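(* The following two statements are equivalent: (A) every planar graph on $n$ vertices contains an induced forest on at least $n/2$ vertices; (B) every planar triangulation $G$ satisfies $\kappa_\rho(G) \geq \frac{1}{2}$.
   Context: A planar triangulation is a simple planar graph to which no edge can be added while keeping it simple and planar (equivalently, a simple graph with an edge-maximal embedding in the plane). For a tree $T$, $\Lambda(T)$ denotes its set of leaves. For a connected graph $G$, $\tau_G$ is the set of spanning trees of $G$. The robust connectivity of $G$ is $\kappa_\rho(G) = \min_{\emptyset \neq R \subseteq V(G)} \max_{T \in \tau_G} \frac{|R \cap \Lambda(T)|}{|R|}$. *)

(* Defs.v *)
From HB Require Import structures.
From mathcomp Require Import all_boot all_order all_algebra.
From mathcomp Require Import all_classical all_reals all_analysis.

Set Implicit Arguments.
Unset Strict Implicit.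
Unset Printing Implicit Defensive.

Import Order.TTheory GRing.Theory Num.Theory.
Import numFieldNormedType.Exports.

Local Open Scope ring_scope.

(* A finite simple graph on the vertex set V is given by its set E of edges, *)
(* each edge being the two-element set of its ends.                          *)

Section Graphs.
Variable V : finType.
Implicit Types (E T : {set {set V}}) (F X : {set V}).

Definition simple_graph E : Prop := forall e, e \in E -> #|e| = 2%N.

Definition adj E : rel V := fun x y => [set x; y] \in E.

Definition connected_graph E : Prop := forall x y : V, connect (adj E) x y.

Definition is_cycle E (c : seq V) : Prop :=
  [/\ (2 < size c)%N, uniq c & cycle (adj E) c].

Definition is_forest E : Prop := forall c : seq V, ~ is_cycle E c.

Definition is_tree E : Prop := connected_graph E /\ is_forest E.

(* The edge set of G[F]. The vertices outside F remain, as isolated vertices; *)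
(* this is immaterial for being a forest.                                     *)
Definition induced_edges E F : {set {set V}} := [set e in E | e \subset F].

Definition induces_forest E F : Prop := is_forest (induced_edges E F).

(* Vertices of degree one; so the one-vertex tree has no leaf. *)
Definition leaves T : {set V} :=
  [set v | #|[set e in T | v \in e]| == 1%N].

Definition spanning_trees E : {set {set {set V}}} :=
  [set T : {set {set V}} | (T \subset E) && `[< is_tree T >]].

(* For a connected graph with at least one vertex both ranges are nonempty and *)
(* the ratios lie in [0, 1], so the default values 1 and 0 play no role.       *)
Definition robust_connectivity E : rat :=
  \big[Order.min/1]_(X : {set V} | X != finset.set0)
    \big[Order.max/0]_(T in spanning_trees E)
      (#|X :&: leaves T|%:R / #|X|%:R).

End Graphs.

Section Planarity.
Local Open Scope classical_set_scope.
Variables (R : realType) (V : finType).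

(* g, restricted to [0, 1], is a Jordan arc in the plane R * R from p to q. *)
Definition is_arc (g : R -> R * R) (p q : R * R) : Prop :=
  [/\ {within `[0, 1], continuous g},
      {in `[0, 1]%R &, injective g}, g 0 = p & g 1 = q].

Definition arc_trace (g : R -> R * R) : set (R * R) :=
  g @` `[0, 1].

Record is_drawing (E : {set {set V}})
    (pos : V -> R * R) (arc : {set V} -> R -> R * R) : Prop := IsDrawing {
  drawing_inj : injective pos;
  drawing_ends : forall e, e \in E ->
    exists x y, e = [set x; y]%SET /\ is_arc (arc e) (pos x) (pos y);
  drawing_vertex : forall e v, e \in E ->
    arc_trace (arc e) (pos v) -> v \in e;
  drawing_cross : forall e f p, e \in E -> f \in E -> e <> f ->
    arc_trace (arc e) p -> arc_trace (arc f) p ->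
    exists2 v, v \in e :&: f & p = pos v
}.

Definition planar (E : {set {set V}}) : Prop :=
  exists pos arc, is_drawing E pos arc.

Definition planar_triangulation (E : {set {set V}}) : Prop :=
  [/\ simple_graph E, planar E &
      forall e : {set V}, #|e| = 2%N -> e \notin E -> ~ planar (e |: E)].

End Planarity.

Arguments planar R {V} E.
Arguments planar_triangulation R {V} E.

(* Main.v *)
Require Import Defs.
From HB Require Import structures.
From mathcomp Require Import all_boot all_order all_algebra.
From mathcomp Require Import all_classical all_reals all_analysis.
From mathcomp Require Import zify ring lra fintype finset.

(* A drawing is discretised to a layout in the square grid: vertices become
   disjoint square balls of lattice points and edges disjoint lattice paths
   joining them; conversely a layout is drawn with radial segments and lattice
   paths. On the grid the Jordan curve theorem is elementary: a closed chain
   colours the unit faces by the parity of the number of horizontal edges above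
   them, and the colour changes exactly across the chain; and if a face
   colouring changes only across a drawn subgraph, the edges where it changes
   form a subgraph with no vertex of degree one, so a drawn forest does not
   separate the faces.

   Hence, if F induces a forest and G - F is disconnected, two components of
   G - F see a common face region and an edge joining them can be drawn. So in a
   triangulation every vertex set whose removal disconnects contains a cycle.
   Conversely this property forces edge-maximality: if uv is not an edge, some
   neighbours of u, all adjacent to the component D of v in G - N(u), contain a
   cycle C, and u, D and C form a K5 minor in G + uv.

   (A) => (B): for a vertex set X, a large induced forest F of G[X] has connected
   and dominating complement, so some spanning tree has all of F as leaves.

   (B) => (A): put a new vertex on both sides of every edge of the drawing, and
   add edges as long as the new vertices stay separated by the cycles of G; the
   result is a triangulation. The old vertices that are leaves of a spanning tree
   induce a forest: a cycle of such leaves would separate two new vertices, but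
   the tree path joining them avoids its leaves. *)

Set Implicit Arguments.
Unset Strict Implicit.
Unset Printing Implicit Defensive.

Import Order.TTheory GRing.Theory Num.Theory.
Import numFieldNormedType.Exports.

Local Open Scope ring_scope.

(** * Edges and faces of the square grid *)

Definition gpoint := (int * int)%type.

Section Grid.
Implicit Types (p q o f g : gpoint) (s : seq gpoint) (r : int).
Implicit Types (col : gpoint -> bool) (K : rel gpoint).

Definition gadj p q : bool := `|p.1 - q.1| + `|p.2 - q.2| == 1.

Definition gneighbours p : seq gpoint :=
  [:: (p.1, p.2 + 1); (p.1 + 1, p.2); (p.1, p.2 - 1); (p.1 - 1, p.2)].

Lemma gadjC p q : gadj p q = gadj q p.
Proof. by rewrite /gadj !(distrC (p.1)) (distrC (p.2)). Qed.

Lemma gadjxx p : gadj p p = false.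
Proof. by rewrite /gadj !subrr. Qed.

Lemma gadjE p q : gadj p q = (q \in gneighbours p).
Proof. by case: p q => [x y] [x' y']; rewrite /gadj !inE !xpair_eqE /=; lia. Qed.

Lemma gneighbours_uniq p : uniq (gneighbours p).
Proof. by rewrite /= !inE !xpair_eqE; lia. Qed.

Lemma gadj_north x y : gadj (x, y) (x, y + 1).
Proof. by rewrite gadjE !inE eqxx. Qed.

Lemma gadj_east x y : gadj (x, y) (x + 1, y).
Proof. by rewrite gadjE !inE eqxx !orbT. Qed.

Lemma gadj_ind (P : gpoint -> gpoint -> Prop) :
  (forall p q, gadj p q -> P p q -> P q p) ->
  (forall x y, P (x, y) (x, y + 1)) -> (forall x y, P (x, y) (x + 1, y)) ->
  forall p q, gadj p q -> P p q.
Proof.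
move=> symP northP eastP [x y] q; rewrite gadjE !inE /=.
case/or4P => /eqP -> //; apply: symP; rewrite ?gadjE ?inE ?subrK ?eqxx ?orbT //.
  by have := northP x (y - 1); rewrite subrK.
by have := eastP (x - 1) y; rewrite subrK.
Qed.

(* A face is a unit square of the grid, named by its lower left corner. *)
Definition low_side p q : gpoint :=
  if p.1 == q.1 then (p.1 - 1, Order.min p.2 q.2) else (Order.min p.1 q.1, p.2 - 1).

Definition high_side p q : gpoint := (Order.min p.1 q.1, Order.min p.2 q.2).

Definition sides p q : seq gpoint := [:: low_side p q; high_side p q].

Lemma sidesC p q : gadj p q -> sides p q = sides q p.
Proof.
move=> adj_pq; rewrite /sides /low_side /high_side [q.1 == _]eq_sym.
rewrite ![Order.min q.1 _]minC ![Order.min q.2 _]minC.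
by case: eqP => [->//|neq_x]; have -> : q.2 = p.2 by move: adj_pq; rewrite /gadj; lia.
Qed.

Lemma sides_north x y : sides (x, y) (x, y + 1) = [:: (x - 1, y); (x, y)].
Proof. by rewrite /sides /low_side /high_side /= eqxx minxx min_l ?lerDl. Qed.

Lemma sides_east x y : sides (x, y) (x + 1, y) = [:: (x, y - 1); (x, y)].
Proof.
rewrite /sides /low_side /high_side /= minxx min_l ?lerDl //.
by case: eqP => //; lia.
Qed.

Lemma low_side_in p q : low_side p q \in sides p q.
Proof. exact: mem_head. Qed.

Lemma high_side_in p q : high_side p q \in sides p q.
Proof. by rewrite !inE eqxx orbT. Qed.

Definition corner f p : bool := (p.1 - 1 <= f.1 <= p.1) && (p.2 - 1 <= f.2 <= p.2).

Lemma cornerE f p :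
  corner f p = (f \in [:: p; (p.1 - 1, p.2); (p.1, p.2 - 1); (p.1 - 1, p.2 - 1)]).
Proof. by case: f p => [a b] [x y]; rewrite /corner !inE !xpair_eqE /=; lia. Qed.

Lemma side_corner p q f : gadj p q -> f \in sides p q -> corner f p && corner f q.
Proof.
move: p q; apply: gadj_ind => [p q adj_pq|x y|x y].
- by rewrite sidesC // andbC.
- by rewrite sides_north !inE => /orP[] /eqP ->; rewrite /corner /=; lia.
- by rewrite sides_east !inE => /orP[] /eqP ->; rewrite /corner /=; lia.
Qed.

(** * Colourings of the faces *)

Definition jump col p q : bool := col (low_side p q) (+) col (high_side p q).

Lemma jumpE col p q f g : sides p q = [:: f; g] -> jump col p q = col f (+) col g.
Proof. by rewrite /jump /sides => -[-> ->]. Qed.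

Lemma jumpC col p q : gadj p q -> jump col p q = jump col q p.
Proof. by move=> adj_pq; exact: jumpE (sidesC adj_pq). Qed.

Lemma jump_north col x y : jump col (x, y) (x, y + 1) = col (x - 1, y) (+) col (x, y).
Proof. exact: jumpE (sides_north x y). Qed.

Lemma jump_east col x y : jump col (x, y) (x + 1, y) = col (x, y - 1) (+) col (x, y).
Proof. exact: jumpE (sides_east x y). Qed.

Lemma jump_south col x y :
  jump col (x, y) (x, y - 1) = col (x - 1, y - 1) (+) col (x, y - 1).
Proof.
rewrite jumpC; first by rewrite -(jump_north col x (y - 1)) subrK.
by rewrite gadjE !inE eqxx !orbT.
Qed.

Lemma jump_west col x y :
  jump col (x, y) (x - 1, y) = col (x - 1, y - 1) (+) col (x - 1, y).
Proof.
rewrite jumpC; first by rewrite -(jump_east col (x - 1) y) subrK.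
by rewrite gadjE !inE eqxx !orbT.
Qed.

Lemma no_jump_sides col p q f g :
  ~~ jump col p q -> f \in sides p q -> g \in sides p q -> col f = col g.
Proof.
rewrite /jump !inE => same_col /orP[] /eqP -> /orP[] /eqP -> //;
by case: (col _) (col _) same_col => -[].
Qed.

Lemma jump_around col p : \big[addb/false]_(q <- gneighbours p) jump col p q = false.
Proof.
case: p => x y; rewrite !big_cons big_nil /= jump_north jump_east jump_south jump_west.
by case: (col _) (col _) (col _) (col _) => -[] [] [].
Qed.

Lemma jump_through col p a b : gadj p a -> gadj p b -> a != b ->
  (forall q, gadj p q -> q != a -> q != b -> ~~ jump col p q) ->
  jump col p a = jump col p b.
Proof.
rewrite !gadjE => a_nbr b_nbr neq_ab other; have := jump_around col p.
have b_rest : b \in [seq q <- gneighbours p | q != a] by rewrite mem_filter eq_sym neq_ab.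
rewrite (bigD1_seq a) ?gneighbours_uniq // -big_filter.
rewrite (bigD1_seq b b_rest) ?filter_uniq ?gneighbours_uniq //.
rewrite big1_seq ?addbF; first by case: (jump _ _ _) (jump _ _ _) => -[].
move=> q; rewrite mem_filter -gadjE => /and3P[neq_qb neq_qa adj_pq].
by apply/negbTE/other.
Qed.

Lemma corner_const col p a f g :
  (forall q, gadj p q -> q != a -> ~~ jump col p q) ->
  corner f p -> corner g p -> col f = col g.
Proof.
move=> other; suff {f g} const f : corner f p -> col f = col p.
  by move=> /const -> /const ->.
have no_jump q : gadj p q -> ~~ jump col p q.
  move=> adj_pq; have [eq_qa|] := eqVneq q a; last exact: other.
  have := jump_around col p; rewrite -eq_qa in other *.
  rewrite (bigD1_seq q) ?gneighbours_uniq -?gadjE //= big1_seq ?addbF => [-> //|q'].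
  by rewrite -gadjE => /andP[neq_q' adj_pq']; apply/negbTE/other.
case: p no_jump {other} => x y no_jump; rewrite cornerE !inE /=.
have := no_jump (x, y + 1); rewrite gadj_north jump_north => /(_ isT).
have := no_jump (x + 1, y); rewrite gadj_east jump_east => /(_ isT).
have := no_jump (x - 1, y); rewrite gadjE !inE eqxx !orbT jump_west => /(_ isT).
by move=> W E N /or4P[] /eqP -> //; move: N E W;
  case: (col _) (col _) (col _) (col _) => -[] [] [].
Qed.

Definition jumps_in K col : Prop :=
  forall p q, gadj p q -> jump col p q -> K p q.

Definition untouched K p : Prop := forall q, gadj p q -> ~~ K p q.

Lemma jumps_in_corner K col p f g : jumps_in K col -> untouched K p ->
  corner f p -> corner g p -> col f = col g.
Proof.
move=> col_K p_free; apply: (@corner_const _ _ p) => q adj_pq _.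
by apply: contra (p_free q adj_pq); exact: col_K.
Qed.

Lemma corner_self p : corner p p.
Proof. by rewrite cornerE mem_head. Qed.

Lemma jumps_in_walk K col p s : jumps_in K col -> path gadj p s ->
  {in p :: s, forall q, untouched K q} -> col p = col (last p s).
Proof.
move=> col_K; elim: s p => [|q s IH] p //= /andP[adj_pq path_s] free.
have /andP[corner_p corner_q] := side_corner adj_pq (high_side_in p q).
transitivity (col (high_side p q)).
  by apply: jumps_in_corner col_K (free p (mem_head _ _)) (corner_self p) corner_p.
rewrite -IH //; last by move=> z zs; apply: free; rewrite inE zs orbT.
apply: jumps_in_corner col_K (free q _) corner_q (corner_self q).
by rewrite !inE eqxx orbT.
Qed.

Lemma row_const col a b y : a <= b ->
  (forall x, a < x <= b -> ~~ jump col (x, y) (x, y + 1)) -> col (a, y) = col (b, y).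
Proof.
move=> le_ab; have [n ->] : exists n : nat, b = a + n%:Z by exists `|b - a|%N; lia.
elim: n => [|n IH] no_jump; first by rewrite addr0.
rewrite IH => [|x x_in]; last by apply: no_jump; lia.
have := no_jump (a + n.+1%:Z); rewrite jump_north -addn1 PoszD addrA addrK => step.
by apply/eqP; rewrite -negb_add; apply: step; lia.
Qed.

Lemma column_const col a b x : a <= b ->
  (forall y, a < y <= b -> ~~ jump col (x, y) (x + 1, y)) -> col (x, a) = col (x, b).
Proof.
move=> le_ab no_jump; apply: (@row_const (fun p => col (p.2, p.1))) => // y y_in.
by have := no_jump y y_in; rewrite jump_north jump_east.
Qed.

Lemma col_const col : (forall p q, gadj p q -> ~~ jump col p q) ->
  forall f g, col f = col g.
Proof.
move=> no_jump; suff {}const f : col f = col (0, 0) by move=> f g; rewrite !const.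
have row a b y : col (a, y) = col (b, y).
  wlog le_ab : a b / a <= b => [hwlog|].
    by case/orP: (le_total a b) => [|/hwlog]; [exact: hwlog | exact: esym].
  by apply: row_const => // x _; apply/no_jump/gadj_north.
have column a b x : col (x, a) = col (x, b).
  wlog le_ab : a b / a <= b => [hwlog|].
    by case/orP: (le_total a b) => [|/hwlog]; [exact: hwlog | exact: esym].
  by apply: column_const => // y _; apply/no_jump/gadj_east.
by case: f => x y; rewrite (row x 0) (column y 0).
Qed.

(** * Walks and their parity *)

Definition steps (T : Type) (s : seq T) : seq (T * T) := zip s (behead s).

Definition walk_edge s p q : bool := ((p, q) \in steps s) || ((q, p) \in steps s).

Lemma steps_cons (T : Type) (x y : T) t : steps (x :: y :: t) = (x, y) :: steps (y :: t).
Proof. by []. Qed.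

Lemma steps_cat (T : Type) (x : T) t1 t2 :
  steps (x :: t1 ++ t2) = steps (x :: t1) ++ steps (last x t1 :: t2).
Proof. by elim: t1 x => [|y t1 IH] x //; rewrite cat_cons !steps_cons IH. Qed.

Lemma mem_steps (T : eqType) (t : seq T) x y : (x, y) \in steps t -> (x \in t) && (y \in t).
Proof.
elim: t => [|a [|b t] IH] //; rewrite steps_cons in_cons => /orP[/eqP[-> ->]|/IH /andP[xt yt]].
  by rewrite !inE !eqxx !orbT.
by rewrite ![_ \in a :: _]in_cons xt yt !orbT.
Qed.

Lemma stepsP (T : eqType) (t : seq T) x y :
  reflect (exists t1 t2, t = t1 ++ [:: x, y & t2]) ((x, y) \in steps t).
Proof.
apply: (iffP idP) => [|[t1 [t2 ->]]].
  elim: t => [|a [|b t] IH] //; rewrite steps_cons in_cons.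
  case/orP=> [/eqP[-> ->]|/IH[t1 [t2 ->]]]; first by exists [::], t.
  by exists (a :: t1), t2.
case: t1 => [|a t1]; first by rewrite steps_cons mem_head.
by rewrite cat_cons steps_cat mem_cat !steps_cons !in_cons eqxx !orbT.
Qed.

Lemma steps_sorted (T : eqType) (e : rel T) (t : seq T) x y :
  sorted e t -> (x, y) \in steps t -> e x y.
Proof.
elim: t => [|a [|b t] IH] // /andP[eab sorted_t].
by rewrite steps_cons in_cons => /orP[/eqP[-> ->] //|]; exact: IH.
Qed.

Lemma walk_edgeC s p q : walk_edge s p q = walk_edge s q p.
Proof. exact: orbC. Qed.

Lemma walk_edge_mem s p q : walk_edge s p q -> (p \in s) && (q \in s).
Proof. by case/orP=> /mem_steps //; rewrite andbC. Qed.

Lemma walk_edge_gadj s p q : sorted gadj s -> walk_edge s p q -> gadj p q.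
Proof. by move=> s_walk /orP[] /(steps_sorted s_walk); rewrite // gadjC. Qed.

Lemma walk_edge_rev s p q : walk_edge (rev s) p q = walk_edge s p q.
Proof.
have rev_steps t a b : (a, b) \in steps t -> (b, a) \in steps (rev t).
  case/stepsP=> t1 [t2 ->]; rewrite rev_cat !rev_cons -!cats1 -!catA /=.
  by apply/stepsP; exists (rev t2), (rev t1).
suff rev_edge t a b : walk_edge t a b -> walk_edge (rev t) a b.
  by apply/idP/idP => /rev_edge; rewrite ?revK.
by case/orP => /rev_steps ab_rev; apply/orP; [right|left].
Qed.

Lemma walk_edge_cat p s1 s2 a b : walk_edge (p :: s1 ++ s2) a b =
  walk_edge (p :: s1) a b || walk_edge (last p s1 :: s2) a b.
Proof. by rewrite /walk_edge steps_cat !mem_cat orbACA. Qed.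

Lemma uniq_split (T : eqType) (t1 t2 t3 t4 : seq T) x :
  uniq (t1 ++ x :: t2) -> t1 ++ x :: t2 = t3 ++ x :: t4 -> t1 = t3 /\ t2 = t4.
Proof.
have idx (u1 u2 : seq T) : uniq (u1 ++ x :: u2) -> index x (u1 ++ x :: u2) = size u1.
  rewrite cat_uniq => /and3P[_ /hasPn disj _]; rewrite index_cat ifF ?index_head ?addn0 //.
  by apply/negbTE; apply: (disj x); rewrite mem_head.
move=> uniq_t eq_t; have eq_size : size t1 = size t3 by rewrite -(idx _ _ uniq_t) eq_t idx // -eq_t.
by move/eqP: eq_t; rewrite eqseq_cat // eqseq_cons eqxx /= => /andP[/eqP -> /eqP ->].
Qed.

Lemma steps_uniq_next (T : eqType) (t1 t2 : seq T) x y z : uniq (t1 ++ [:: x, y & t2]) ->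
  (x, z) \in steps (t1 ++ [:: x, y & t2]) -> z = y.
Proof.
move=> uniq_t /stepsP[t3 [t4 eq_t]].
by have [_ [->]] := uniq_split uniq_t eq_t.
Qed.

Lemma steps_uniq_prev (T : eqType) (t1 t2 : seq T) x y z : uniq (t1 ++ [:: x, y & t2]) ->
  (z, y) \in steps (t1 ++ [:: x, y & t2]) -> z = x.
Proof.
move=> uniq_t /stepsP[t3 [t4]]; rewrite -!(cat_rcons _ _ (_ :: _)) => eq_t.
by move: uniq_t; rewrite -cat_rcons => /uniq_split /(_ eq_t) [/rcons_inj[_ ->]].
Qed.

Lemma walk_edge_interior s1 s2 a z b q : uniq (s1 ++ [:: a, z, b & s2]) ->
  walk_edge (s1 ++ [:: a, z, b & s2]) z q -> q \in [:: a; b].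
Proof.
move=> uniq_s /orP[].
  by rewrite -cat_rcons in uniq_s * => /(steps_uniq_next uniq_s) ->; rewrite !inE eqxx orbT.
by move/(steps_uniq_prev uniq_s) ->; rewrite !inE eqxx.
Qed.

Lemma walk_edge_first p q s z : uniq [:: p, q & s] -> walk_edge [:: p, q & s] p z -> z = q.
Proof.
move=> uniq_s /orP[|/stepsP[[|a s1] [s2 []]]].
- exact: (@steps_uniq_next _ [::] s).
- by move=> _ eq_pq; move: uniq_s; rewrite eq_pq /= mem_head.
by move=> _ eq_s; move: uniq_s; rewrite eq_s /= mem_cat !inE eqxx !orbT.
Qed.

Lemma walk_edge_last p q s z : uniq (rcons (rcons s q) p) ->
  walk_edge (rcons (rcons s q) p) p z -> z = q.
Proof. by rewrite -rev_uniq -walk_edge_rev !rev_rcons; exact: walk_edge_first. Qed.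

Definition odd_edge s p q : bool := odd (count (mem [:: (p, q); (q, p)]) (steps s)).

Lemma odd_edgeC s p q : odd_edge s p q = odd_edge s q p.
Proof. by congr odd; apply: eq_count => st; rewrite /= !inE orbC. Qed.

Lemma odd_edge_cat p s1 s2 a b :
  odd_edge (p :: s1 ++ s2) a b = odd_edge (p :: s1) a b (+) odd_edge (last p s1 :: s2) a b.
Proof. by rewrite /odd_edge steps_cat count_cat oddD. Qed.

Lemma odd_edge_off s p q : ~~ walk_edge s p q -> odd_edge s p q = false.
Proof.
rewrite negb_or => /andP[pq_off qp_off]; rewrite /odd_edge (_ : count _ _ = 0%N) //.
apply/eqP; rewrite -leqn0 leqNgt -has_count; apply/hasPn => st st_in.
by rewrite /= !inE negb_or; apply/andP; split;
  [apply: contraNneq pq_off => <-|apply: contraNneq qp_off => <-].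
Qed.

Lemma walk_edge_cons a b s p q :
  walk_edge [:: a, b & s] p q = ((a, b) \in [:: (p, q); (q, p)]) || walk_edge (b :: s) p q.
Proof. by rewrite /walk_edge steps_cons !in_cons in_nil orbF ![_ == (a, b)]eq_sym orbACA. Qed.

Lemma odd_edge_cons a b s p q :
  odd_edge [:: a, b & s] p q = ((a, b) \in [:: (p, q); (q, p)]) (+) odd_edge (b :: s) p q.
Proof. by rewrite /odd_edge steps_cons [count _ _]/= oddD oddb. Qed.

Lemma odd_edge_uniq s p q : uniq s -> walk_edge s p q -> odd_edge s p q.
Proof.
elim: s => [|a [|b s] IH] //; rewrite cons_uniq => /andP[a_off uniq_bs].
rewrite walk_edge_cons odd_edge_cons; have [ab_pq _|_] := boolP (_ \in _); last exact: IH.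
rewrite odd_edge_off //; apply: contra a_off => /walk_edge_mem /andP[p_in q_in].
by move: ab_pq; rewrite !inE => /orP[] /eqP[-> _].
Qed.

Definition above f (st : gpoint * gpoint) : bool :=
  [&& st.1.2 == st.2.2, f.2 < st.1.2 & f.1 == Order.min st.1.1 st.2.1].

Definition parity_above s f : bool := odd (count (above f) (steps s)).

Definition end_parity (h : gpoint -> bool) s : bool := h (head 0 s) (+) h (last 0 s).

Lemma above_vert x y p q : gadj p q ->
  above (x - 1, y) (p, q) (+) above (x, y) (p, q) =
  ((p, q) \in [:: ((x, y), (x, y + 1)); ((x, y + 1), (x, y))])
    (+) (((p.1 == x) && (y < p.2)) (+) ((q.1 == x) && (y < q.2))).
Proof.
case: p q => [a b] q; rewrite gadjE !inE => /or4P[] /eqP ->; rewrite /above !xpair_eqE /=;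
by apply/eqP; rewrite -negb_add; lia.
Qed.

Lemma above_hor x y p q : gadj p q ->
  above (x, y - 1) (p, q) (+) above (x, y) (p, q) =
  ((p, q) \in [:: ((x, y), (x + 1, y)); ((x + 1, y), (x, y))]).
Proof.
case: p q => [a b] q; rewrite gadjE !inE => /or4P[] /eqP ->; rewrite /above !xpair_eqE /=;
by apply/eqP; rewrite -negb_add; lia.
Qed.

Lemma parity_above_cons a b s f :
  parity_above [:: a, b & s] f = above f (a, b) (+) parity_above (b :: s) f.
Proof. by rewrite /parity_above steps_cons [count _ _]/= oddD oddb. Qed.

Lemma jump_parity_north x y s : sorted gadj s ->
  jump (parity_above s) (x, y) (x, y + 1) =
  odd_edge s (x, y) (x, y + 1) (+) end_parity (fun p => (p.1 == x) && (y < p.2)) s.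
Proof.
rewrite jump_north; case: s => [|p s]; first by rewrite /end_parity /= addbb.
elim: s p => [|q s IH] p; first by rewrite /end_parity /= addbb.
move=> /andP[adj_pq s_walk]; rewrite !parity_above_cons odd_edge_cons addbACA IH //.
rewrite (above_vert x y adj_pq) /end_parity /= addbACA; congr (_ (+) _).
by rewrite -addbA addKb.
Qed.

Lemma jump_parity_east x y s : sorted gadj s ->
  jump (parity_above s) (x, y) (x + 1, y) = odd_edge s (x, y) (x + 1, y).
Proof.
rewrite jump_east; case: s => [|p s] //; elim: s p => [|q s IH] p //.
move=> /andP[adj_pq s_walk]; rewrite !parity_above_cons odd_edge_cons addbACA IH //.
by rewrite above_hor.
Qed.

Section ParitySum.
Variables (I : eqType) (walk : I -> seq gpoint) (t : seq I).

Definition parity_sum f : bool := \big[addb/false]_(i <- t) parity_above (walk i) f.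

Definition closed_walks : Prop :=
  forall h, \big[addb/false]_(i <- t) end_parity h (walk i) = false.

Hypothesis walk_sorted : {in t, forall i, sorted gadj (walk i)}.
Hypothesis walk_closed : closed_walks.

Lemma jump_parity_sum p q : gadj p q ->
  jump parity_sum p q = \big[addb/false]_(i <- t) odd_edge (walk i) p q.
Proof.
move: p q; apply: gadj_ind => [p q adj_pq|x y|x y].
- rewrite jumpC // => ->; apply: eq_bigr => i _; exact: odd_edgeC.
- rewrite jump_north -big_split -[RHS]addbF.
  rewrite -[X in _ = _ (+) X](walk_closed (fun p => (p.1 == x) && (y < p.2))) -big_split /=.
  by apply: eq_big_seq => i it; rewrite -jump_north jump_parity_north ?walk_sorted.
rewrite jump_east -big_split /=.
by apply: eq_big_seq => i it; rewrite -jump_east jump_parity_east ?walk_sorted.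
Qed.

Lemma jumps_in_parity_sum K :
  (forall i p q, i \in t -> walk_edge (walk i) p q -> K p q) -> jumps_in K parity_sum.
Proof.
move=> walk_K p q adj_pq; apply: contraLR => notK; rewrite jump_parity_sum // big1_seq // => i it.
by apply: odd_edge_off; apply: contra notK; exact: walk_K.
Qed.

End ParitySum.

(** * Square balls *)

Definition gdist p q : int := Order.max `|p.1 - q.1| `|p.2 - q.2|.

Definition in_ball o r p : bool := gdist p o <= r.

Definition on_sphere o r p : bool := gdist p o == r.

Definition face_in_ball o r f : bool :=
  (o.1 - r <= f.1 < o.1 + r) && (o.2 - r <= f.2 < o.2 + r).

Lemma in_ballE o r p :
  in_ball o r p = (o.1 - r <= p.1 <= o.1 + r) && (o.2 - r <= p.2 <= o.2 + r).
Proof. by rewrite /in_ball /gdist ge_max !ler_distl. Qed.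

Lemma in_ball_centre o r : 0 <= r -> in_ball o r o.
Proof. by rewrite in_ballE; lia. Qed.

Lemma in_ball_neighbour o r p : 1 <= r -> in_ball o r p ->
  exists2 q, gadj p q & in_ball o r q.
Proof.
case: p => x y r_ge1 p_in; have [le_o|lt_o] := lerP o.1 x.
  by exists (x - 1, y); rewrite ?gadjE ?inE ?eqxx ?orbT //; move: p_in; rewrite !in_ballE /=; lia.
by exists (x + 1, y); rewrite ?gadj_east //; move: p_in; rewrite !in_ballE /=; lia.
Qed.

Lemma on_sphere_exit o r p q : in_ball o r p -> ~~ in_ball o r q -> gadj p q -> on_sphere o r p.
Proof. by rewrite /in_ball /on_sphere /gdist /gadj; lia. Qed.

Lemma face_in_ball_corner o r f p : face_in_ball o r f -> corner f p -> in_ball o r p.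
Proof. by rewrite /face_in_ball /corner in_ballE; lia. Qed.

Lemma side_out_of_ball o r p q f : gadj p q -> ~~ (in_ball o r p && in_ball o r q) ->
  f \in sides p q -> ~~ face_in_ball o r f.
Proof.
move=> adj_pq not_in /(side_corner adj_pq) /andP[fp fq].
by apply: contra not_in => f_in; rewrite !(face_in_ball_corner f_in).
Qed.

Definition in_box p q z : bool :=
  (Order.min p.1 q.1 <= z.1 <= Order.max p.1 q.1) &&
  (Order.min p.2 q.2 <= z.2 <= Order.max p.2 q.2).

Lemma in_box_ball o r p q z : in_ball o r p -> in_ball o r q -> in_box p q z -> in_ball o r z.
Proof. by case: o p q z => [a b] [c d] [e f] [g h]; rewrite !in_ballE /in_box /=; lia. Qed.

Lemma box_walk p q : exists s,
  [/\ path gadj p s, last p s = q & {in p :: s, forall z, in_box p q z}].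
Proof.
have [n] := ubnP (absz (p.1 - q.1) + absz (p.2 - q.2)).
case: q => x' y'; elim: n p => // n IH [x y]; rewrite ltnS /= => dist_n.
have step a b : gadj (x, y) (a, b) -> in_box (x, y) (x', y') (a, b) ->
    (absz (a - x') + absz (b - y') < absz (x - x') + absz (y - y'))%N ->
    exists s, [/\ path gadj (x, y) s, last (x, y) s = (x', y') &
      {in (x, y) :: s, forall z, in_box (x, y) (x', y') z}].
  move=> adj_ab in_ab closer; have [s [walk_s last_s box_s]] := IH (a, b) (leq_trans closer dist_n).
  exists ((a, b) :: s); split; rewrite /= ?adj_ab // => -[c d].
  rewrite inE => /orP[/eqP[-> ->]|/box_s]; first by rewrite /in_box /=; lia.
  by move: in_ab; rewrite /in_box /=; lia.
have [lt_x|lt_x|eq_x] := ltrgtP x x'.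
- by apply: (step (x + 1) y); rewrite /gadj /in_box /=; lia.
- by apply: (step (x - 1) y); rewrite /gadj /in_box /=; lia.
have [lt_y|lt_y|eq_y] := ltrgtP y y'.
- by apply: (step x (y + 1)); rewrite /gadj /in_box /=; lia.
- by apply: (step x (y - 1)); rewrite /gadj /in_box /=; lia.
exists [::]; rewrite eq_x eq_y; split=> // z; rewrite inE => /eqP ->.
by rewrite /in_box /=; lia.
Qed.

Lemma ball_walk o r p q : in_ball o r p -> in_ball o r q -> exists s,
  [/\ path gadj p s, last p s = q & {in p :: s, forall z, in_ball o r z}].
Proof.
move=> p_in q_in; have [s [walk_s last_s box_s]] := box_walk p q.
by exists s; split=> // z /box_s; exact: in_box_ball.
Qed.

Section Ring.
Variables (col : gpoint -> bool) (o : gpoint) (r : int) (X : rel gpoint).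
Local Notation x0 := (o.1 - r).
Local Notation x1 := (o.1 + r).
Local Notation y0 := (o.2 - r).
Local Notation y1 := (o.2 + r).

Hypothesis exit_jump : forall p q,
  in_ball o r p -> ~~ in_ball o r q -> gadj p q -> jump col p q -> X p q.

Lemma ring_top a b : x0 - 1 <= a <= b -> b <= x1 ->
  (forall x, a < x <= b -> ~~ X (x, y1) (x, y1 + 1)) -> col (a, y1) = col (b, y1).
Proof.
move=> a_ge b_le noX; apply: row_const => [|x x_in]; first by case/andP: a_ge.
by apply: contra (noX x x_in); apply: exit_jump; rewrite ?gadj_north // in_ballE /=; lia.
Qed.

Lemma ring_bottom a b : x0 - 1 <= a <= b -> b <= x1 ->
  (forall x, a < x <= b -> ~~ X (x, y0) (x, y0 - 1)) -> col (a, y0 - 1) = col (b, y0 - 1).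
Proof.
move=> a_ge b_le noX; apply: row_const => [|x x_in]; first by case/andP: a_ge.
rewrite jumpC ?gadj_north // subrK; apply: contra (noX x x_in).
by apply: exit_jump; rewrite ?gadjE ?inE ?eqxx ?orbT // in_ballE /=; lia.
Qed.

Lemma ring_right a b : y0 - 1 <= a <= b -> b <= y1 ->
  (forall y, a < y <= b -> ~~ X (x1, y) (x1 + 1, y)) -> col (x1, a) = col (x1, b).
Proof.
move=> a_ge b_le noX; apply: column_const => [|y y_in]; first by case/andP: a_ge.
by apply: contra (noX y y_in); apply: exit_jump; rewrite ?gadj_east // in_ballE /=; lia.
Qed.

Lemma ring_left a b : y0 - 1 <= a <= b -> b <= y1 ->
  (forall y, a < y <= b -> ~~ X (x0, y) (x0 - 1, y)) -> col (x0 - 1, a) = col (x0 - 1, b).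
Proof.
move=> a_ge b_le noX; apply: column_const => [|y y_in]; first by case/andP: a_ge.
rewrite jumpC ?gadj_east // subrK; apply: contra (noX y y_in).
by apply: exit_jump; rewrite ?gadjE ?inE ?eqxx ?orbT // in_ballE /=; lia.
Qed.

End Ring.

Lemma ring_const col o r f p :
  (forall p q, in_ball o r p -> ~~ in_ball o r q -> gadj p q -> ~~ jump col p q) ->
  ~~ face_in_ball o r f -> in_ball o r p -> corner f p ->
  col f = col (o.1 - r - 1, o.2 - r - 1).
Proof.
move=> no_jump f_out p_in fp.
have exit_jump p' q' : in_ball o r p' -> ~~ in_ball o r q' -> gadj p' q' ->
    jump col p' q' -> false.
  by move=> p'_in q'_out adj'; apply: contraLR => _; exact: no_jump.
case: f f_out fp => x y f_out fp.
have [x_in y_in r_ge0] : [/\ o.1 - r - 1 <= x <= o.1 + r, o.2 - r - 1 <= y <= o.2 + r & 0 <= r].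
  by move: p_in fp; rewrite in_ballE /corner /=; split; lia.
have : [|| x == o.1 - r - 1, x == o.1 + r, y == o.2 - r - 1 | y == o.2 + r].
  by move: f_out; rewrite /face_in_ball /=; lia.
case/or4P => /eqP ->.
- by rewrite -(ring_left exit_jump (a := o.2 - r - 1) (b := y)) //; lia.
- rewrite -(ring_right exit_jump (a := o.2 - r - 1) (b := y)) //; try lia.
  by rewrite -(ring_bottom exit_jump (a := o.1 - r - 1) (b := o.1 + r)) //; lia.
- by rewrite -(ring_bottom exit_jump (a := o.1 - r - 1) (b := x)) //; lia.
rewrite -(ring_top exit_jump (a := o.1 - r - 1) (b := x)) //; try lia.
by rewrite -(ring_left exit_jump (a := o.2 - r - 1) (b := o.2 + r)) //; lia.
Qed.

(* The faces around a ball form a cycle, along which the colour cannot change just once. *)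
Lemma no_single_exit_jump col o r p0 q0 :
  in_ball o r p0 -> ~~ in_ball o r q0 -> gadj p0 q0 ->
  (forall p q, in_ball o r p -> ~~ in_ball o r q -> gadj p q -> jump col p q ->
     (p, q) = (p0, q0)) ->
  ~~ jump col p0 q0.
Proof.
move=> p0_in q0_out adj0 only0.
have exit_jump p q : in_ball o r p -> ~~ in_ball o r q -> gadj p q -> jump col p q ->
  (p, q) == (p0, q0) by move=> p_in q_out adj_pq jpq; apply/eqP/only0.
have top := ring_top exit_jump; have bottom := ring_bottom exit_jump.
have left := ring_left exit_jump; have right := ring_right exit_jump.
case: p0 {only0 exit_jump} p0_in q0_out adj0 top bottom left right => x y.
rewrite !in_ballE gadjE !inE /= => p0_in q0_out /or4P[] /eqP eq_q;
  move: q0_out; rewrite {}eq_q /= => q0_out top bottom left right.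
- have ey : y = o.2 + r by lia.
  rewrite jump_north ey negb_add; apply/eqP.
  transitivity (col (o.1 - r - 1, o.2 + r)); last transitivity (col (o.1 + r, o.2 + r)).
  + by symmetry; apply: top => [||z z_in]; rewrite ?xpair_eqE; lia.
  + by rewrite -(left (o.2 - r - 1)) -?(right (o.2 - r - 1)) -?(bottom (o.1 - r - 1) (o.1 + r)) //;
      first [lia | move=> z z_in; rewrite !xpair_eqE; lia].
  by symmetry; apply: top => [||z z_in]; rewrite ?xpair_eqE; lia.
- have ex : x = o.1 + r by lia.
  rewrite jump_east ex negb_add; apply/eqP.
  transitivity (col (o.1 + r, o.2 - r - 1)); last transitivity (col (o.1 + r, o.2 + r)).
  + by symmetry; apply: right => [||z z_in]; rewrite ?xpair_eqE; lia.
  + by rewrite -(bottom (o.1 - r - 1)) -?(top (o.1 - r - 1)) -?(left (o.2 - r - 1) (o.2 + r)) //;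
      first [lia | move=> z z_in; rewrite !xpair_eqE; lia].
  by symmetry; apply: right => [||z z_in]; rewrite ?xpair_eqE; lia.
- have ey : y = o.2 - r by lia.
  rewrite jump_south ey negb_add; apply/eqP.
  transitivity (col (o.1 - r - 1, o.2 - r - 1)); last transitivity (col (o.1 + r, o.2 - r - 1)).
  + by symmetry; apply: bottom => [||z z_in]; rewrite ?xpair_eqE; lia.
  + by rewrite (left (o.2 - r - 1) (o.2 + r)) ?(right (o.2 - r - 1) (o.2 + r))
      -?(top (o.1 - r - 1) (o.1 + r)) //;
      first [lia | move=> z z_in; rewrite !xpair_eqE; lia].
  by symmetry; apply: bottom => [||z z_in]; rewrite ?xpair_eqE; lia.
- have ex : x = o.1 - r by lia.
  rewrite jump_west ex negb_add; apply/eqP.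
  transitivity (col (o.1 - r - 1, o.2 - r - 1)); last transitivity (col (o.1 - r - 1, o.2 + r)).
  + by symmetry; apply: left => [||z z_in]; rewrite ?xpair_eqE; lia.
  + by rewrite (bottom (o.1 - r - 1) (o.1 + r)) ?(top (o.1 - r - 1) (o.1 + r))
      -?(right (o.2 - r - 1) (o.2 + r)) //;
      first [lia | move=> z z_in; rewrite !xpair_eqE; lia].
  by symmetry; apply: left => [||z z_in]; rewrite ?xpair_eqE; lia.
Qed.

(** * Reachability between faces *)

Inductive reach K f : gpoint -> Prop :=
| reach_refl : reach K f f
| reach_step g h p q : reach K f g -> gadj p q -> ~~ K p q ->
    g \in sides p q -> h \in sides p q -> reach K f h.

Lemma reach_across K p q f g : gadj p q -> ~~ K p q ->
  f \in sides p q -> g \in sides p q -> reach K f g.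
Proof. exact/reach_step/reach_refl. Qed.

Lemma reach_trans K g f h : reach K f g -> reach K g h -> reach K f h.
Proof. by move=> fg; elim=> // g' h' p q _ fg' adj_pq notK; exact: reach_step fg' adj_pq notK. Qed.

Lemma reach_sym K f g : reach K f g -> reach K g f.
Proof.
elim=> [|g' h p q _ IH adj_pq notK g'_side h_side]; first exact: reach_refl.
exact: reach_trans (reach_across adj_pq notK h_side g'_side) IH.
Qed.

Definition reached K f g : bool := `[< reach K f g >].

Lemma reached_refl K f : reached K f f.
Proof. by apply/asboolP; exact: reach_refl. Qed.

Lemma jumps_in_reached K f : jumps_in K (reached K f).
Proof.
move=> p q adj_pq; apply: contraLR => notK; rewrite /jump negb_add; apply/eqP.
by apply: asbool_equiv_eq; split=> fg; apply: reach_step fg adj_pq notK _ _;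
  rewrite ?low_side_in ?high_side_in.
Qed.

(* Turning around p from one side of the edge p a, one meets a second edge of K. *)
Lemma reach_around K p a b f : gadj p a -> f \in sides p a -> gadj p b -> b != a -> K p b ->
  exists c g, [/\ gadj p c, c != a, K p c, g \in sides p c & reach K f g].
Proof.
move=> adj_pa f_side adj_pb neq_ba Kpb; apply: contrapT => none.
have unreached q g : gadj p q -> q != a -> K p q -> g \in sides p q -> ~~ reached K f g.
  by move=> adj_pq neq_qa Kpq g_side; apply/negP => /asboolP fg; apply: none; exists q, g.
have no_jump q : gadj p q -> q != a -> ~~ jump (reached K f) p q.
  move=> adj_pq neq_qa; have [Kpq|] := boolP (K p q); last first.
    by apply: contra; exact: jumps_in_reached.
  have out := unreached q _ adj_pq neq_qa Kpq.
  by rewrite /jump (negbTE (out _ (low_side_in p q))) (negbTE (out _ (high_side_in p q))).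
have /andP[f_corner _] := side_corner adj_pa f_side.
have /andP[b_corner _] := side_corner adj_pb (low_side_in p b).
move: (unreached b _ adj_pb neq_ba Kpb (low_side_in p b)).
by rewrite -(corner_const no_jump f_corner b_corner) reached_refl.
Qed.

(** * Refining the grid *)

(* The grid is refined by doubling all coordinates, so that the midpoints of edges and the
   centres of faces become grid points. *)
Definition gdouble p : gpoint := (2 * p.1, 2 * p.2).
Definition gmid p q : gpoint := (p.1 + q.1, p.2 + q.2).
Definition face_centre f : gpoint := (2 * f.1 + 1, 2 * f.2 + 1).
Definition ghalf f : gpoint := ((f.1 %/ 2)%Z, (f.2 %/ 2)%Z).

Fixpoint refine s : seq gpoint :=
  if s is p :: t then
    gdouble p :: (if t is q :: _ then gmid p q :: refine t else [::])
  else [::].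

Lemma gdouble_inj : injective gdouble.
Proof. by move=> [a b] [c d] [eq1 eq2]; congr (_, _); lia. Qed.

Lemma gmidC p q : gmid p q = gmid q p.
Proof. by rewrite /gmid addrC [p.2 + _]addrC. Qed.

Lemma gmid_inj p q p' q' : gadj p q -> gadj p' q' -> gmid p q = gmid p' q' ->
  (p', q') = (p, q) \/ (p', q') = (q, p).
Proof.
move: p q p' q' => [a b] [c d] [a' b'] [c' d']; rewrite /gadj /= => adj adj' [eq1 eq2].
have : (a', b', c', d') = (a, b, c, d) \/ (a', b', c', d') = (c, d, a, b).
  have [[-> [-> [-> ->]]]|[-> [-> [-> ->]]]] : (a' = a /\ b' = b /\ c' = c /\ d' = d) \/
    (a' = c /\ b' = d /\ c' = a /\ d' = b) by lia.
    by left.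
  by right.
by case=> -[-> -> -> ->]; [left|right].
Qed.

Lemma gmid_neq_double p q z : gadj p q -> gmid p q <> gdouble z.
Proof. by rewrite /gadj => adj_pq [eq1 eq2]; lia. Qed.

Lemma gmid_neq_centre p q f : gadj p q -> gmid p q <> face_centre f.
Proof. by rewrite /gadj => adj_pq [eq1 eq2]; lia. Qed.

Lemma gdouble_neq_centre p f : gdouble p <> face_centre f.
Proof. by move=> [eq1 _]; lia. Qed.

Lemma gadj_double_mid p q : gadj p q -> gadj (gdouble p) (gmid p q).
Proof. by rewrite /gadj /gdouble /gmid /=; lia. Qed.

Lemma gadj_centre_mid p q f : gadj p q -> f \in sides p q -> gadj (face_centre f) (gmid p q).
Proof.
move: p q; apply: gadj_ind => [p q adj_pq|x y|x y]; first by rewrite sidesC // gmidC.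
- by rewrite sides_north !inE => /orP[] /eqP ->; rewrite /gadj /face_centre /gmid /=; lia.
- by rewrite sides_east !inE => /orP[] /eqP ->; rewrite /gadj /face_centre /gmid /=; lia.
Qed.

Lemma refine_cons p q s : refine [:: p, q & s] = [:: gdouble p, gmid p q & refine (q :: s)].
Proof. by []. Qed.

Lemma refine_head p s : refine (p :: s) = gdouble p :: behead (refine (p :: s)).
Proof. by []. Qed.

Lemma last_refine p s z : last z (refine (p :: s)) = gdouble (last p s).
Proof. by elim: s p z => [|q s IH] p z //; rewrite refine_cons /= -(IH q (gmid p q)). Qed.

Lemma mem_refine s z : z \in refine s ->
  (exists2 p : gpoint, p \in s & z = gdouble p) \/
  (exists2 pq : gpoint * gpoint, pq \in steps s & z = gmid pq.1 pq.2).
Proof.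
elim: s => [|p [|q s] IH] //; first by rewrite inE => /eqP ->; left; exists p; rewrite ?mem_head.
rewrite refine_cons 2!in_cons => /or3P[/eqP ->|/eqP ->|/IH[[p' p's ->]|[pq pq_s ->]]].
- by left; exists p; rewrite ?mem_head.
- by right; exists (p, q); rewrite // steps_cons mem_head.
- by left; exists p'; rewrite // inE p's orbT.
- by right; exists pq; rewrite // steps_cons inE pq_s orbT.
Qed.

Lemma refine_sorted s : sorted gadj s -> sorted gadj (refine s).
Proof.
elim: s => [|p [|q s] IH] // /andP[adj_pq /IH]; rewrite refine_cons (refine_head q) /= => ->.
by rewrite gadj_double_mid // gmidC gadjC gadj_double_mid // gadjC.
Qed.

Lemma refine_uniq s : sorted gadj s -> uniq s -> uniq (refine s).
Proof.
elim: s => [|p [|q s] IH] //; rewrite cons_uniq => /andP[adj_pq walk_qs] /andP[p_off uniq_qs].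
have adj_steps a b := @steps_sorted _ gadj (q :: s) a b walk_qs.
rewrite refine_cons 2!cons_uniq IH // in_cons negb_or andbT -andbA; apply/and3P; split.
- by apply/eqP => eq_mid; exact: gmid_neq_double adj_pq (esym eq_mid).
- apply/negP => /mem_refine[[p' p'_in /gdouble_inj eq_p]|[[a b] ab eq_p]].
    by rewrite eq_p p'_in in p_off.
  exact: gmid_neq_double (adj_steps _ _ ab) (esym eq_p).
apply/negP => /mem_refine[[p' _]|[[a b] ab]]; first exact: gmid_neq_double.
have /andP[a_in b_in] := mem_steps ab.
case/(gmid_inj adj_pq (adj_steps _ _ ab)) => -[eq_a eq_b].
  by rewrite -eq_a a_in in p_off.
by rewrite -eq_b b_in in p_off.
Qed.

Lemma steps_refine s p q : (p, q) \in steps s ->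
  ((gdouble p, gmid p q) \in steps (refine s)) && ((gmid p q, gdouble q) \in steps (refine s)).
Proof.
elim: s => [|a [|b s] IH] //; rewrite refine_cons (refine_head b) !steps_cons !in_cons -refine_head.
by case/orP=> [/eqP[-> ->]|/IH /andP[-> ->]]; rewrite ?eqxx ?orbT.
Qed.

Lemma walk_edge_refine s p q : walk_edge s p q -> walk_edge (refine s) (gdouble p) (gmid p q).
Proof.
by case/orP => /steps_refine /andP[into out]; apply/orP; [left|right]; rewrite // gmidC.
Qed.

Lemma in_ball_double o r p : in_ball (gdouble o) (2 * r) (gdouble p) = in_ball o r p.
Proof. by rewrite !in_ballE /=; lia. Qed.

Lemma in_ball_mid o r p q : gadj p q ->
  in_ball (gdouble o) (2 * r) (gmid p q) = in_ball o r p && in_ball o r q.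
Proof. by rewrite !in_ballE /gadj /=; lia. Qed.

Lemma in_ball_centre_face o r f :
  in_ball (gdouble o) (2 * r) (face_centre f) = face_in_ball o r f.
Proof. by rewrite in_ballE /face_in_ball /=; lia. Qed.

Lemma in_ball_half o r p : in_ball (gdouble o) (2 * r) p -> in_ball o r (ghalf p).
Proof. by rewrite !in_ballE /=; lia. Qed.

Lemma ghalf_double p : ghalf (gdouble p) = p.
Proof. by case: p => x y; rewrite /ghalf /gdouble /=; congr (_, _); lia. Qed.

(* An edge of the refined grid lies on an edge of the grid or inside a face. *)
Lemma sides_half a b : gadj a b ->
  (exists f, map ghalf (sides a b) = [:: f; f]) \/
  exists p q, [/\ gadj p q, sides p q = map ghalf (sides a b) &
    (a, b) = (gdouble p, gmid p q) \/ (b, a) = (gdouble p, gmid p q)].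
Proof.
move: a b; apply: gadj_ind => [a b adj_ab|x y|x y].
- rewrite (sidesC adj_ab); case=> [|[p [q [adj_pq sides_pq ab]]]]; first by left.
  by right; exists p, q; split=> //; case: ab; [right|left].
- have [odd_x|even_x] : x = 2 * (x %/ 2)%Z + 1 \/ x = 2 * (x %/ 2)%Z by lia.
    left; exists (ghalf (x, y)); rewrite sides_north /ghalf /=.
    by congr [:: (_, _); _]; lia.
  right; set u := (x %/ 2)%Z in even_x *; set v := (y %/ 2)%Z.
  have sides_uv : sides (u, v) (u, v + 1) = map ghalf (sides (x, y) (x, y + 1)).
    by rewrite !sides_north /ghalf /=; congr [:: (_, _); _]; lia.
  have [even_y|odd_y] : y = 2 * v \/ y = 2 * v + 1 by rewrite /v; lia.
    exists (u, v), (u, v + 1); split; rewrite ?gadj_north //; left.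
    by rewrite /gdouble /gmid /=; congr ((_, _), (_, _)); lia.
  exists (u, v + 1), (u, v); split; rewrite 1?gadjC ?gadj_north 1?sidesC 1?gadjC ?gadj_north //.
  by right; rewrite /gdouble /gmid /=; congr ((_, _), (_, _)); lia.
- have [odd_y|even_y] : y = 2 * (y %/ 2)%Z + 1 \/ y = 2 * (y %/ 2)%Z by lia.
    left; exists (ghalf (x, y)); rewrite sides_east /ghalf /=.
    by congr [:: (_, _); _]; lia.
  right; set u := (x %/ 2)%Z; set v := (y %/ 2)%Z in even_y *.
  have sides_uv : sides (u, v) (u + 1, v) = map ghalf (sides (x, y) (x + 1, y)).
    by rewrite !sides_east /ghalf /=; congr [:: (_, _); _]; lia.
  have [even_x|odd_x] : x = 2 * u \/ x = 2 * u + 1 by rewrite /u; lia.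
    exists (u, v), (u + 1, v); split; rewrite ?gadj_east //; left.
    by rewrite /gdouble /gmid /=; congr ((_, _), (_, _)); lia.
  exists (u + 1, v), (u, v); split; rewrite 1?gadjC ?gadj_east 1?sidesC 1?gadjC ?gadj_east //.
  by right; rewrite /gdouble /gmid /=; congr ((_, _), (_, _)); lia.
Qed.

Lemma reach_walk K f g : reach K f g -> exists s,
  [/\ path gadj (face_centre f) s, last (face_centre f) s = face_centre g &
    {in s, forall z, exists p q, [/\ gadj p q, ~~ K p q &
      z = gmid p q \/ exists2 h, h \in sides p q & z = face_centre h]}].
Proof.
elim=> [|g' h p q _ [s [walk_s last_s off_s]] adj_pq notK g'_side h_side]; first by exists [::].
exists (s ++ [:: gmid p q; face_centre h]); split.
- by rewrite cat_path walk_s last_s /= gadj_centre_mid // gadjC gadj_centre_mid.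
- by rewrite last_cat.
move=> z; rewrite mem_cat => /orP[/off_s //|]; rewrite !inE => z_new; exists p, q; split=> //.
by case/orP: z_new => /eqP ->; [left|right; exists h].
Qed.

End Grid.

(** * Walks, forests and cycles in finite graphs *)

Section SimpleWalks.
Variables (T : eqType) (e : rel T).
Implicit Types (A B : pred T) (x : T) (s : seq T).

Lemma head_rev x s : head x (rev s) = last x s.
Proof. by case/lastP: s => // s y; rewrite rev_rcons last_rcons. Qed.

Lemma last_rev x s : last x (rev s) = head x s.
Proof. by case: s => // y s; rewrite rev_cons last_rcons. Qed.

Lemma rev_cons_belast x s : rev (x :: s) = last x s :: rev (belast x s).
Proof. by rewrite lastI rev_rcons. Qed.

Lemma last_rev_belast x s : last (last x s) (rev (belast x s)) = x.
Proof. by case: s => // y s; rewrite rev_cons last_rcons. Qed.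

Lemma path_rev_belast x s : symmetric e -> path e (last x s) (rev (belast x s)) = path e x s.
Proof. by move=> symE; rewrite rev_path; apply: eq_path => y z; exact: symE. Qed.

Lemma path_first_hit B x s : path e x s -> B (last x s) -> exists t,
  [/\ path e x t, {subset x :: t <= x :: s}, B (last x t) &
    {in x :: t, forall y, B y -> y = last x t}].
Proof.
elim: s x => [|y s IH] x.
  by move=> _ Bx; exists [::]; split=> // z; rewrite inE => /eqP.
move=> /= /andP[exy path_s] B_last; have [Bx|notBx] := boolP (B x).
  exists [::]; split=> // z; rewrite inE => /eqP -> //.
  exact: mem_head.
have [t [path_t sub_t B_t only_t]] := IH y path_s B_last.
exists (y :: t); split=> //=; first by rewrite exy.
  by move=> z; rewrite ![z \in x :: _]inE => /orP[-> // |/sub_t ->]; rewrite orbT.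
by move=> z; rewrite inE => /orP[/eqP -> Bx|/only_t //]; rewrite Bx in notBx.
Qed.

Lemma simple_path_between A B x s :
  symmetric e -> path e x s -> A x -> B (last x s) ->
  exists y t, [/\ path e y t, uniq (y :: t), {subset y :: t <= x :: s},
    A y /\ B (last y t) & {in y :: t, forall z, (A z -> z = y) /\ (B z -> z = last y t)}].
Proof.
move=> symE path_s Ax B_last.
have [t [path_t sub_t B_t only_t]] := path_first_hit path_s B_last.
have [|| u [path_u sub_u A_u only_u]] := @path_first_hit A (last x t) (rev (belast x t)).
- by rewrite path_rev_belast.
- by rewrite last_rev_belast.
have {}sub_u z : z \in last x t :: u -> z \in x :: t.
  by move/sub_u; rewrite -rev_cons_belast mem_rev.
case/shortenP: path_u sub_u A_u only_u => w path_w uniq_w sub_wu sub_u A_w only_w.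
have sub_w z : z \in last x t :: w -> z \in last x t :: u.
  by rewrite !inE => /orP[->//|/sub_wu ->]; rewrite orbT.
have rev_w z : (z \in last (last x t) w :: rev (belast (last x t) w)) = (z \in last x t :: w).
  by rewrite -rev_cons_belast mem_rev.
exists (last (last x t) w), (rev (belast (last x t) w)); rewrite last_rev_belast; split=> //.
- by rewrite path_rev_belast.
- by rewrite -rev_cons_belast rev_uniq.
- by move=> z; rewrite rev_w => /sub_w/sub_u/sub_t.
by move=> z; rewrite rev_w => /sub_w zu; split; [exact: only_w | apply/only_t/sub_u].
Qed.

End SimpleWalks.

Lemma next_orbit (T : finType) (c : seq T) x y : uniq c -> x \in c -> y \in c ->
  exists n, y = iter n (next c) x.
Proof.
move=> uniq_c xc yc; have : fconnect (next c) x y by rewrite (fconnect_cycle (cycle_next uniq_c)).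
by move/iter_findex => <-; exists (findex (next c) x y).
Qed.

Lemma next_next_neq (T : eqType) (c : seq T) x : uniq c -> (2 < size c)%N -> x \in c ->
  next c (next c x) != x.
Proof.
move=> uniq_c size_c xc; have [i s eq_rot] := rot_to xc.
rewrite -!(next_rot i uniq_c) eq_rot.
have := uniq_c; rewrite -(rot_uniq i) eq_rot; move: size_c; rewrite -(size_rot i) eq_rot.
case: s {eq_rot} => [|y [|z s]] //= _; rewrite eqxx !inE !negb_or => /andP[/and3P[xy xz _] _].
by rewrite [y == x]eq_sym (negbTE xy) eqxx eq_sym.
Qed.

Lemma perm_next (T : eqType) (c : seq T) : uniq c -> perm_eq (map (next c) c) c.
Proof.
move=> uniq_c; apply: uniq_perm => //.
  by rewrite map_inj_uniq //; exact: can_inj (prev_next uniq_c).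
move=> y; apply/mapP/idP => [[x xc ->]|yc]; first by rewrite mem_next.
by exists (prev c y); rewrite ?mem_prev ?next_prev.
Qed.

Section Graphs.
Variable V : finType.
Implicit Types (E : {set {set V}}) (x y z : V) (c s : seq V) (S : {set V}).

Lemma adj_sym E : symmetric (adj E).
Proof. by move=> x y; rewrite /adj setUC. Qed.

Lemma adj_connect_sym E : connect_sym (adj E).
Proof. exact/sym_connect_sym/adj_sym. Qed.

Lemma adj_neq E x y : simple_graph E -> adj E x y -> x != y.
Proof.
by move=> simpleE; apply: contraTneq => ->; apply/negP => /simpleE; rewrite setUid cards1.
Qed.

Lemma simple_edgeP E e : simple_graph E -> e \in E -> exists x y, e = [set x; y] /\ x != y.
Proof. by move=> simpleE /simpleE /eqP /cards2P[x [y [neq_xy ->]]]; exists x, y. Qed.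

Lemma simple_edge_at E e x : simple_graph E -> e \in E -> x \in e ->
  exists2 y, e = [set x; y] & x != y.
Proof.
move=> simpleE eE; have [a [b [-> neq_ab]]] := simple_edgeP simpleE eE.
rewrite !inE => /orP[] /eqP ->; first by exists b.
by exists a; rewrite 1?setUC 1?eq_sym.
Qed.

Lemma eq_set2 x y z t : z != t -> [set x; y] = [set z; t] ->
  x = z /\ y = t \/ x = t /\ y = z.
Proof.
move=> neq_zt eq_sets.
have : x \in [set z; t] by rewrite -eq_sets set21.
have : y \in [set z; t] by rewrite -eq_sets set22.
have : z \in [set x; y] by rewrite eq_sets set21.
have : t \in [set x; y] by rewrite eq_sets set22.
rewrite !inE => tE zE /orP[] /eqP eq_y /orP[] /eqP eq_x; auto; subst x y.
  by move: tE; rewrite orbb eq_sym (negbTE neq_zt).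
by move: zE; rewrite orbb (negbTE neq_zt).
Qed.

Lemma sum_edge x y (h : V -> bool) : x != y ->
  \big[addb/false]_(z in [set x; y]) h z = h x (+) h y.
Proof. by move=> neq_xy; rewrite big_setU1 ?inE //= big_set1. Qed.

Lemma sub_is_cycle E E' c : E' \subset E -> is_cycle E' c -> is_cycle E c.
Proof.
move=> /subsetP sub [size_c uniq_c cycle_c]; split=> //.
by apply: sub_cycle cycle_c => x y; exact: sub.
Qed.

Lemma sub_forest E E' : E' \subset E -> is_forest E -> is_forest E'.
Proof. by move=> sub forestE c /(sub_is_cycle sub); exact: forestE. Qed.

Lemma card_le2_forest E : (#|V| <= 2)%N -> is_forest E.
Proof.
move=> small c [size_c uniq_c _]; have := max_card (mem c); rewrite (card_uniqP uniq_c).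
by move/(leq_trans size_c)/leq_trans/(_ small).
Qed.

Lemma adj_induced E S x y : adj (induced_edges E S) x y = [&& adj E x y, x \in S & y \in S].
Proof. by rewrite /adj inE subUset !sub1set. Qed.

Lemma induced_sub E S : induced_edges E S \subset E.
Proof. by apply/subsetP => e; rewrite inE => /andP[]. Qed.

Lemma is_cycle_induced E S c :
  is_cycle (induced_edges E S) c <-> is_cycle E c /\ {subset c <= S}.
Proof.
split=> [cycle_c|[[size_c uniq_c cycle_c] cS]]; last first.
  split=> //; apply: (sub_in_cycle (P := mem c)) cycle_c; last exact/allP.
  by move=> x y xc yc; rewrite adj_induced => ->; rewrite !cS.
split=> [|x xc]; first exact: sub_is_cycle (induced_sub E S) cycle_c.
by case: cycle_c => _ _ /next_cycle /(_ xc); rewrite adj_induced => /and3P[].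
Qed.

Lemma sub_induces_forest E S S' : S' \subset S -> induces_forest E S -> induces_forest E S'.
Proof.
by move=> sub forestS c /is_cycle_induced[cycle_c cS']; apply: (forestS c);
  apply/is_cycle_induced; split=> // x /cS'; exact: subsetP.
Qed.

Definition component E S x : {set V} := [set y | connect (adj (induced_edges E S)) x y].

Lemma mem_component E S x : x \in component E S x.
Proof. by rewrite inE. Qed.

Lemma component_sub E S x : x \in S -> component E S x \subset S.
Proof.
move=> xS; apply/subsetP => y; rewrite inE => /connectP[p path_p ->].
elim: p x xS path_p => [|z p IH] x //= xS; rewrite adj_induced => /andP[/and3P[_ _ zS]].
exact: IH.
Qed.

Lemma component_closed E S x y z : x \in S -> y \in component E S x -> z \in S ->
  adj E y z -> z \in component E S x.
Proof.
move=> xS y_comp zS adj_yz; have yS := subsetP (component_sub E xS) _ y_comp.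
by rewrite !inE in y_comp *; apply: connect_trans y_comp (connect1 _);
  rewrite adj_induced yS zS adj_yz.
Qed.

Lemma sub_component E E' S x : E \subset E' -> component E S x \subset component E' S x.
Proof.
move=> /subsetP sub; apply/subsetP => y; rewrite !inE; apply: connect_sub => a b.
rewrite adj_induced => /andP[/sub ab_E' abS]; apply: connect1.
by rewrite adj_induced /adj ab_E'.
Qed.

Lemma uniq_path_forest_extend E x y z s : simple_graph E -> is_forest E ->
  path (adj E) x (y :: s) -> uniq [:: x, y & s] -> adj E z x -> z != y ->
  uniq [:: z, x, y & s].
Proof.
move=> simpleE forestE path_s uniq_s adj_zx neq_zy; rewrite cons_uniq uniq_s andbT.
rewrite !inE !negb_or neq_zy (adj_neq simpleE adj_zx) /=; apply/negP => z_s.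
case/splitPr: z_s path_s uniq_s => s1 s2; rewrite -cat_rcons -!cat_cons cat_path cat_uniq.
move=> /andP[path_s _] /andP[uniq_s _]; apply: (forestE [:: x, y & rcons s1 z]).
split=> //; first by rewrite /= size_rcons.
by rewrite (cycle_path x) /= last_rcons adj_zx.
Qed.

Lemma forest_leaf E e0 : simple_graph E -> is_forest E -> e0 \in E ->
  exists x e, [/\ e \in E, x \in e & {in E, forall e' : {set V}, x \in e' -> e' = e}].
Proof.
move=> simpleE forestE e0E; apply: contrapT => no_leaf.
have second x e : e \in E -> x \in e -> exists2 e', e' \in E & x \in e' /\ e' != e.
  move=> eE xe; apply: contrapT => only; apply: no_leaf; exists x, e; split=> // e' e'E xe'.
  by apply/eqP; apply: contraT => neq_e'; case: only; exists e'.
have long n : exists x s, [/\ size s = n.+1, uniq (x :: s) & path (adj E) x s].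
  elim: n => [|n [x [[|y s] [size_s uniq_s path_s]]]] //.
    have [x [y [eq_e0 neq_xy]]] := simple_edgeP simpleE e0E; exists x, [:: y].
    by split; rewrite //= ?inE ?neq_xy // andbT /adj -eq_e0.
  have xyE : [set x; y] \in E by case/andP: path_s.
  have [e' e'E [xe' neq_e']] := second x _ xyE (set21 x y).
  have [z eq_e' neq_xz] := simple_edge_at simpleE e'E xe'.
  have adj_zx : adj E z x by rewrite adj_sym /adj -eq_e'.
  exists z, [:: x, y & s]; split; [by rewrite /= -size_s| |by rewrite /= adj_zx].
  by apply: uniq_path_forest_extend adj_zx _ => //; apply: contra neq_e' => /eqP <-; rewrite eq_e'.
have [x [s [size_s uniq_s _]]] := long #|V|.
have := max_card (mem (x :: s)); move/card_uniqP: uniq_s => ->.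
by rewrite /= size_s => /ltnW; rewrite ltnn.
Qed.

(** ** The edges of a cycle *)

Definition cycle_edges c : seq {set V} := [seq [set x; next c x] | x <- c].

Lemma cycle_edges_mem c e x : e \in cycle_edges c -> x \in e -> x \in c.
Proof. by case/mapP => y yc ->; rewrite !inE => /orP[] /eqP ->; rewrite ?mem_next. Qed.

Lemma cycle_nonempty E c : is_cycle E c -> exists x, x \in c.
Proof. by case: c => [[]|x s _] //; exists x; rewrite mem_head. Qed.

Section CycleEdges.
Variables (E : {set {set V}}) (c : seq V).
Hypothesis cycle_c : is_cycle E c.

Lemma cycle_edges_sub : {subset cycle_edges c <= E}.
Proof. by case: cycle_c => _ _ c_cycle e /mapP[x xc ->]; exact: (next_cycle c_cycle xc). Qed.

Lemma next_neq x : x \in c -> next c x != x.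
Proof.
case: cycle_c => size_c uniq_c _ xc; have := next_next_neq uniq_c size_c xc.
by apply: contra => /eqP eq_next; rewrite !eq_next.
Qed.

Lemma cycle_edge_inj x y : x \in c -> y \in c -> [set x; next c x] = [set y; next c y] -> x = y.
Proof.
case: cycle_c => size_c uniq_c _ xc yc eq_xy.
have neq_y : y != next c y by rewrite eq_sym next_neq.
case: (eq_set2 neq_y eq_xy) => [[]//|[eq_x eq_y]].
by have := next_next_neq uniq_c size_c yc; rewrite -eq_x eq_y eqxx.
Qed.

Lemma cycle_edges_uniq : uniq (cycle_edges c).
Proof.
case: cycle_c => _ uniq_c _; rewrite map_inj_in_uniq // => x y; exact: cycle_edge_inj.
Qed.

Lemma cycle_edges_sum (h : V -> bool) :
  \big[addb/false]_(e <- cycle_edges c) \big[addb/false]_(x in e) h x = false.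
Proof.
case: cycle_c => _ uniq_c _; rewrite big_map.
rewrite (eq_big_seq (fun x => h x (+) h (next c x))) => [|x xc]; last first.
  by rewrite sum_edge // eq_sym next_neq.
rewrite big_split /= -(big_map (next c) xpredT) (perm_big _ (perm_next uniq_c)).
exact: addbb.
Qed.

Lemma cycle_edge_bypass x : x \in c ->
  connect (adj (E :\ [set x; next c x])) (next c x) x.
Proof.
move=> xc; have [_ uniq_c c_cycle] := cycle_c; apply/negPn/negP => notconn.
have [n eq_x] : exists n, x = iter n (next c) (next c x) by apply: next_orbit; rewrite ?mem_next.
suff conn m : connect (adj (E :\ [set x; next c x])) (next c x) (iter m (next c) (next c x)).
  by move: (conn n); rewrite -eq_x (negbTE notconn).
elim: m => [|m IH] //=; set y := iter m _ _ in IH *; apply: (connect_trans IH) (connect1 _).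
have yc : y \in c by rewrite /y; elim: m {y IH} => [|m IH]; rewrite /= mem_next.
have neq_yx : y != x by apply: contraNneq notconn => eq_yx; rewrite eq_yx in IH.
have edge_y : [set y; next c y] \in E := next_cycle c_cycle yc.
rewrite /adj in_setD1 edge_y andbT; apply: contra neq_yx => /eqP eq_edge.
by apply/eqP; exact: cycle_edge_inj.
Qed.

Lemma cycle_edges_at x y : [set x; y] \in cycle_edges c -> y = next c x \/ y = prev c x.
Proof.
case: cycle_c => _ uniq_c _ /mapP[z zc eq_xy].
have neq_z : z != next c z by rewrite eq_sym next_neq.
case: (eq_set2 neq_z eq_xy) => -[-> ->]; first by left.
by right; rewrite prev_next.
Qed.

Lemma cycle_minus_vertex_forest x : x \in c ->
  is_forest [set e in cycle_edges c | x \notin e].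
Proof.
case: (cycle_c) => _ uniq_c _ xc d [size_d uniq_d cycle_d].
have adj_at y z : adj [set e in cycle_edges c | x \notin e] y z -> z = next c y \/ z = prev c y.
  by rewrite /adj inE => /andP[yz_c _]; exact: cycle_edges_at.
have d_next y : y \in d -> next c y \in d.
  move=> yd; have := next_cycle cycle_d yd; have := prev_cycle cycle_d yd.
  rewrite adj_sym => /adj_at[<- _|eq_prev]; first by rewrite mem_prev.
  case/adj_at => [<-|eq_next]; first by rewrite mem_next.
  have pd : prev d y \in d by rewrite mem_prev.
  by have := next_next_neq uniq_d size_d pd; rewrite next_prev // eq_next eq_prev eqxx.
have no_x y : y \in d -> y \in c -> x != y.
  move=> yd yc; have := next_cycle cycle_d yd; rewrite /adj inE => /andP[_].
  by apply: contraNneq => ->; rewrite set21.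
have [y yd] : exists y, y \in d by exact: cycle_nonempty (And3 size_d uniq_d cycle_d).
have yc : y \in c.
  have := next_cycle cycle_d yd; rewrite /adj inE => /andP[y_edge _].
  exact: cycle_edges_mem y_edge (set21 _ _).
have [n eq_x] := next_orbit uniq_c yc xc.
have /no_x : x \in d by rewrite eq_x; elim: n {eq_x} => [|n IH] //=; exact: d_next.
by rewrite eqxx => /(_ xc).
Qed.

End CycleEdges.

End Graphs.

(** * Grid layouts of graphs *)

(* Vertices become disjoint balls and edges disjoint walks between them; [route L e] is
   only meaningful for the edges e of the graph that is laid out. *)
Record layout (V : finType) := Layout {
  centre : V -> gpoint;
  radius : V -> int;
  route : {set V} -> seq gpoint }.

Definition vertex_ball (V : finType) (L : layout V) v := in_ball (centre L v) (radius L v).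

Definition vertex_face (V : finType) (L : layout V) v := face_in_ball (centre L v) (radius L v).

Record joins (V : finType) (L : layout V) (x y : V) (s : seq gpoint) : Prop := Joins {
  joins_walk : sorted gadj s;
  joins_uniq : uniq s;
  joins_head : vertex_ball L x (head 0 s);
  joins_last : vertex_ball L y (last 0 s);
  joins_ball : forall z v, z \in s -> vertex_ball L v z ->
    v = x /\ z = head 0 s \/ v = y /\ z = last 0 s }.

Definition disjoint_balls (V : finType) (L : layout V) : Prop :=
  forall u v p, vertex_ball L u p -> vertex_ball L v p -> u = v.

Record is_layout (V : finType) (E : {set {set V}}) (L : layout V) : Prop := IsLayout {
  layout_radius : forall v, 1 <= radius L v;
  layout_disjoint_balls : disjoint_balls L;
  layout_route : forall e, e \in E -> exists x y,
    [/\ e = [set x; y], x != y & joins L x y (route L e)];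
  layout_disjoint_routes : forall e f z,
    e \in E -> f \in E -> z \in route L e -> z \in route L f -> e = f }.

(* The grid edges covered by the routes of [EC] and the balls of [S]. *)
Definition drawn (V : finType) (L : layout V) (EC : {set {set V}}) (S : {set V}) : rel gpoint :=
  fun p q => [exists e in EC, walk_edge (route L e) p q] ||
             [exists v in S, vertex_ball L v p && vertex_ball L v q].

Definition outside (V : finType) (L : layout V) (S : {set V}) (f : gpoint) : Prop :=
  {in S, forall v, ~~ vertex_face L v f}.

Definition subgraph (V : finType) (E EC : {set {set V}}) (S : {set V}) : Prop :=
  EC \subset E /\ {in EC, forall e : {set V}, e \subset S}.

Section Joins.
Variables (V : finType) (L : layout V).
Implicit Types (x y v : V) (s : seq gpoint).

Lemma joins_rev x y s : joins L x y s -> joins L y x (rev s).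
Proof.
case=> walk_s uniq_s hx hy balls; split; rewrite ?rev_uniq ?head_rev ?last_rev //.
  by rewrite rev_sorted; under eq_sorted do rewrite gadjC.
by move=> z v; rewrite mem_rev => zs vz; case: (balls z v zs vz); [right|left].
Qed.

Lemma joins_interior x y s1 s2 a z b v : joins L x y (s1 ++ [:: a, z, b & s2]) ->
  ~~ vertex_ball L v z.
Proof.
rewrite -cat_rcons => -[_ uniq_s _ _ balls]; apply/negP => vz.
have [z_before z_after] : z \notin rcons s1 a /\ z \notin b :: s2.
  by move: uniq_s; rewrite cat_uniq cons_uniq /= negb_or => /and3P[_ /andP[-> _] /andP[-> _]].
have zs : z \in rcons s1 a ++ [:: z, b & s2] by rewrite mem_cat mem_head orbT.
case: (balls z v zs vz) => -[_ eq_z].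
  by move: z_before; rewrite eq_z; case: (s1) => [|c s1'] /=; rewrite mem_head.
by move: z_after; rewrite eq_z last_cat /= mem_last.
Qed.

Hypothesis disjoint_L : disjoint_balls L.

Lemma joins_exit x y s : x != y -> joins L x y s -> exists p q t,
  [/\ s = [:: p, q & t], vertex_ball L x p, ~~ vertex_ball L x q & gadj p q].
Proof.
move=> neq_xy; case: s => [|p [|q t]] [walk_s uniq_s hx hy balls].
- by case/eqP: neq_xy; exact: disjoint_L hx hy.
- by case/eqP: neq_xy; exact: disjoint_L hx hy.
exists p, q, t; split=> //; last by case/andP: walk_s.
apply/negP => xq; case: (balls q x _ xq); first by rewrite !inE eqxx orbT.
  by case=> _ eq_q; move: uniq_s; rewrite eq_q /= mem_head.
by case=> eq_xy; rewrite eq_xy eqxx in neq_xy.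
Qed.

Lemma joins_on_sphere x y s z v : x != y -> joins L x y s -> z \in s -> vertex_ball L v z ->
  on_sphere (centre L v) (radius L v) z.
Proof.
have head_sphere a b t : a != b -> joins L a b t -> on_sphere (centre L a) (radius L a) (head 0 t).
  move=> neq_ab /(joins_exit neq_ab)[p [q [t' [-> ap aq adj_pq]]]].
  exact: on_sphere_exit ap aq adj_pq.
move=> neq_xy joins_s zs vz; case: (joins_ball joins_s zs vz) => -[-> ->].
  exact: head_sphere joins_s.
by rewrite -head_rev; apply: head_sphere (joins_rev joins_s); rewrite eq_sym.
Qed.

End Joins.

Section Layout.
Variables (V : finType) (E : {set {set V}}) (L : layout V).
Hypothesis layoutL : is_layout E L.
Implicit Types (x y v : V) (e : {set V}) (p q : gpoint) (s : seq gpoint) (S : {set V})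
  (EC : {set {set V}}) (col : gpoint -> bool).

Lemma layout_simple : simple_graph E.
Proof. by move=> e /(layout_route layoutL)[x [y [-> neq_xy _]]]; rewrite cards2 neq_xy. Qed.

Lemma centre_in_ball v : vertex_ball L v (centre L v).
Proof. by apply: in_ball_centre; have := layout_radius layoutL v; lia. Qed.

Lemma route_sorted e : e \in E -> sorted gadj (route L e).
Proof. by case/(layout_route layoutL) => x [y [_ _ []]]. Qed.

Lemma route_uniq e : e \in E -> uniq (route L e).
Proof. by case/(layout_route layoutL) => x [y [_ _ []]]. Qed.

Lemma route_ball e z v : e \in E -> z \in route L e -> vertex_ball L v z -> v \in e.
Proof.
case/(layout_route layoutL) => x [y [-> _ joins_e]] ze vz.
by case: (joins_ball joins_e ze vz) => -[-> _]; rewrite !inE eqxx ?orbT.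
Qed.

Lemma route_from e x : e \in E -> x \in e -> exists y s,
  [/\ e = [set x; y], x != y, joins L x y s,
      walk_edge s =2 walk_edge (route L e) & s =i route L e].
Proof.
move=> eE xe; have [a [b [eq_e neq_ab joins_e]]] := layout_route layoutL eE.
move: xe; rewrite {1}eq_e !inE => /orP[] /eqP ->; first by exists b, (route L e).
exists a, (rev (route L e)); split; rewrite 1?setUC 1?eq_sym //.
- exact: joins_rev.
- exact: walk_edge_rev.
- exact: mem_rev.
Qed.

Lemma route_exit e x : e \in E -> x \in e -> exists p q,
  [/\ vertex_ball L x p, ~~ vertex_ball L x q, gadj p q, walk_edge (route L e) p q &
    forall p' q', vertex_ball L x p' -> walk_edge (route L e) p' q' -> (p', q') = (p, q)].
Proof.
move=> eE xe; have [y [s [eq_e neq_xy joins_s edge_s _]]] := route_from eE xe.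
have [p [q [t [eq_s xp xq adj_pq]]]] := joins_exit (layout_disjoint_balls layoutL) neq_xy joins_s.
exists p, q; split; rewrite -?edge_s ?eq_s ?walk_edge_cons ?mem_head // => p' q' xp'.
rewrite -edge_s => pq'; have /andP[p's _] := walk_edge_mem pq'.
have eq_p : p' = p.
  case: (joins_ball joins_s p's xp') => [[_ ->]|[eq_xy _]]; first by rewrite eq_s.
  by rewrite eq_xy eqxx in neq_xy.
have uniq_s := joins_uniq joins_s; rewrite eq_s eq_p in pq' uniq_s *.
by rewrite (walk_edge_first uniq_s pq').
Qed.

Lemma route_on_sphere e p v : e \in E -> p \in route L e -> vertex_ball L v p ->
  on_sphere (centre L v) (radius L v) p.
Proof.
case/(layout_route layoutL) => x [y [_ neq_xy joins_e]].
exact: (joins_on_sphere (layout_disjoint_balls layoutL) neq_xy joins_e).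
Qed.

Lemma route_edge_not_in_ball e p q v : e \in E -> walk_edge (route L e) p q ->
  ~~ (vertex_ball L v p && vertex_ball L v q).
Proof.
move=> eE pq; apply/negP => /andP[vp vq]; have /andP[p_route _] := walk_edge_mem pq.
have [p0 [q0 [_ vq0 _ _ only]]] := route_exit eE (route_ball eE p_route vp).
by case: (only p q vp pq) vq0 => _ <-; rewrite vq.
Qed.

Lemma drawnP EC S p q :
  reflect ((exists2 e, e \in EC & walk_edge (route L e) p q) \/
           (exists2 v, v \in S & vertex_ball L v p && vertex_ball L v q))
          (drawn L EC S p q).
Proof. by apply: (iffP orP) => -[] /exists_inP; [left|right|left|right]. Qed.

Lemma drawnC EC S p q : drawn L EC S p q = drawn L EC S q p.
Proof.
congr (_ || _); apply: eq_existsb => a; first by rewrite walk_edgeC.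
by rewrite [vertex_ball L a q && _]andbC.
Qed.

Lemma vertex_face_corner v f p : vertex_face L v f -> corner f p -> vertex_ball L v p.
Proof. exact: face_in_ball_corner. Qed.

Lemma centre_outside v S : v \notin S -> outside L S (centre L v).
Proof.
move=> vS w wS; apply: contra vS => /vertex_face_corner /(_ (corner_self _)) in_w.
by rewrite (layout_disjoint_balls layoutL (centre_in_ball v) in_w).
Qed.

Lemma side_outside e p q f S : e \in E -> walk_edge (route L e) p q -> f \in sides p q ->
  outside L S f.
Proof.
move=> eE pq f_side v _; have adj_pq := walk_edge_gadj (route_sorted eE) pq.
exact: side_out_of_ball adj_pq (route_edge_not_in_ball v eE pq) f_side.
Qed.

(** ** A drawn forest does not separate the plane *)

Lemma steps_const (T : Type) (f : T -> T -> bool) (t : seq T) :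
  (forall t1 a z b t2, t = t1 ++ [:: a, z, b & t2] -> f a z = f z b) ->
  exists b, all (fun st => f st.1 st.2 == b) (steps t).
Proof.
elim: t => [|x [|y [|z t]] IH] const; try by exists true.
  by exists (f x y); rewrite /= eqxx.
case: IH => [t1 a w b t2 eq_t|b all_b].
  by apply: (const (x :: t1) a w b t2); rewrite eq_t.
exists b; rewrite steps_cons; apply/andP; split=> //=.
by rewrite (const [::] x y z t) //; case/andP: all_b.
Qed.

Lemma jump_along_route EC S col e a b c d : EC \subset E -> e \in EC ->
  jumps_in (drawn L EC S) col ->
  walk_edge (route L e) a b -> walk_edge (route L e) c d -> jump col a b = jump col c d.
Proof.
move=> /subsetP sub eEC jumps; have eE := sub _ eEC.
have e_walk := route_sorted eE; have uniq_e := route_uniq eE.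
have [k all_k] : exists k, all (fun st => jump col st.1 st.2 == k) (steps (route L e)).
  apply: steps_const => t1 p z q t2 eq_e; rewrite eq_e in e_walk uniq_e.
  have adj_pz : gadj p z by apply: (steps_sorted e_walk); apply/stepsP; exists t1, (q :: t2).
  have adj_zq : gadj z q.
    by apply: (steps_sorted e_walk); apply/stepsP; exists (rcons t1 p), t2; rewrite cat_rcons.
  have neq_pq : p != q.
    by move: uniq_e; rewrite cat_uniq cons_uniq !in_cons !negb_or => /and4P[_ _ /and3P[]].
  rewrite jumpC //; apply: jump_through neq_pq _ => //; first by rewrite gadjC.
  move=> w adj_zw neq_wp neq_wq.
  have ze : z \in route L e by rewrite eq_e mem_cat !inE eqxx !orbT.
  apply/negP => /(jumps _ _ adj_zw) /drawnP[[f fEC zw]|[v _ /andP[vz _]]].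
    have /andP[zf _] := walk_edge_mem zw.
    rewrite (layout_disjoint_routes layoutL (sub _ fEC) eE zf ze) eq_e in zw.
    have := walk_edge_interior uniq_e zw.
    by rewrite !inE (negbTE neq_wp) (negbTE neq_wq).
  have [x [y [_ _ joins_e]]] := layout_route layoutL eE; rewrite eq_e in joins_e.
  by rewrite (negbTE (joins_interior v joins_e)) in vz.
suff const p q : walk_edge (route L e) p q -> jump col p q = k by move=> /const -> /const ->.
move=> pq; have adj_pq := walk_edge_gadj e_walk pq.
by case/orP: pq => /(allP all_k) /eqP /= <-; rewrite // jumpC.
Qed.

Lemma forest_no_jump EC S col : subgraph E EC S -> is_forest EC ->
  jumps_in (drawn L EC S) col -> jumps_in (drawn L finset.set0 S) col.
Proof.
move=> [subE subS] forestEC jumps.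
pose jumping := [set e in EC | `[< exists p q, walk_edge (route L e) p q /\ jump col p q >]].
have sub : jumping \subset EC by apply/subsetP => e; rewrite inE => /andP[].
suff none : jumping = finset.set0.
  move=> p q adj_pq jump_pq; apply/drawnP; right.
  case/drawnP: (jumps p q adj_pq jump_pq) => // -[e eEC pq].
  by have := in_set0 e; rewrite -none inE eEC => /asboolP[]; exists p, q.
apply/eqP; apply: contraT => /set0Pn[e0 e0_jump].
have simple_j : simple_graph jumping.
  by move=> e ej; apply: layout_simple; apply/(subsetP subE)/(subsetP sub).
have [v [e [ej ve leaf_v]]] := forest_leaf simple_j (sub_forest sub forestEC) e0_jump.
have eEC := subsetP sub _ ej; have eE := subsetP subE _ eEC.
have [p0 [q0 [vp0 vq0 adj0 pq0 only0]]] := route_exit eE ve.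
have jump0 : jump col p0 q0.
  move: ej; rewrite inE => /andP[_ /asboolP[p [q [pq jump_pq]]]].
  by rewrite (jump_along_route subE eEC jumps pq0 pq).
suff : ~~ jump col p0 q0 by rewrite jump0.
apply: no_single_exit_jump vp0 vq0 adj0 _ => p q.
rewrite -!/(vertex_ball L v _) => vp vq adj_pq jump_pq.
case/drawnP: (jumps p q adj_pq jump_pq) => [[e' e'EC pq]|[w _ /andP[wp wq]]]; last first.
  by rewrite -(layout_disjoint_balls layoutL wp vp) wq in vq.
have /andP[pe' _] := walk_edge_mem pq.
have ve' := route_ball (subsetP subE _ e'EC) pe' vp.
have eq_e : e' = e by apply: leaf_v ve'; rewrite inE e'EC; apply/asboolP; exists p, q.
by apply: only0; rewrite -?eq_e.
Qed.

Lemma balls_do_not_separate S col f g : jumps_in (drawn L finset.set0 S) col ->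
  outside L S f -> outside L S g -> col f = col g.
Proof.
move=> jumps f_out g_out.
have ball_jump p q : gadj p q -> jump col p q ->
    exists2 v, v \in S & vertex_ball L v p && vertex_ball L v q.
  by move=> adj_pq /(jumps _ _ adj_pq) /drawnP[[e]|//]; rewrite in_set0.
pose shade v := col ((centre L v).1 - radius L v - 1, (centre L v).2 - radius L v - 1).
pose filled h := if [pick v in S | vertex_face L v h] is Some v then shade v else col h.
have filled_out h : outside L S h -> filled h = col h.
  by rewrite /filled => h_out; case: pickP => // v /andP[vS]; rewrite (negbTE (h_out v vS)).
have filled_near v h p : v \in S -> vertex_ball L v p -> corner h p -> filled h = shade v.
  move=> vS vp hp; rewrite /filled; case: pickP => [w /andP[wS wh]|none].
    by congr shade; apply: (layout_disjoint_balls layoutL) vp; exact: vertex_face_corner wh hp.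
  apply: (ring_const _ _ vp hp); last by have := none v; rewrite vS /= => /negbT.
  move=> a b; rewrite -!/(vertex_ball L v _) => va vb adj_ab.
  apply: contraNN vb => /(ball_jump _ _ adj_ab)[w _ /andP[wa wb]].
  by rewrite -(layout_disjoint_balls layoutL wa va).
suff const : forall p q, gadj p q -> ~~ jump filled p q.
  by rewrite -(filled_out f) // -(filled_out g) //; exact: col_const const _ _.
move=> p q adj_pq.
have [/exists_inP[v vS /andP[vp vq]]|not_in] :=
  boolP [exists v in S, vertex_ball L v p && vertex_ball L v q].
  have shaded h : h \in sides p q -> filled h = shade v.
    by case/(side_corner adj_pq)/andP => hp _; exact: filled_near vp hp.
  by rewrite /jump !shaded ?low_side_in ?high_side_in ?addbb.
have {}not_in v : v \in S -> ~~ (vertex_ball L v p && vertex_ball L v q).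
  by move=> vS; apply: contra not_in => in_v; apply/exists_inP; exists v.
have side_out h : h \in sides p q -> outside L S h.
  by move=> h_side v vS; exact: side_out_of_ball adj_pq (not_in v vS) h_side.
rewrite /jump !filled_out; try by apply: side_out; rewrite ?low_side_in ?high_side_in.
by apply/negP => /(ball_jump _ _ adj_pq)[v vS]; apply/negP; exact: not_in.
Qed.

(* A colour change along the route of an edge persists over the whole route, and around
   a ball it cannot occur just once: so it cannot occur at a leaf of a forest. *)
Lemma forest_does_not_separate EC S col f g : subgraph E EC S -> is_forest EC ->
  jumps_in (drawn L EC S) col -> outside L S f -> outside L S g -> col f = col g.
Proof.
by move=> subES forestEC /(forest_no_jump subES forestEC); exact: balls_do_not_separate.
Qed.

End Layout.

(** * Colourings that jump along a drawn subgraph only *)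

Section OutsideSubgraph.
Variables (V : finType) (E : {set {set V}}) (L : layout V).
Hypothesis layoutL : is_layout E L.
Variables (EC : {set {set V}}) (S : {set V}) (col : gpoint -> bool).
Hypothesis subES : subgraph E EC S.
Hypothesis col_jumps : jumps_in (drawn L EC S) col.
Implicit Types (x y v : V) (e : {set V}) (p q f : gpoint).

Lemma not_in_subgraph e x : x \in e -> x \notin S -> e \notin EC.
Proof. by move=> xe; apply: contra => /subES.2 /subsetP; exact. Qed.

Lemma untouched_ball x p : x \notin S -> vertex_ball L x p -> untouched (drawn L EC S) p.
Proof.
move=> xS xp q _; apply/negP => /(drawnP L)[[e eEC /walk_edge_mem /andP[pe _]]|[v vS /andP[vp _]]].
  have xe := route_ball layoutL (subsetP subES.1 _ eEC) pe xp.
  by rewrite (negbTE (not_in_subgraph xe xS)) in eEC.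
by rewrite (layout_disjoint_balls layoutL xp vp) vS in xS.
Qed.

Lemma untouched_route e p : e \in E -> e \notin EC -> p \in route L e ->
  {in S, forall v, ~~ vertex_ball L v p} -> untouched (drawn L EC S) p.
Proof.
move=> eE eEC pe off_balls q _.
apply/negP => /(drawnP L)[[e' e'EC /walk_edge_mem /andP[pe' _]]|[v vS /andP[vp _]]].
  by rewrite (layout_disjoint_routes layoutL eE (subsetP subES.1 _ e'EC) pe pe') e'EC in eEC.
by rewrite (negbTE (off_balls v vS)) in vp.
Qed.

Lemma ball_const x p : x \notin S -> vertex_ball L x p -> col p = col (centre L x).
Proof.
move=> xS xp; have [s [walk_s last_s s_ball]] := ball_walk xp (centre_in_ball layoutL x).
rewrite -last_s; apply: jumps_in_walk col_jumps walk_s _ => z /s_ball.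
exact: untouched_ball xS.
Qed.

Lemma ball_corner_const x p f : x \notin S -> vertex_ball L x p -> corner f p ->
  col f = col (centre L x).
Proof.
move=> xS xp fp; rewrite -(ball_const xS xp).
exact: jumps_in_corner col_jumps (untouched_ball xS xp) fp (corner_self p).
Qed.

Lemma route_const e x p : e \in E -> x \in e -> x \notin S -> p \in route L e ->
  {in S, forall v, ~~ vertex_ball L v p} -> col p = col (centre L x).
Proof.
move=> eE xe xS pe p_off; have eEC := not_in_subgraph xe xS.
have [y [s [eq_e neq_xy [s_walk uniq_s x_head y_last balls] _ mem_s]]] := route_from layoutL eE xe.
case: s s_walk uniq_s x_head y_last balls mem_s pe => [|p0 t] s_walk uniq_s /= x_p0 _ balls mem_s.
  by rewrite -mem_s.
rewrite -(ball_const xS x_p0) -mem_s => pt; move: s_walk uniq_s balls mem_s.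
case/splitPl: pt => t1 t2 last_t1; rewrite /sorted cat_path => /andP[walk_t1 _] uniq_s balls mem_s.
rewrite -last_t1; symmetry; apply: jumps_in_walk col_jumps walk_t1 _ => z zt1.
have zt : z \in p0 :: t1 ++ t2 by rewrite -cat_cons mem_cat zt1.
apply: (untouched_route eE eEC); first by rewrite -mem_s.
move=> v vS; apply/negP => vz; case: (balls z v zt vz) => -[eq_v eq_z].
  by rewrite eq_v (negbTE xS) in vS.
have eq_zp : z = p; last by move: (p_off v vS); rewrite -eq_zp vz.
case: t2 eq_z uniq_s {balls mem_s zt} => [|b t2]; first by rewrite cats0 last_t1.
rewrite last_cat -cat_cons cat_uniq => eq_z /and3P[_ /hasPn disj _].
have /disj : z \in b :: t2 by rewrite eq_z /= mem_last.
by rewrite /= zt1.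
Qed.

Lemma route_side_const e x p q f : e \in E -> x \in e -> x \notin S ->
  walk_edge (route L e) p q -> f \in sides p q -> col f = col (centre L x).
Proof.
move=> eE xe xS pq f_side; have eEC := not_in_subgraph xe xS.
have [y [_ [eq_e _ _ _ _]]] := route_from layoutL eE xe.
have /andP[pe qe] := walk_edge_mem pq.
have /andP[fp fq] := side_corner (walk_edge_gadj (route_sorted layoutL eE) pq) f_side.
have const z : z \in route L e -> ~~ vertex_ball L y z -> corner f z -> col f = col (centre L x).
  move=> ze yz fz; have z_off : {in S, forall v, ~~ vertex_ball L v z}.
    move=> v vS; apply/negP => vz; have := route_ball layoutL eE ze vz.
    rewrite eq_e !inE => /orP[] /eqP eq_v; first by rewrite -eq_v vS in xS.
    by rewrite -eq_v vz in yz.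
  rewrite -(route_const eE xe xS ze z_off).
  exact: jumps_in_corner col_jumps (untouched_route eE eEC ze z_off) fz (corner_self z).
have := route_edge_not_in_ball layoutL y eE pq; rewrite negb_and => /orP[yp|yq].
  exact: const pe yp fp.
exact: const qe yq fq.
Qed.

Lemma edge_const x y : adj E x y -> x \notin S -> y \notin S ->
  col (centre L x) = col (centre L y).
Proof.
move=> xyE xS yS; have [p [q [_ _ _ pq _]]] := route_exit layoutL xyE (set21 x y).
rewrite -(route_side_const xyE (set21 x y) xS pq (low_side_in p q)).
exact: route_side_const xyE (set22 x y) yS pq (low_side_in p q).
Qed.

Lemma path_const x s : path (adj E) x s -> {in x :: s, forall y, y \notin S} ->
  col (centre L x) = col (centre L (last x s)).
Proof.
elim: s x => [|y s IH] x //= /andP[xyE path_s] off_S.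
rewrite -(IH y path_s) => [|z zs]; last by apply: off_S; rewrite inE zs orbT.
by apply: edge_const xyE _ _; apply: off_S; rewrite !inE eqxx ?orbT.
Qed.

End OutsideSubgraph.

(** * Parity of a drawn cycle *)

Section Chains.
Variables (V : finType) (E : {set {set V}}) (L : layout V).
Hypothesis layoutL : is_layout E L.
Implicit Types (x : V) (e : {set V}) (es : seq {set V}) (p q : gpoint).

(* A walk along the route of an edge, prolonged to the centres of its ends. *)
Record edge_walk e (w : seq gpoint) : Prop := EdgeWalk {
  edge_walk_sorted : sorted gadj w;
  edge_walk_ends : forall h, end_parity h w = \big[addb/false]_(x in e) h (centre L x);
  edge_walk_drawn : forall p q, walk_edge w p q -> drawn L [set e] e p q;
  edge_walk_odd : forall p q, walk_edge (route L e) p q -> odd_edge w p q }.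

Lemma edge_walk_exists e : e \in E -> exists w, edge_walk e w.
Proof.
move=> eE; have [x [y [eq_e neq_xy [e_walk uniq_e x_head y_last _]]]] := layout_route layoutL eE.
have not_in_ball p q v := @route_edge_not_in_ball _ _ _ layoutL e p q v eE.
have edges p q : drawn L [set e] e p q = walk_edge (route L e) p q ||
    [exists v in e, vertex_ball L v p && vertex_ball L v q].
  congr (_ || _); apply/exists_inP/idP => [[e' /set1P ->] //|pq].
  by exists e; rewrite ?set11.
have xe : x \in e by rewrite eq_e set21.
have ye : y \in e by rewrite eq_e set22.
case route_e: (route L e) e_walk uniq_e x_head y_last not_in_ball edges => [|p t] e_walk uniq_e.
  by move=> /= x0 y0; case/eqP: neq_xy; exact: (layout_disjoint_balls layoutL x0 y0).
move=> /= x_head y_last not_in_ball edges.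
have [s1 [walk1 last1 ball1]] := ball_walk (centre_in_ball layoutL x) x_head.
have [s2 [walk2 last2 ball2]] := ball_walk y_last (centre_in_ball layoutL y).
have in_x a b : walk_edge (centre L x :: s1) a b -> vertex_ball L x a && vertex_ball L x b.
  by case/walk_edge_mem/andP => /ball1 xa /ball1 xb; apply/andP.
have in_y a b : walk_edge (last p t :: s2) a b -> vertex_ball L y a && vertex_ball L y b.
  by case/walk_edge_mem/andP => /ball2 ya /ball2 yb; apply/andP.
exists (centre L x :: s1 ++ t ++ s2); split.
- by rewrite /= !cat_path last1 walk1 walk2 andbT.
- by move=> h; rewrite /end_parity /= !last_cat last1 last2 eq_e sum_edge.
- move=> a b; rewrite !walk_edge_cat last1 edges => /or3P[/in_x in_ab|-> //|/in_y in_ab].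
    by apply/orP; right; apply/exists_inP; exists x.
  by apply/orP; right; apply/exists_inP; exists y.
move=> a b; rewrite route_e => ab; rewrite !odd_edge_cat last1 (odd_edge_uniq uniq_e ab).
rewrite !odd_edge_off //.
  by apply: contra (not_in_ball a b y ab); exact: in_y.
by apply: contra (not_in_ball a b x ab); exact: in_x.
Qed.

Lemma edge_walks_exist :
  exists walk : {set V} -> seq gpoint, {in E, forall e, edge_walk e (walk e)}.
Proof.
have /choice[walk walkE] : forall e, exists w, e \in E -> edge_walk e w.
  move=> e; have [eE|] := boolP (e \in E); last by exists [::].
  by have [w] := edge_walk_exists eE; exists w.
by exists walk => e /walkE.
Qed.

Variable walk : {set V} -> seq gpoint.
Hypothesis walkE : {in E, forall e, edge_walk e (walk e)}.

Definition even_chain es : Prop :=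
  forall h : V -> bool, \big[addb/false]_(e <- es) \big[addb/false]_(x in e) h x = false.

Definition ends es : {set V} := [set x | has (fun e : {set V} => x \in e) es].

Lemma endsP es x : reflect (exists2 e : {set V}, e \in es & x \in e) (x \in ends es).
Proof. by rewrite inE; exact: hasP. Qed.

Variable es : seq {set V}.
Hypothesis esE : {subset es <= E}.
Hypothesis even_es : even_chain es.

Lemma subgraph_chain : subgraph E [set e in es] (ends es).
Proof.
split; first by apply/subsetP => e; rewrite inE; exact: esE.
by move=> e; rewrite inE => e_in; apply/subsetP => x xe; apply/endsP; exists e.
Qed.

Lemma chain_sorted : {in es, forall e, sorted gadj (walk e)}.
Proof. by move=> e /esE /walkE[]. Qed.

Lemma chain_closed : closed_walks walk es.
Proof.
move=> h; rewrite -[RHS](even_es (h \o centre L)).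
by apply: eq_big_seq => e /esE /walkE[].
Qed.

Lemma chain_jumps : jumps_in (drawn L [set e in es] (ends es)) (parity_sum walk es).
Proof.
apply: (jumps_in_parity_sum chain_sorted chain_closed) => e p q e_in.
case/(edge_walk_drawn (walkE (esE e_in)))/(drawnP L) => [[_ /set1P -> pq]|[v ve in_v]];
  apply/(drawnP L).
  by left; exists e; rewrite ?inE.
by right; exists v; rewrite //; apply/endsP; exists e.
Qed.

Lemma chain_jump_at e p q : uniq es -> e \in es -> walk_edge (route L e) p q ->
  jump (parity_sum walk es) p q.
Proof.
move=> uniq_es e_in pq; have eE := esE e_in.
rewrite (jump_parity_sum chain_sorted chain_closed); last first.
  exact: walk_edge_gadj (route_sorted layoutL eE) pq.
rewrite (bigD1_seq e) //= (edge_walk_odd (walkE eE) pq) big1_seq // => e' /andP[neq_e' e'_in].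
have e'E := esE e'_in; apply: odd_edge_off; apply: contra neq_e'.
case/(edge_walk_drawn (walkE e'E))/(drawnP L) => [[_ /set1P -> pq']|[v _]].
  have /andP[pe _] := walk_edge_mem pq; have /andP[pe' _] := walk_edge_mem pq'.
  by rewrite (layout_disjoint_routes layoutL e'E eE pe' pe).
by rewrite (negbTE (route_edge_not_in_ball layoutL v eE pq)).
Qed.

End Chains.

(** * No K5 minor *)

Definition touches (V : finType) (L : layout V) v f : Prop :=
  exists p q, [/\ gadj p q, vertex_ball L v p, vertex_ball L v q & f \in sides p q].

Section ReachVertex.
Variables (V : finType) (E : {set {set V}}) (L : layout V).
Hypothesis layoutL : is_layout E L.

Lemma touches_centre v : touches L v (centre L v).
Proof.
have r_ge1 := layout_radius layoutL v; have in_v := centre_in_ball layoutL v.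
exists (centre L v), ((centre L v).1, (centre L v).2 + 1); rewrite /vertex_ball in in_v *.
case: (centre L v) in_v => x y in_v; rewrite gadj_north sides_north in_v !inE eqxx orbT.
by split=> //; rewrite in_ballE /=; lia.
Qed.

Definition at_vertex (EC : {set {set V}}) (x : V) : rel gpoint := fun p q =>
  (vertex_ball L x p && vertex_ball L x q) ||
  [exists e in EC, (x \in e) && walk_edge (route L e) p q].

(* The edges of EC that avoid x form a forest, so their drawing does not separate z from x. *)
Lemma reach_at_vertex EC S x z : subgraph E EC S -> is_forest [set e in EC | x \notin e] ->
  outside L S z ->
  exists f p q, [/\ reach (drawn L EC S) z f, gadj p q, f \in sides p q & at_vertex EC x p q].
Proof.
move=> [subE subS] forestEC z_out; apply: contrapT => none.
pose col := reached (drawn L EC S) z.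
have unreached p q f : gadj p q -> at_vertex EC x p q -> f \in sides p q -> col f = false.
  by move=> adj_pq x_pq f_side; apply/asboolP => zf; apply: none; exists f, p, q.
have subES' : subgraph E [set e in EC | x \notin e] (S :\ x).
  split; first by apply: subset_trans subE; apply/subsetP => e; rewrite inE => /andP[].
  by move=> e; rewrite inE subsetD1 => /andP[/subS -> ->].
have jumps : jumps_in (drawn L [set e in EC | x \notin e] (S :\ x)) col.
  move=> p q adj_pq jump_pq; have := jumps_in_reached adj_pq jump_pq.
  have [x_pq|] := boolP (at_vertex EC x p q).
    by move: jump_pq; rewrite /jump !(unreached p q) ?low_side_in ?high_side_in.
  rewrite negb_or => /andP[not_ball /exists_inPn not_edge].
  case/drawnP => [[e eEC pq]|[v vS in_v]]; apply/drawnP.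
    by left; exists e; rewrite // inE eEC; have := not_edge e eEC; rewrite pq andbT.
  right; exists v; rewrite // !inE vS andbT.
  by apply: contraNneq not_ball => <-.
have z_out' : outside L (S :\ x) z by move=> v; rewrite !inE => /andP[_]; exact: z_out.
have x_out : outside L (S :\ x) (centre L x) by apply: (centre_outside layoutL); rewrite !inE eqxx.
have := forest_does_not_separate layoutL subES' forestEC jumps z_out' x_out.
have [p [q [adj_pq xp xq x_side]]] := touches_centre x.
by rewrite (unreached p q _ _ _ x_side) ?/at_vertex ?xp ?xq // /col reached_refl.
Qed.

End ReachVertex.

Section Wheel.
Variables (V : finType) (E : {set {set V}}) (L : layout V).
Hypothesis layoutL : is_layout E L.
Variable walk : {set V} -> seq gpoint.
Hypothesis walkE : {in E, forall e, edge_walk L e (walk e)}.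
Variables (u : V) (c : seq V).
Hypothesis cycle_c : is_cycle E c.
Hypothesis u_notin_c : u \notin c.
Hypothesis spokes : {in c, forall x, adj E u x}.
Implicit Types (x : V) (e : {set V}) (z f : gpoint).

Local Notation rim := (cycle_edges c).
Local Notation rimE := (cycle_edges_sub cycle_c).
Local Notation rim_parity := (parity_sum walk rim).

Definition triangle e : seq {set V} := e :: [seq [set u; x] | x <- enum e].

Local Notation triangle_parity e := (parity_sum walk (triangle e)).

Lemma mem_triangle e e' : e' \in triangle e -> e' = e \/ exists2 x, x \in e & e' = [set u; x].
Proof.
rewrite in_cons => /orP[/eqP|/mapP[x]]; first by left.
by rewrite mem_enum; right; exists x.
Qed.

Lemma ends_triangle e x : x \in ends (triangle e) -> (x == u) || (x \in e).
Proof.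
case/endsP => e' /mem_triangle[-> -> |[y ye ->]]; first exact: orbT.
by rewrite !inE => /orP[/eqP -> |/eqP ->]; rewrite ?eqxx ?ye ?orbT.
Qed.

Lemma ends_rim x : x \in ends rim -> x \in c.
Proof. by case/endsP => e; exact: cycle_edges_mem. Qed.

Lemma u_notin_ends_rim : u \notin ends rim.
Proof. by apply: contra u_notin_c; exact: ends_rim. Qed.

Lemma rim_even : even_chain rim.
Proof. by move=> h; exact: (cycle_edges_sum cycle_c). Qed.

Lemma triangle_sub e : e \in rim -> {subset triangle e <= E}.
Proof.
move=> e_rim e' /mem_triangle[->|[x xe ->]]; first exact: rimE.
exact/spokes/(cycle_edges_mem e_rim).
Qed.

Lemma triangle_even e : e \in rim -> even_chain (triangle e).
Proof.
move=> e_rim h; rewrite big_cons big_map big_enum /=.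
rewrite [X in _ (+) X](eq_bigr (fun x => h u (+) h x)); last first.
  by move=> x xe; rewrite sum_edge //; apply: contraNneq u_notin_c => ->; exact: cycle_edges_mem xe.
rewrite big_split /= addbCA addbb addbF.
have /mapP[x xc ->] := e_rim; rewrite sum_edge ?addbb // eq_sym.
exact: (next_neq cycle_c xc).
Qed.

Lemma rim_parity_triangles f : rim_parity f = \big[addb/false]_(e <- rim) triangle_parity e f.
Proof.
pose spoke_parity x := parity_above (walk [set u; x]) f.
transitivity (\big[addb/false]_(e <- rim)
    (parity_above (walk e) f (+) \big[addb/false]_(x in e) spoke_parity x)).
  by rewrite big_split /= (cycle_edges_sum cycle_c) addbF.
by apply: eq_bigr => e _; rewrite /parity_sum big_cons big_map big_enum.
Qed.

Lemma triangle_parity_reach e z f : e \in rim -> rim_parity z != rim_parity (centre L u) ->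
  reach (drawn L [set e in rim] (ends rim)) z f ->
  rim_parity f = rim_parity z /\ triangle_parity e f = triangle_parity e z.
Proof.
move=> e_rim z_side; have rim_sub := subgraph_chain rimE.
have rim_jumps := chain_jumps walkE rimE rim_even.
have triE := triangle_sub e_rim; have tri_jumps := chain_jumps walkE triE (triangle_even e_rim).
elim=> [//|g h p q _ [rim_g tri_g] adj_pq not_rim g_side h_side].
have not_u : rim_parity g != rim_parity (centre L u) by rewrite rim_g.
rewrite -rim_g -tri_g; split; symmetry; apply: (no_jump_sides _ g_side h_side).
  by apply: contra not_rim; exact: rim_jumps.
apply/negP => /(tri_jumps _ _ adj_pq) /drawnP[[e' e'_tri pq]|[v v_tri in_v]].
  rewrite inE in e'_tri; case: (mem_triangle e'_tri) => [eq_e'|[x xe eq_e']].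
    by rewrite eq_e' in pq; case/negP: not_rim; apply/drawnP; left; exists e; rewrite ?inE.
  have ue' : u \in e' by rewrite eq_e' set21.
  case/eqP: not_u.
  exact: (route_side_const layoutL rim_sub rim_jumps (triE _ e'_tri) ue' u_notin_ends_rim
    pq g_side).
have /andP[vp vq] := in_v; case/orP: (ends_triangle v_tri) => [/eqP eq_v|ve].
  have /andP[gp _] := side_corner adj_pq g_side; rewrite eq_v in vp; case/eqP: not_u.
  exact: (ball_corner_const layoutL rim_sub rim_jumps u_notin_ends_rim vp gp).
by case/negP: not_rim; apply/drawnP; right; exists v; rewrite //; apply/endsP; exists e.
Qed.

(* From z, lying on the other side of the cycle c than u, a vertex x of c is reached
   without crossing c, hence without meeting the edges at u. *)
Lemma triangle_parity_rim e x z : e \in rim -> x \in c -> x \notin e ->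
  outside L (ends rim) z -> rim_parity z != rim_parity (centre L u) ->
  triangle_parity e z = triangle_parity e (centre L x).
Proof.
move=> e_rim xc xe z_out z_side.
have triE := triangle_sub e_rim; have tri_sub := subgraph_chain triE.
have tri_jumps := chain_jumps walkE triE (triangle_even e_rim).
have x_tri : x \notin ends (triangle e).
  apply/negP => /ends_triangle; rewrite (negbTE xe) orbF => /eqP eq_xu.
  by case/negP: u_notin_c; rewrite -eq_xu.
have forest_x : is_forest [set e' in [set e in rim] | x \notin e'].
  apply: sub_forest (cycle_minus_vertex_forest cycle_c xc).
  by apply/subsetP => e'; rewrite !inE.
have [f [p [q [zf adj_pq f_side x_pq]]]] :=
  reach_at_vertex layoutL (subgraph_chain rimE) forest_x z_out.
rewrite -(triangle_parity_reach e_rim z_side zf).2; case/orP: x_pq => [/andP[xp _]|].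
  have /andP[fp _] := side_corner adj_pq f_side.
  exact: (ball_corner_const layoutL tri_sub tri_jumps x_tri xp fp).
case/exists_inP => e'; rewrite inE => e'_rim /andP[xe' pq].
exact: (route_side_const layoutL tri_sub tri_jumps (rimE e'_rim) xe' x_tri pq f_side).
Qed.

Lemma two_sided_rim : exists2 z, outside L (ends rim) z & rim_parity z != rim_parity (centre L u).
Proof.
have [x xc] := cycle_nonempty cycle_c.
have e_rim : [set x; next c x] \in rim by apply/mapP; exists x.
have [p [q [_ _ _ pq _]]] := route_exit layoutL (rimE e_rim) (set21 _ _).
have := chain_jump_at layoutL walkE rimE rim_even (cycle_edges_uniq cycle_c) e_rim pq.
have out f : f \in sides p q -> outside L (ends rim) f.
  exact: (side_outside layoutL (rimE e_rim) pq).
have [eq_u|neq_u _] := eqVneq (rim_parity (low_side p q)) (rim_parity (centre L u)); last first.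
  by exists (low_side p q) => //; apply/out/low_side_in.
rewrite /jump eq_u => diff; exists (high_side p q); first exact/out/high_side_in.
by move: diff; case: (rim_parity _) (rim_parity _) => -[].
Qed.

End Wheel.

(* The cycle c, the vertex u and the component of v in G[S] would form a K5 minor. *)
Lemma no_K5_minor (V : finType) (E : {set {set V}}) (L : layout V) u v (S : {set V}) c :
  is_layout E L -> is_cycle E c -> u \notin c -> {in c, forall x, adj E u x} -> adj E u v ->
  u \notin S -> v \in S -> {in c, forall x, x \notin S} ->
  {in c, forall x, exists2 y, y \in component E S v & adj E x y} -> False.
Proof.
move=> layoutL cycle_c uc spokes uv uS vS c_off_S attached.
have [walk walkE] := edge_walks_exist layoutL.
have [z z_out z_side] := two_sided_rim layoutL walkE u cycle_c.
have rimE := cycle_edges_sub cycle_c.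
have rim_jumps := chain_jumps walkE rimE (rim_even cycle_c).
have v_rim : v \notin ends (cycle_edges c).
  by apply/negP => /ends_rim /c_off_S; rewrite vS.
case/eqP: (z_side).
rewrite (edge_const layoutL (subgraph_chain rimE) rim_jumps uv (u_notin_ends_rim uc) v_rim).
rewrite !(rim_parity_triangles walk u cycle_c); apply: eq_big_seq => e e_rim.
have [x xc xe] : exists2 x, x \in c & x \notin e.
  have [size_c uniq_c _] := cycle_c; have /mapP[y yc ->] := e_rim.
  exists (next c (next c y)); rewrite ?mem_next // !inE negb_or.
  by rewrite (next_next_neq uniq_c) // (next_neq cycle_c) ?mem_next.
have [y] := attached x xc; rewrite inE => /connectP[s path_s eq_y] xy.
have triE := triangle_sub cycle_c spokes e_rim.
have tri_jumps := chain_jumps walkE triE (triangle_even cycle_c uc e_rim).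
have off_S w : w \in S -> w \notin ends (triangle u e).
  move=> wS; apply/negP => /ends_triangle /orP[/eqP eq_w|we]; first by rewrite -eq_w wS in uS.
  by have := c_off_S w (cycle_edges_mem e_rim we); rewrite wS.
have in_S : {subset v :: s <= S}.
  move=> w /(path_connect path_s) v_w; apply: (subsetP (component_sub E vS)).
  by rewrite inE.
have x_off : x \notin ends (triangle u e).
  apply/negP => /ends_triangle; rewrite (negbTE xe) orbF => /eqP eq_x.
  by rewrite -eq_x xc in uc.
rewrite (triangle_parity_rim layoutL walkE cycle_c uc spokes e_rim xc xe z_out z_side).
rewrite (edge_const layoutL (subgraph_chain triE) tri_jumps xy x_off); last first.
  by apply: off_S; rewrite eq_y; exact/in_S/mem_last.
rewrite eq_y; symmetry; apply: (path_const layoutL (subgraph_chain triE) tri_jumps).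
  by apply: sub_path path_s => a b; rewrite adj_induced => /andP[].
by move=> w /in_S /off_S.
Qed.

(** * Separators that contain a cycle *)

Definition cyclic_separators (V : finType) (E : {set {set V}}) : Prop :=
  forall F : {set V}, induces_forest E F ->
    {in ~: F &, forall a b, connect (adj (induced_edges E (~: F))) a b}.

Lemma cyclic_separators_maximal (V : finType) (E : {set {set V}}) u v L :
  simple_graph E -> cyclic_separators E -> u != v -> [set u; v] \notin E ->
  ~ is_layout ([set u; v] |: E) L.
Proof.
move=> simpleE separators neq_uv uvE layoutL.
pose N := [set x | adj E u x]; pose C := ~: (u |: N); pose D := component E C v.
pose S := [set x in N | [exists y in D, adj E x y]].
have uN : u \notin N by rewrite inE; apply/negP => /(adj_neq simpleE); rewrite eqxx.
have CE x : (x \in C) = (x != u) && (x \notin N) by rewrite in_setC in_setU1 negb_or.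
have vC : v \in C by rewrite CE eq_sym neq_uv inE.
have DC : {subset D <= C} by apply/subsetP/component_sub.
have uC : u \notin C by rewrite CE eqxx.
have SN x : x \in S -> x \in N by rewrite inE => /andP[].
have [c cycle_c] : exists c, is_cycle (induced_edges E S) c.
  apply: contrapT => no_cycle.
  have forestS : induces_forest E S by move=> c cycle_c; apply: no_cycle; exists c.
  have uS : u \in ~: S by rewrite in_setC; apply: contra uN; exact: SN.
  have vS : v \in ~: S.
    by rewrite in_setC; apply/negP => /SN vN; move: vC; rewrite CE vN andbF.
  have closedD x y : adj (induced_edges E (~: S)) x y -> x \in D -> y \in D.
    rewrite adj_induced => /and3P[xy _ yS] xD; apply: (component_closed vC xD _ xy).
    have := DC x xD; rewrite !CE => /andP[_ xN]; apply/andP; split.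
      by apply: contraNneq xN => eq_y; rewrite inE adj_sym -eq_y.
    apply: contraL yS => yN; rewrite in_setC negbK inE yN; apply/exists_inP; exists x => //.
    by rewrite adj_sym.
  have := closed_connect (intro_closed (adj_connect_sym _) closedD) (separators S forestS v u vS
    uS).
  by rewrite mem_component => /esym /DC; rewrite (negbTE uC).
have [{}cycle_c cS] := (is_cycle_induced E S c).1 cycle_c.
have cN x : x \in c -> adj E u x by move=> /cS/SN; rewrite inE.
have subE : E \subset [set u; v] |: E by exact: subsetUr.
apply: (no_K5_minor layoutL (sub_is_cycle subE cycle_c) (u := u) (v := v) (S := C)) => //.
- by apply/negP => /cS/SN; rewrite (negbTE uN).
- by move=> x /cN ux; exact: (subsetP subE).
- by rewrite /adj setU11.
- by move=> x /cS/SN xN; rewrite CE xN andbF.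
move=> x /cS; rewrite inE => /andP[_ /exists_inP[y yD xy]].
by exists y; [exact: (subsetP (sub_component C v subE))|exact: (subsetP subE)].
Qed.

Section Visibility.
Variables (V : finType) (E : {set {set V}}) (L : layout V).
Hypothesis layoutL : is_layout E L.
Implicit Types (v a b : V) (e : {set V}) (p q f g : gpoint).
Local Notation K := (drawn L E [set: V]).

Lemma drawn_at_route e p q : e \in E -> p \in route L e -> K p q ->
  walk_edge (route L e) p q \/ exists v, vertex_ball L v p && vertex_ball L v q.
Proof.
move=> eE pe /drawnP[[e' e'E pq]|[v _ in_v]]; last by right; exists v.
have /andP[pe' _] := walk_edge_mem pq.
by left; rewrite (layout_disjoint_routes layoutL eE e'E pe pe').
Qed.

Section AlongRoute.
Variables (e : {set V}) (u v : V) (s : seq gpoint).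
Hypothesis eE : e \in E.
Hypothesis joins_s : joins L u v s.
Hypothesis edge_s : walk_edge s =2 walk_edge (route L e).

Lemma reach_from_last_edge s0 p q f : s = rcons (rcons s0 p) q -> f \in sides p q ->
  exists2 g, reach K f g & touches L v g.
Proof.
move=> eq_s f_side; have uniq_s := joins_uniq joins_s.
have pq : walk_edge s p q.
  by apply/orP; left; apply/stepsP; exists s0, [::]; rewrite eq_s -!cats1 -catA.
have adj_pq := walk_edge_gadj (joins_walk joins_s) pq; rewrite edge_s in pq.
have /andP[_ qe] := walk_edge_mem pq.
have vq : vertex_ball L v q by have := joins_last joins_s; rewrite eq_s last_rcons.
have [w adj_qw vw] := in_ball_neighbour (layout_radius layoutL v) vq.
have neq_wp : w != p.
  apply: contraNneq (route_edge_not_in_ball layoutL v eE pq) => <-.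
  by rewrite vq andbT.
have Kqw : K q w by apply/drawnP; right; exists v; rewrite ?inE ?vq.
rewrite gadjC in adj_pq; rewrite -(sidesC adj_pq) in f_side.
have [d [g [adj_qd neq_dp Kqd g_side fg]]] := reach_around adj_pq f_side adj_qw neq_wp Kqw.
exists g => //; exists q, d; split=> //; case: (drawn_at_route eE qe Kqd) => [|[x /andP[xq xd]]].
  rewrite -edge_s eq_s => /walk_edge_last; rewrite -eq_s => /(_ uniq_s) eq_d.
  by rewrite eq_d eqxx in neq_dp.
by rewrite (layout_disjoint_balls layoutL vq xq).
Qed.

Lemma reach_next_edge s0 p q c t f : s = s0 ++ [:: p, q, c & t] -> f \in sides p q ->
  exists2 g, g \in sides q c & reach K f g.
Proof.
move=> eq_s f_side; have uniq_s := joins_uniq joins_s.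
have pq : walk_edge s p q by apply/orP; left; apply/stepsP; exists s0, (c :: t).
have qc : walk_edge s q c.
  by apply/orP; left; apply/stepsP; exists (rcons s0 p), t; rewrite cat_rcons.
have adj_pq := walk_edge_gadj (joins_walk joins_s) pq.
have adj_qc := walk_edge_gadj (joins_walk joins_s) qc.
rewrite edge_s in pq; have /andP[_ qe] := walk_edge_mem pq.
have Kqc : K q c by apply/drawnP; left; exists e; rewrite -?edge_s.
have neq_cp : c != p.
  rewrite eq_sym; move: uniq_s; rewrite eq_s.
  by rewrite cat_uniq cons_uniq !in_cons !negb_or => /and4P[_ _ /and3P[]].
rewrite gadjC in adj_pq; rewrite -(sidesC adj_pq) in f_side.
have [d [g [adj_qd neq_dp Kqd g_side fg]]] := reach_around adj_pq f_side adj_qc neq_cp Kqc.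
exists g => //; suff <- : d = c by [].
rewrite eq_s in uniq_s; case: (drawn_at_route eE qe Kqd) => [|[x /andP[xq _]]].
  rewrite -edge_s eq_s => /(walk_edge_interior uniq_s).
  by rewrite !inE (negbTE neq_dp) => /eqP.
by have := joins_s; rewrite eq_s => /(joins_interior x); rewrite xq.
Qed.

Lemma reach_along_route s0 p q t f : s = s0 ++ [:: p, q & t] -> f \in sides p q ->
  exists2 g, reach K f g & touches L v g.
Proof.
elim: t s0 p q f => [|c t IH] s0 p q f eq_s f_side.
  by apply: (@reach_from_last_edge s0 p q) f_side; rewrite eq_s -!cats1 -catA.
have [g g_side fg] := reach_next_edge eq_s f_side.
have [||h gh v_h] := IH (rcons s0 p) q c g; rewrite ?cat_rcons //.
by exists h => //; exact: reach_trans fg gh.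
Qed.

End AlongRoute.

Lemma route_side_reaches e v p q f : e \in E -> v \in e -> walk_edge (route L e) p q ->
  f \in sides p q -> exists2 g, reach K f g & touches L v g.
Proof.
move=> eE ve pq f_side; have [u [s [_ _ joins_s edge_s _]]] := route_from layoutL eE ve.
have edge_rev : walk_edge (rev s) =2 walk_edge (route L e) by move=> a b; rewrite walk_edge_rev.
have adj_pq := walk_edge_gadj (route_sorted layoutL eE) pq.
move: pq; rewrite -edge_rev => /orP[] /stepsP[s1 [s2 eq_s]].
  exact: (reach_along_route eE (joins_rev joins_s) edge_rev eq_s f_side).
rewrite sidesC // in f_side.
exact: (reach_along_route eE (joins_rev joins_s) edge_rev eq_s f_side).
Qed.

Definition visible a b : Prop :=
  exists f g, [/\ touches L a f, touches L b g & reach K f g].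

(* Otherwise the faces reachable from A would be separated by the drawing of F. *)
Lemma visible_across_forest (F A : {set V}) a0 b0 : induces_forest E F ->
  a0 \in A -> b0 \notin A -> b0 \notin F -> [disjoint A & F] ->
  (forall a b, a \in A -> b \notin A -> b \notin F -> [set a; b] \notin E) ->
  exists a b, [/\ a \in A, b \notin A, b \notin F & visible a b].
Proof.
move=> forestF a0A b0A b0F disjAF no_edge; apply: contrapT => none.
pose seen f := `[< exists a g, [/\ a \in A, touches L a g & reach K g f] >].
have seen_reach f g : reach K f g -> seen f = seen g.
  move=> fg; apply: asbool_equiv_eq; split=> -[a [h [aA ah hf]]]; exists a, h; split=> //.
    exact: reach_trans hf fg.
  exact: reach_trans hf (reach_sym fg).
have seen_touch v f : v \notin F -> touches L v f -> seen f = (v \in A).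
  move=> vF vf; have [vA|vA] := boolP (v \in A).
    by apply/asboolP; exists v, f; split=> //; exact: reach_refl.
  by apply/asboolP => -[a [g [aA ag gf]]]; apply: none; exists a, v; split=> //; exists g, f.
have jumps : jumps_in (drawn L (induced_edges E F) F) seen.
  move=> p q adj_pq; apply: contraLR => not_drawn; rewrite /jump negb_add; apply/eqP.
  have [Kpq|notK] := boolP (K p q); last first.
    exact/seen_reach/(reach_across adj_pq notK (low_side_in p q) (high_side_in p q)).
  case/drawnP: Kpq => [[e eE pq]|[v _ /andP[vp vq]]].
    have [v ve vF] : exists2 v, v \in e & v \notin F.
      apply/subsetPn; apply: contra not_drawn => eF; apply/drawnP; left.
      by exists e; rewrite // inE eE.
    have [g1 /seen_reach -> /(seen_touch v _ vF) ->] :=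
      route_side_reaches eE ve pq (low_side_in p q).
    by have [g2 /seen_reach -> /(seen_touch v _ vF) ->] :=
      route_side_reaches eE ve pq (high_side_in p q).
  have vF : v \notin F.
    by apply: contra not_drawn => vF; apply/drawnP; right; exists v; rewrite // vp.
  by rewrite !(seen_touch v) //; exists p, q; rewrite ?low_side_in ?high_side_in.
have subF : subgraph E (induced_edges E F) F.
  by split=> [|e]; [exact: induced_sub | rewrite inE => /andP[]].
have a0F : a0 \notin F by rewrite (disjointFr disjAF a0A).
have := forest_does_not_separate layoutL subF forestF jumps
  (centre_outside layoutL a0F) (centre_outside layoutL b0F).
by rewrite !(seen_touch _ _ _ (touches_centre layoutL _)) // a0A (negbTE b0A).
Qed.

End Visibility.

(** * Refining a layout and adding an edge *)

Section RefineLayout.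
Variables (V : finType) (E : {set {set V}}) (L : layout V).
Hypothesis layoutL : is_layout E L.
Implicit Types (v a b x y : V) (e : {set V}) (p q z f : gpoint) (s : seq gpoint).

(* The layout in the refined grid, where the edge e0 gets the new route s0. *)
Definition refine_layout (e0 : {set V}) s0 : layout V :=
  Layout (fun v => gdouble (centre L v)) (fun v => 2 * radius L v)
    (fun e => if e == e0 then s0 else refine (route L e)).

Definition refined_ball v := in_ball (gdouble (centre L v)) (2 * radius L v).

Lemma refine_vertex_ball e0 s0 v : vertex_ball (refine_layout e0 s0) v = refined_ball v.
Proof. by []. Qed.

Lemma refined_ball_double v p : refined_ball v (gdouble p) = vertex_ball L v p.
Proof. exact: in_ball_double. Qed.

Lemma refined_ball_mid v p q : gadj p q ->
  refined_ball v (gmid p q) = vertex_ball L v p && vertex_ball L v q.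
Proof. exact: in_ball_mid. Qed.

Lemma refined_ball_centre v f : refined_ball v (face_centre f) = vertex_face L v f.
Proof. exact: in_ball_centre_face. Qed.

Lemma refine_joins e0 s0 e x y : x != y -> joins L x y (route L e) ->
  joins (refine_layout e0 s0) x y (refine (route L e)).
Proof.
move=> neq_xy [e_walk uniq_e]; case: (route L e) e_walk uniq_e => [|p t] e_walk uniq_e.
  by move=> x0 y0; case/eqP: neq_xy; exact: (layout_disjoint_balls layoutL x0 y0).
move=> hx hy balls; split.
- exact: refine_sorted.
- exact: refine_uniq.
- by rewrite refine_vertex_ball refined_ball_double.
- by rewrite last_refine refine_vertex_ball refined_ball_double.
rewrite last_refine => z v /mem_refine[[q qt ->]|[[q q'] qq' ->]]; rewrite refine_vertex_ball.
  by rewrite refined_ball_double => /(balls q v qt) [[-> ->]|[-> ->]]; [left|right].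
have adj_qq' := steps_sorted e_walk qq'; have /andP[qt q't] := mem_steps qq'.
rewrite refined_ball_mid // => /andP[vq vq']; exfalso; move: adj_qq'.
case: (balls q v qt vq) => -[eq_v ->]; case: (balls q' v q't vq') => -[eq_v' ->];
  rewrite ?gadjxx //; by rewrite -eq_v eq_v' eqxx in neq_xy.
Qed.

Lemma refine_disjoint_routes e e' z : e \in E -> e' \in E ->
  z \in refine (route L e) -> z \in refine (route L e') -> e = e'.
Proof.
move=> eE e'E; have adj_e p q := @steps_sorted _ gadj _ p q (route_sorted layoutL eE).
have adj_e' p q := @steps_sorted _ gadj _ p q (route_sorted layoutL e'E).
case/mem_refine=> [[p pe ->]|[[p q] pq ->]]; case/mem_refine=> [[p' p'e]|[[p' q'] pq']].
- by move/gdouble_inj => eq_p; rewrite -eq_p in p'e;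
    exact: (layout_disjoint_routes layoutL eE e'E pe p'e).
- by move/esym/(gmid_neq_double (adj_e' _ _ pq')).
- by move/(gmid_neq_double (adj_e _ _ pq)).
have /andP[p_e q_e] := mem_steps pq; have /andP[p'_e' _] := mem_steps pq'.
case/(gmid_inj (adj_e _ _ pq) (adj_e' _ _ pq')) => -[eq_p' _]; rewrite eq_p' in p'_e'.
  exact: (layout_disjoint_routes layoutL eE e'E p_e p'_e').
exact: (layout_disjoint_routes layoutL eE e'E q_e p'_e').
Qed.

Lemma refine_is_layout e0 s0 : e0 \notin E -> is_layout E (refine_layout e0 s0).
Proof.
move=> e0E; have neq_e0 e : e \in E -> (e == e0) = false.
  by move=> eE; apply: contraNF e0E => /eqP <-.
split=> [v|u v p|e eE|e e' z eE e'E] /=.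
- by have := layout_radius layoutL v; lia.
- by move=> /in_ball_half u_p /in_ball_half v_p; exact: (layout_disjoint_balls layoutL u_p v_p).
- have [x [y [eq_e neq_xy joins_e]]] := layout_route layoutL eE.
  by exists x, y; rewrite neq_e0 //; split=> //; exact: refine_joins.
by rewrite !neq_e0 //; exact: refine_disjoint_routes.
Qed.

Lemma refine_add_edge a b s : a != b -> [set a; b] \notin E ->
  joins (refine_layout [set a; b] s) a b s ->
  {in E, forall e z, z \in s -> z \notin refine (route L e)} ->
  is_layout ([set a; b] |: E) (refine_layout [set a; b] s).
Proof.
move=> neq_ab abE joins_s disj_s; have layoutL' := refine_is_layout s abE.
have neq_ab' e : e \in E -> (e == [set a; b]) = false.
  by move=> eE; apply: contraNF abE => /eqP <-.
split; [exact: layout_radius layoutL' | exact: layout_disjoint_balls layoutL' | |].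
  move=> e; rewrite in_setU1 => /orP[/eqP ->|]; last exact: (layout_route layoutL').
  by exists a, b; split=> //=; rewrite eqxx.
move=> e e' z; rewrite !in_setU1 => /orP[/eqP->|eE] /orP[/eqP->|e'E] //=; rewrite ?eqxx ?neq_ab' //.
- by move=> zs; rewrite (negbTE (disj_s _ e'E z zs)).
- by move=> + zs; rewrite (negbTE (disj_s _ eE z zs)).
exact: refine_disjoint_routes.
Qed.

(* The points of the refined grid through which an edge from a to b may be drawn. *)
Definition free_point a b z : Prop :=
  {in E, forall e, z \notin refine (route L e)} /\ forall v, refined_ball v z -> v \in [set a; b].

Lemma free_centre a b f : (forall v, vertex_face L v f -> v \in [set a; b]) ->
  free_point a b (face_centre f).
Proof.
move=> in_ab; split=> [e eE|v]; last by rewrite refined_ball_centre; exact: in_ab.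
apply/negP => /mem_refine[[p _ /esym/gdouble_neq_centre //]|[[p q] pq /esym]].
exact/gmid_neq_centre/(steps_sorted (route_sorted layoutL eE) pq).
Qed.

Lemma free_mid a b p q : gadj p q -> {in E, forall e, ~~ walk_edge (route L e) p q} ->
  (forall v, vertex_ball L v p -> vertex_ball L v q -> v \in [set a; b]) ->
  free_point a b (gmid p q).
Proof.
move=> adj_pq off_routes in_ab; split=> [e eE|v]; last first.
  by rewrite refined_ball_mid // => /andP[]; exact: in_ab.
apply: contra (off_routes e eE) => /mem_refine[[z _ /(gmid_neq_double adj_pq) //]|[[p' q'] pq']].
case/(gmid_inj adj_pq (steps_sorted (route_sorted layoutL eE) pq')) => -[eq_p' eq_q'];
  by rewrite /walk_edge -eq_p' -eq_q' pq' ?orbT.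
Qed.

Lemma touches_free_walk a b x f : x \in [set a; b] -> touches L x f ->
  exists p q, [/\ refined_ball x (gmid p q), free_point a b (gmid p q),
    gadj (gmid p q) (face_centre f) & free_point a b (face_centre f)].
Proof.
move=> x_ab [p [q [adj_pq xp xq f_side]]]; exists p, q; split.
- by rewrite refined_ball_mid ?xp.
- apply: free_mid adj_pq _ _ => [e eE|v vp _].
    by apply: contraL (xp) => /(route_edge_not_in_ball layoutL x eE); rewrite xq andbT.
  by rewrite (layout_disjoint_balls layoutL vp xp).
- by rewrite gadjC gadj_centre_mid.
have /andP[fp _] := side_corner adj_pq f_side.
by apply: free_centre => v /vertex_face_corner /(_ fp) vp;
  rewrite (layout_disjoint_balls layoutL vp xp).
Qed.

Lemma visible_free_walk a b : visible E L a b -> exists p s,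
  [/\ path gadj p s, refined_ball a p, refined_ball b (last p s) &
    {in p :: s, forall z, free_point a b z}].
Proof.
case=> f [g [touch_f touch_g fg]].
have [p [q [ap free_p adj_pf free_f]]] := touches_free_walk (set21 a b) touch_f.
have [p' [q' [bp' free_p' adj_p'g _]]] := touches_free_walk (set22 a b) touch_g.
have [s [walk_s last_s off_s]] := reach_walk fg.
exists (gmid p q), (face_centre f :: rcons s (gmid p' q')); split=> //.
- by rewrite /= rcons_path adj_pf walk_s last_s gadjC.
- by rewrite /= last_rcons.
move=> z; rewrite !inE mem_rcons inE => /or4P[/eqP-> //|/eqP-> //|/eqP-> //|].
case/off_s=> [c [d [adj_cd notK z_cd]]].
have [off_routes off_balls] : {in E, forall e, ~~ walk_edge (route L e) c d} /\
    forall v, ~~ (vertex_ball L v c && vertex_ball L v d).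
  split=> [e eE|v]; apply: contra notK => cd; apply/drawnP; first by left; exists e.
  by right; exists v; rewrite ?inE.
case: z_cd => [->|[h h_side ->]].
  by apply: free_mid adj_cd off_routes _ => v vc vd; have := off_balls v; rewrite vc vd.
apply: free_centre => v h_v; have /andP[hc hd] := side_corner adj_cd h_side.
by have := off_balls v; rewrite !(vertex_face_corner h_v).
Qed.

Lemma extend_layout a b : a != b -> [set a; b] \notin E -> visible E L a b ->
  exists s, is_layout ([set a; b] |: E) (refine_layout [set a; b] s).
Proof.
move=> neq_ab abE /visible_free_walk[p [s [walk_s ap b_last free]]].
have [p' [s' [walk_s' uniq_s' sub_s' [ap' b_last'] only]]] :=
  simple_path_between gadjC walk_s ap b_last.
exists (p' :: s'); apply: refine_add_edge => //.
  split=> // z v zs vz; have [only_a only_b] := only z zs.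
  have [_ in_ab] := free z (sub_s' z zs).
  have /set2P[eq_v|eq_v] := in_ab v vz; [left|right]; split=> //.
    by apply: only_a; rewrite -eq_v.
  by apply: only_b; rewrite -eq_v.
by move=> e eE z /sub_s' zs; have [off _] := free z zs; exact: off.
Qed.

End RefineLayout.

Lemma cyclic_separators_or_extend (V : finType) (E : {set {set V}}) L : is_layout E L ->
  cyclic_separators E \/ exists a b s, [/\ a != b, [set a; b] \notin E &
    is_layout ([set a; b] |: E) (refine_layout L [set a; b] s)].
Proof.
move=> layoutL; apply: contrapT => /not_orP[+ no_extension]; apply => F forestF a b aF bF.
apply: contrapT => not_conn; apply: no_extension.
pose A := component E (~: F) a.
have bA : b \notin A by rewrite inE; apply/negP.
have disjAF : [disjoint A & F] by rewrite disjoints_subset component_sub.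
have no_edge x y : x \in A -> y \notin A -> y \notin F -> [set x; y] \notin E.
  by move=> xA yA yF; apply: contra yA => xy; apply: (component_closed aF xA _ xy); rewrite inE.
rewrite in_setC in bF.
have [a' [b' [a'A b'A b'F vis]]] :=
  visible_across_forest layoutL forestF (mem_component E _ a) bA bF disjAF no_edge.
have neq_ab : a' != b' by apply: contraNneq b'A => <-.
have abE := no_edge _ _ a'A b'A b'F.
by have [s layout_s] := extend_layout layoutL neq_ab abE vis; exists a', b', s.
Qed.

(** * From layouts to drawings *)

Section Arcs.
Variable R : realType.
Implicit Types (a b c z : R * R) (g : R -> R * R) (t : R).

Definition segment a b z : Prop := exists2 t, 0 <= t <= 1 & z = a + t *: (b - a).

Lemma segment_sym a b z : segment a b z -> segment b a z.
Proof.
case=> t t01 ->; exists (1 - t); first by lra.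
by rewrite scalerBl scale1r addrA subrKC -scalerN opprB.
Qed.

Lemma segment_end a b : segment a b b.
Proof. by exists 1; rewrite ?ler01 ?lexx // scale1r subrKC. Qed.

Lemma arc_trace_at g t : 0 <= t <= 1 -> arc_trace g (g t).
Proof. by move=> t01; exists t; rewrite //= in_itv. Qed.

Lemma segment_arc a b : a <> b -> exists g,
  [/\ continuous g, is_arc g a b & forall z, arc_trace g z -> segment a b z].
Proof.
move=> neq_ab; pose g t := a + t *: (b - a); exists g.
have cont_g : continuous g.
  by move=> t; apply: cvgD; [exact: cvg_cst | exact: scalel_continuous].
split=> //; last by move=> z [t]; rewrite /= in_itv /= => t01 <-; exists t.
split; [exact: continuous_subspaceT| |by rewrite /g scale0r addr0|by rewrite /g scale1r subrKC].
move=> s t _ _ /addrI /eqP; rewrite -subr_eq0 -scalerBl scaler_eq0 !subr_eq0.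
by case/orP => /eqP // eq_ba; case: neq_ab.
Qed.

Section Concat.
Variables (g1 g2 : R -> R * R) (a b c : R * R).
Hypotheses (cont1 : continuous g1) (cont2 : continuous g2).
Hypotheses (arc1 : is_arc g1 a b) (arc2 : is_arc g2 b c).
Hypothesis meet_at_b : forall z, arc_trace g1 z -> arc_trace g2 z -> z = b.

Definition concat_arcs t : R * R := g1 (Num.min (2 * t) 1) + (g2 (Num.max (2 * t - 1) 0) - b).

Lemma concat_arcsl t : t <= 2^-1 -> concat_arcs t = g1 (2 * t).
Proof.
move=> t_le; rewrite /concat_arcs min_l; last by lra.
by rewrite max_r; [case: arc2 => _ _ -> _; rewrite subrr addr0 | lra].
Qed.

Lemma concat_arcsr t : 2^-1 <= t -> concat_arcs t = g2 (2 * t - 1).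
Proof.
move=> t_ge; rewrite /concat_arcs min_r; last by lra.
by rewrite max_l; [case: arc1 => _ _ _ ->; rewrite addrC subrK | lra].
Qed.

Lemma continuous_concat_arcs : continuous concat_arcs.
Proof.
have cont_double : continuous (fun t => 2 * t).
  by move=> t; apply: cvgM; [exact: cvg_cst | exact: cvg_id].
move=> t; apply: cvgD.
  apply: (continuous_comp (f := fun t => Num.min (2 * t) 1)); last exact: cont1.
  by apply: min_fun_continuous => //; exact: cst_continuous.
apply: cvgB; last exact: cvg_cst.
apply: (continuous_comp (f := fun t => Num.max (2 * t - 1) 0)); last exact: cont2.
apply: max_fun_continuous; last exact: cst_continuous.
by move=> s; apply: cvgB; [exact: cont_double | exact: cvg_cst].
Qed.

Lemma concat_arcs_inj : {in `[0, 1]%R &, injective concat_arcs}.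
Proof.
case: arc1 arc2 => _ inj1 _ g1_1 [_ inj2 g2_0 _].
have in01 t : 0 <= t <= 1 -> t \in `[0, 1]%R by rewrite in_itv.
have mixed s t : 0 <= s <= 2^-1 -> 2^-1 <= t <= 1 -> concat_arcs s = concat_arcs t -> s = t.
  move=> s_in t_in; rewrite concat_arcsl ?concat_arcsr; [|lra..] => eq_st.
  have s01 : 0 <= 2 * s <= 1 by lra.
  have t01 : 0 <= 2 * t - 1 <= 1 by lra.
  have at_b : g1 (2 * s) = b.
    by apply: meet_at_b; [|rewrite eq_st]; exact: arc_trace_at.
  have eq_s : 2 * s = 1 by apply: inj1; rewrite ?at_b ?g1_1 //; apply: in01; lra.
  have eq_t : 2 * t - 1 = 0 by apply: inj2; rewrite -?eq_st ?at_b ?g2_0 //; apply: in01; lra.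
  by lra.
move=> s t; rewrite !in_itv /= => s01 t01.
have [s_le|s_gt] := lerP s 2^-1; have [t_le|t_gt] := lerP t 2^-1.
- rewrite !concat_arcsl // => /inj1 eq_st; have : 2 * s = 2 * t by apply: eq_st; apply: in01; lra.
  by lra.
- by apply: mixed; lra.
- by move=> eq_st; symmetry; apply: mixed; [lra | lra | rewrite eq_st].
rewrite !concat_arcsr; [|lra..] => /inj2 eq_st.
have : 2 * s - 1 = 2 * t - 1 by apply: eq_st; apply: in01; lra.
by lra.
Qed.

Lemma arc_concat : exists g, [/\ continuous g, is_arc g a c &
  forall z, arc_trace g z -> arc_trace g1 z \/ arc_trace g2 z].
Proof.
case: (arc1) (arc2) => _ _ g1_0 _ [_ _ _ g2_1].
exists concat_arcs; split; first exact: continuous_concat_arcs.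
  split; [exact/continuous_subspaceT/continuous_concat_arcs|exact: concat_arcs_inj| |].
    by rewrite concat_arcsl ?mulr0 //; lra.
  by rewrite concat_arcsr; [rewrite (_ : 2 * 1 - 1 = 1) //; lra | lra].
move=> z [t]; rewrite /= in_itv /= => t01 <-; have [t_le|t_gt] := lerP t 2^-1.
  by left; rewrite concat_arcsl //; apply: arc_trace_at; lra.
by right; rewrite concat_arcsr ?ltW //; apply: arc_trace_at; lra.
Qed.

End Concat.

Definition polyline_trace (s : seq (R * R)) z : Prop :=
  exists2 ab, ab \in steps s & segment ab.1 ab.2 z.

Fixpoint simple_polyline (s : seq (R * R)) : Prop :=
  if s is a :: (b :: _) as s' then
    [/\ a <> b, forall z, segment a b z -> polyline_trace s' z -> z = b & simple_polyline s']
  else True.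

Lemma polyline_trace_cons a b s z :
  polyline_trace [:: a, b & s] z <-> segment a b z \/ polyline_trace (b :: s) z.
Proof.
split=> [[ab]|[ab_z|[ab ab_s ab_z]]].
- by rewrite steps_cons in_cons => /orP[/eqP -> |ab_s] ab_z; [left|right; exists ab].
- by exists (a, b); rewrite // steps_cons mem_head.
by exists ab; rewrite // steps_cons in_cons ab_s orbT.
Qed.

Lemma polyline_arc a b s : simple_polyline [:: a, b & s] -> exists g,
  [/\ continuous g, is_arc g a (last b s) &
    forall z, arc_trace g z -> polyline_trace [:: a, b & s] z].
Proof.
elim: s a b => [|c s IH] a b.
  case=> /segment_arc[g [cont_g arc_g trace_g]] _ _; exists g; split=> // z /trace_g ab_z.
  by apply/polyline_trace_cons; left.
case=> /segment_arc[g1 [cont1 arc1 trace1]] meet_b /IH[g2 [cont2 arc2 trace2]].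
have meet z : arc_trace g1 z -> arc_trace g2 z -> z = b.
  by move=> /trace1 ab_z /trace2; exact: meet_b.
have [g [cont_g arc_g trace_g]] := arc_concat cont1 cont2 arc1 arc2 meet.
exists g; split=> // z /trace_g[/trace1|/trace2] z_in; apply/polyline_trace_cons; first by left.
by right.
Qed.

End Arcs.

(** ** Grid points in the plane *)

Section GridInPlane.
Variable R : realType.
Implicit Types (p q o w : gpoint) (r : int) (z : R * R).

Definition plane p : R * R := (p.1%:~R, p.2%:~R).
Definition gfloor z : gpoint := (Num.floor z.1, Num.floor z.2).
Definition gceil z : gpoint := (Num.ceil z.1, Num.ceil z.2).

Lemma planeK : cancel plane gfloor.
Proof. by case=> x y; rewrite /gfloor /= !intrKfloor. Qed.

Lemma gceil_plane : cancel plane gceil.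
Proof. by case=> x y; rewrite /gceil /= !intrKceil. Qed.

Lemma plane_inj : injective plane.
Proof. exact: can_inj planeK. Qed.

Lemma norm_plane p q : `|plane p - plane q| = (gdist p q)%:~R.
Proof.
rewrite prod_normE /= -!intrB -!intr_norm /gdist.
by case: (leP `|p.1 - q.1| `|p.2 - q.2|) => le_pq; [rewrite max_r|rewrite max_l];
  rewrite ?ler_int // ltW.
Qed.

Lemma plane_in_ball o r p : (`|plane p - plane o| <= r%:~R) = in_ball o r p.
Proof. by rewrite norm_plane ler_int. Qed.

Lemma floor_ceil_in_ball o r z :
  `|z - plane o| <= r%:~R -> in_ball o r (gfloor z) && in_ball o r (gceil z).
Proof.
rewrite prod_normE /= ge_max !ler_distl -!intrB -!intrD !in_ballE /=.
case/andP => /andP[z1_ge z1_le] /andP[z2_ge z2_le].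
rewrite !floor_ge_int !ceil_le_int z1_ge z1_le z2_ge z2_le /=.
have floor_le (x : R) m : x <= m%:~R -> Num.floor x <= m.
  by move=> x_le; rewrite -(ler_int R); apply: le_trans x_le; exact: floor_le.
have ceil_ge (x : R) m : m%:~R <= x -> m <= Num.ceil x.
  by move=> x_ge; rewrite -(ler_int R); apply: le_trans x_ge _; exact: ceil_ge.
by rewrite !floor_le ?ceil_ge.
Qed.

(* Off its ends, a point of a unit segment is rounded to both of them. *)
Lemma unit_segment p q z : gadj p q -> segment (plane p) (plane q) z ->
  z \in map plane [:: p; q] \/ (gfloor z, gceil z) \in [:: (p, q); (q, p)].
Proof.
have floor_ceil (x : int) t : 0 < t < 1 -> Num.floor (x%:~R + t : R) = x /\
    Num.ceil (x%:~R + t : R) = x + 1.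
  by move=> t01; split; [apply: floor_def | apply: ceil_def]; rewrite ?addrK intrD; lra.
move: p q; apply: gadj_ind => [p q _ IH|x y|x y].
- by move/segment_sym/IH; rewrite !inE orbC [in X in _ \/ X]orbC.
- case=> t t01 ->; have [->|t_neq0] := eqVneq t 0; first by left; rewrite scale0r addr0 mem_head.
  have [->|t_neq1] := eqVneq t 1; first by left; rewrite scale1r subrKC !inE eqxx orbT.
  have -> : plane (x, y) + t *: (plane (x, y + 1) - plane (x, y)) = (x%:~R, y%:~R + t).
    by congr (_, _); rewrite /= /GRing.scale /= ?intrD; ring.
  have [|floor_y ceil_y] := floor_ceil y t; first by lra.
  by right; rewrite /gfloor /gceil /= intrKfloor intrKceil floor_y ceil_y mem_head.
case=> t t01 ->; have [->|t_neq0] := eqVneq t 0; first by left; rewrite scale0r addr0 mem_head.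
have [->|t_neq1] := eqVneq t 1; first by left; rewrite scale1r subrKC !inE eqxx orbT.
have -> : plane (x, y) + t *: (plane (x + 1, y) - plane (x, y)) = (x%:~R + t, y%:~R).
  by congr (_, _); rewrite /= /GRing.scale /= ?intrD; ring.
have [|floor_x ceil_x] := floor_ceil x t; first by lra.
by right; rewrite /gfloor /gceil /= intrKfloor intrKceil floor_x ceil_x mem_head.
Qed.

Lemma unit_segment_lattice p q w : gadj p q -> segment (plane p) (plane q) (plane w) ->
  w \in [:: p; q].
Proof.
move=> adj_pq /(unit_segment adj_pq); rewrite (mem_map plane_inj) planeK gceil_plane.
by case=> //; rewrite !inE => /orP[] /eqP[-> _]; rewrite eqxx ?orbT.
Qed.

Lemma unit_segments_meet p q p' q' z : gadj p q -> gadj p' q' ->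
  segment (plane p) (plane q) z -> segment (plane p') (plane q') z ->
  {subset [:: p; q] <= [:: p'; q']} \/
  exists w, [/\ w \in [:: p; q], w \in [:: p'; q'] & z = plane w].
Proof.
move=> adj_pq adj_pq' pq_z pq'_z; case: (unit_segment adj_pq pq_z) => [/mapP[w w_pq eq_z]|z_pq].
  by right; exists w; split=> //; apply: unit_segment_lattice adj_pq' _; rewrite -eq_z.
case: (unit_segment adj_pq' pq'_z) => [/mapP[w w_pq' eq_z]|].
  by right; exists w; split=> //; apply: unit_segment_lattice adj_pq _; rewrite -eq_z.
by move: z_pq; rewrite !inE => /orP[] /eqP[<- <-] /orP[] /eqP[<- <-]; left=> w;
  rewrite !inE // orbC.
Qed.

Lemma unit_segment_ball p q o r z : gadj p q -> ~~ (in_ball o r p && in_ball o r q) ->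
  segment (plane p) (plane q) z -> `|z - plane o| <= r%:~R ->
  exists w, [/\ w \in [:: p; q], in_ball o r w & z = plane w].
Proof.
move=> adj_pq not_in /(unit_segment adj_pq) [/mapP[w w_pq ->]|z_pq] z_in.
  by exists w; rewrite -plane_in_ball.
have /andP[floor_in ceil_in] := floor_ceil_in_ball z_in; move: z_pq not_in.
by rewrite !inE => /orP[] /eqP[<- <-]; rewrite floor_in ceil_in.
Qed.

Lemma radius_in_ball o r p z : in_ball o r p -> segment (plane o) (plane p) z ->
  `|z - plane o| <= r%:~R.
Proof.
rewrite -plane_in_ball => p_in [t t01 ->]; have /andP[t_ge0 t_le1] := t01.
rewrite addrC addKr normrZ ger0_norm //; apply: le_trans p_in.
by rewrite ler_piMl.
Qed.

Lemma radii_meet o r p p' z : 0 < r -> on_sphere o r p -> on_sphere o r p' ->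
  segment (plane o) (plane p) z -> segment (plane o) (plane p') z -> z = plane o \/ p = p'.
Proof.
move=> r_gt0 /eqP dist_p /eqP dist_p' [t t01 ->] [t' t'01 /addrI eq_z].
have eq_t : t = t'.
  have := congr1 Num.norm eq_z; rewrite !normrZ !norm_plane dist_p dist_p'.
  rewrite !ger0_norm; [|lra..]; apply: mulIf.
  by rewrite intr_eq0 gt_eqF.
have [t0|t_neq0] := eqVneq t 0; first by left; rewrite t0 scale0r addr0.
right; apply: plane_inj; move: eq_z; rewrite -eq_t => /(scalerI t_neq0).
exact: addIr.
Qed.

Lemma disjoint_balls_plane o r o' r' z : `|z - plane o| <= r%:~R -> `|z - plane o'| <= r'%:~R ->
  exists2 w, in_ball o r w & in_ball o' r' w.
Proof.
by move=> /floor_ceil_in_ball /andP[? _] /floor_ceil_in_ball /andP[? _]; exists (gfloor z).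
Qed.

End GridInPlane.

Section Drawing.
Variables (R : realType) (V : finType) (E : {set {set V}}) (L : layout V).
Hypothesis layoutL : is_layout E L.
Implicit Types (u v x y : V) (e : {set V}) (p q w : gpoint) (s : seq gpoint) (z : R * R).

Local Notation plane := (@plane R).
Local Notation in_vertex v z := (`|z - plane (centre L v)| <= (radius L v)%:~R).

Lemma sphere_neq_centre v p : on_sphere (centre L v) (radius L v) p ->
  plane (centre L v) <> plane p.
Proof.
move=> on_p /plane_inj eq_p; move: on_p; rewrite /on_sphere /gdist -eq_p !subrr normr0 maxxx.
by have := layout_radius layoutL v; case: eqP => // <-.
Qed.

Lemma in_vertex_inj u v z : in_vertex u z -> in_vertex v z -> u = v.
Proof.
by move=> u_z /(disjoint_balls_plane u_z)[w uw vw]; exact: (layout_disjoint_balls layoutL uw vw).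
Qed.

Lemma route_step_in_vertex e p q v z : e \in E -> walk_edge (route L e) p q ->
  segment (plane p) (plane q) z -> in_vertex v z ->
  exists w, [/\ w \in route L e, vertex_ball L v w & z = plane w].
Proof.
move=> eE pq pq_z v_z; have adj_pq := walk_edge_gadj (route_sorted layoutL eE) pq.
have [w [w_pq vw ->]] := unit_segment_ball adj_pq (route_edge_not_in_ball layoutL v eE pq) pq_z v_z.
exists w; split=> //; have /andP[pe qe] := walk_edge_mem pq.
by move: w_pq; rewrite !inE => /orP[] /eqP ->.
Qed.

(* The arc of an edge: its route, and radii of the balls of its ends. *)
Definition edge_trace e z : Prop :=
  (exists v p, [/\ p \in route L e, vertex_ball L v p &
    segment (plane (centre L v)) (plane p) z]) \/
  (exists p q, walk_edge (route L e) p q /\ segment (plane p) (plane q) z).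

Lemma steps_map_plane s a b : (a, b) \in steps (map plane s) ->
  exists2 pq, pq \in steps s & (a, b) = (plane pq.1, plane pq.2).
Proof.
elim: s => [|p [|q s] IH] //; rewrite /= !steps_cons !in_cons => /orP[/eqP ->|/IH[pq pq_s ->]].
  by exists (p, q); rewrite ?mem_head.
by exists pq; rewrite // in_cons pq_s orbT.
Qed.

Lemma lattice_polyline_trace p s (c : R * R) z : polyline_trace (rcons (map plane (p :: s)) c) z ->
  (exists2 ab, ab \in steps (p :: s) & segment (plane ab.1) (plane ab.2) z) \/
  segment (plane (last p s)) c z.
Proof.
rewrite /= -cats1 => -[[a b]]; rewrite steps_cat mem_cat last_map => /orP[].
  rewrite -map_cons => /steps_map_plane[pq pq_s [-> ->]] pq_z.
  by left; exists pq.
by rewrite inE => /eqP[-> ->]; right.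
Qed.

Lemma lattice_polyline_simple p s (c : R * R) : path gadj p s -> uniq (p :: s) ->
  plane (last p s) <> c ->
  {in steps (p :: s), forall ab z, segment (plane ab.1) (plane ab.2) z ->
    segment (plane (last p s)) c z -> z = plane (last p s)} ->
  simple_polyline (rcons (map plane (p :: s)) c).
Proof.
elim: s p => [|q s IH] p; first by move=> _ _ neq_c _; split=> // z _ [].
move=> /andP[adj_pq walk_s]; rewrite cons_uniq => /andP[p_off uniq_s] neq_c meet_c; split.
- by move/plane_inj => eq_pq; rewrite eq_pq mem_head in p_off.
- move=> z pq_z /lattice_polyline_trace[[[a b] ab ab_z]|last_z].
    have adj_ab := @steps_sorted _ gadj (q :: s) a b walk_s ab.
    have ab_s w : w \in [:: a; b] -> w \in q :: s.
      by have /andP[a_s b_s] := mem_steps ab; rewrite !inE => /orP[] /eqP ->.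
    case: (unit_segments_meet adj_pq adj_ab pq_z ab_z) => [sub|[w [w_pq w_ab ->]]].
      by rewrite (ab_s p) // sub ?mem_head in p_off.
    move: w_pq (ab_s w w_ab); rewrite !inE => /orP[] /eqP -> //.
    by rewrite -in_cons (negbTE p_off).
  have eq_z : z = plane (last q s) by apply: (meet_c (p, q)); rewrite ?mem_head.
  rewrite eq_z in pq_z *; have := unit_segment_lattice adj_pq pq_z.
  rewrite !inE => /orP[] /eqP eq_last; last by rewrite eq_last.
  by rewrite -eq_last mem_last in p_off.
apply: IH => // ab ab_s; apply: meet_c; rewrite steps_cons in_cons ab_s; exact: orbT.
Qed.

Lemma route_in_vertex e x y p q z : e \in E -> x != y -> joins L x y (route L e) ->
  walk_edge (route L e) p q -> segment (plane p) (plane q) z ->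
  (in_vertex x z -> z = plane (head 0 (route L e))) /\
  (in_vertex y z -> z = plane (last 0 (route L e))).
Proof.
move=> eE neq_xy joins_e pq pq_z; split=> in_z;
  have [w [we vw ->]] := route_step_in_vertex eE pq pq_z in_z;
  case: (joins_ball joins_e we vw) => -[eq_v ->] //;
  by rewrite eq_v eqxx in neq_xy.
Qed.

Lemma edge_arc e : e \in E -> exists2 g : R -> R * R,
  exists x y, e = [set x; y] /\ is_arc g (plane (centre L x)) (plane (centre L y)) &
  forall z, arc_trace g z -> edge_trace e z.
Proof.
move=> eE; have [x [y [eq_e neq_xy joins_e]]] := layout_route layoutL eE.
have near_end p q z := @route_in_vertex e x y p q z eE neq_xy joins_e.
have on_ball v p := @route_on_sphere _ _ _ layoutL e p v eE.
case: joins_e => e_walk uniq_e x_head y_last _; rewrite /edge_trace.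
case: (route L e) e_walk uniq_e x_head y_last near_end on_ball => [|p s] /=.
  by move=> _ _ x0 y0; case/eqP: neq_xy; exact: (layout_disjoint_balls layoutL x0 y0).
move=> walk_s uniq_s xp y_last near_end on_ball.
have head_sphere := on_ball x p (mem_head _ _) xp.
have last_sphere := on_ball y _ (mem_last p s) y_last.
have on_route (ab : gpoint * gpoint) : ab \in steps (p :: s) -> walk_edge (p :: s) ab.1 ab.2.
  by case: ab => a b ab; rewrite /walk_edge ab.
pose c := plane (centre L y).
have y_z z : segment (plane (last p s)) c z -> in_vertex y z.
  by move/segment_sym; exact: radius_in_ball.
have simple_e : simple_polyline (plane (centre L x) :: rcons (map plane (p :: s)) c).
  split; first exact: sphere_neq_centre.
    move=> z x_p_z /lattice_polyline_trace[[ab /on_route ab_s ab_z]|/y_z in_y].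
      exact: (near_end _ _ _ ab_s ab_z).1 (radius_in_ball xp x_p_z).
    by case/eqP: neq_xy; exact: in_vertex_inj (radius_in_ball xp x_p_z) in_y.
  apply: lattice_polyline_simple => //.
    by move/esym; exact: sphere_neq_centre.
  by move=> ab /on_route ab_s z ab_z /y_z; exact: (near_end _ _ _ ab_s ab_z).2.
have [g [_ arc_g trace_g]] := polyline_arc simple_e; exists g.
  by exists x, y; split=> //; move: arc_g; rewrite last_rcons.
move=> z /trace_g /polyline_trace_cons[x_p_z|/lattice_polyline_trace[[ab ab_s ab_z]|last_z]].
- by left; exists x, p; rewrite mem_head.
- by right; exists ab.1, ab.2; split=> //; exact: on_route.
by left; exists y, (last p s); split=> //; [exact: mem_last | exact: segment_sym].
Qed.

(* A radius inside a ball meets the routes only at its end. *)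
Lemma radius_meets_route e e' v p a b z : e \in E -> e' \in E ->
  p \in route L e -> vertex_ball L v p -> segment (plane (centre L v)) (plane p) z ->
  walk_edge (route L e') a b -> segment (plane a) (plane b) z -> e = e'.
Proof.
move=> eE e'E pe vp p_z ab ab_z.
have [w [we' vw eq_z]] := route_step_in_vertex e'E ab ab_z (radius_in_ball vp p_z).
have w_sphere := route_on_sphere layoutL e'E we' vw; rewrite eq_z in p_z.
have r_gt0 : 0 < radius L v by have := layout_radius layoutL v; lia.
case: (radii_meet r_gt0 (route_on_sphere layoutL eE pe vp) w_sphere p_z (segment_end _ _)).
  by move/esym => /(sphere_neq_centre w_sphere).
by move=> eq_p; rewrite eq_p in pe; exact: (layout_disjoint_routes layoutL eE e'E pe we').
Qed.

Lemma edge_traces_meet e e' z : e \in E -> e' \in E -> e <> e' ->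
  edge_trace e z -> edge_trace e' z -> exists2 v, v \in e :&: e' & z = plane (centre L v).
Proof.
move=> eE e'E neq_e [[v [p [pe vp p_z]]]|[a [b [ab ab_z]]]].
  case=> [[v' [p' [pe' vp' p'_z]]]|[a' [b' [ab' ab'_z]]]]; last first.
    by case: neq_e; exact: radius_meets_route eE e'E pe vp p_z ab' ab'_z.
  have eq_v := in_vertex_inj (radius_in_ball vp p_z) (radius_in_ball vp' p'_z).
  rewrite -eq_v in vp' p'_z; have r_gt0 : 0 < radius L v by have := layout_radius layoutL v; lia.
  have p_sphere := route_on_sphere layoutL eE pe vp.
  have p'_sphere := route_on_sphere layoutL e'E pe' vp'.
  case: (radii_meet r_gt0 p_sphere p'_sphere p_z p'_z) => [->|eq_p].
    by exists v; rewrite // inE (route_ball layoutL eE pe vp) (route_ball layoutL e'E pe' vp').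
  by rewrite -eq_p in pe'; case: neq_e; exact: (layout_disjoint_routes layoutL eE e'E pe pe').
case=> [[v [p [pe' vp p_z]]]|[a' [b' [ab' ab'_z]]]]; case: neq_e.
  by symmetry; exact: radius_meets_route e'E eE pe' vp p_z ab ab_z.
have /andP[ae be] := walk_edge_mem ab; have /andP[ae' be'] := walk_edge_mem ab'.
have adj_ab := walk_edge_gadj (route_sorted layoutL eE) ab.
have adj_ab' := walk_edge_gadj (route_sorted layoutL e'E) ab'.
have in_e w : w \in [:: a; b] -> w \in route L e by rewrite !inE => /orP[] /eqP ->.
have in_e' w : w \in [:: a'; b'] -> w \in route L e' by rewrite !inE => /orP[] /eqP ->.
case: (unit_segments_meet adj_ab adj_ab' ab_z ab'_z) => [sub|[w [/in_e we /in_e' we' _]]].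
  have /sub/in_e' ae'' : a \in [:: a; b] by rewrite mem_head.
  exact: (layout_disjoint_routes layoutL eE e'E ae ae'').
exact: (layout_disjoint_routes layoutL eE e'E we we').
Qed.

Lemma edge_trace_vertex e v : e \in E -> edge_trace e (plane (centre L v)) -> v \in e.
Proof.
have v_v : in_vertex v (plane (centre L v)).
  by rewrite plane_in_ball; exact: centre_in_ball layoutL v.
move=> eE [[u [p [pe up p_v]]]|[a [b [ab ab_v]]]].
  by rewrite -(in_vertex_inj (radius_in_ball up p_v) v_v); exact: (route_ball layoutL eE pe up).
have [w [we vw _]] := route_step_in_vertex eE ab ab_v v_v.
exact: (route_ball layoutL eE we vw).
Qed.

Lemma layout_planar : planar R E.
Proof.
have /choice[arc arcP] : forall e, exists g : R -> R * R, e \in E ->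
    (exists x y, e = [set x; y] /\ is_arc g (plane (centre L x)) (plane (centre L y))) /\
    forall z, arc_trace g z -> edge_trace e z.
  move=> e; have [eE|_] := boolP (e \in E); last by exists (fun=> 0).
  by have [g] := edge_arc eE; exists g.
exists (fun v => plane (centre L v)), arc; split.
- move=> u v /plane_inj eq_c; apply: (layout_disjoint_balls layoutL (centre_in_ball layoutL u)).
  by rewrite eq_c; exact: centre_in_ball layoutL v.
- by move=> e /arcP[].
- by move=> e v eE /(arcP e eE).2; exact: edge_trace_vertex.
move=> e e' z eE e'E neq_e /(arcP e eE).2 e_z /(arcP e' e'E).2.
exact: edge_traces_meet e_z.
Qed.

End Drawing.

(** * From drawings to layouts *)

Section Curves.
Variable R : realType.
Implicit Types (c z : R * R) (h t : R) (p q w : gpoint) (G : R -> R * R).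

(* Freezing a curve outside the unit interval makes it continuous on the whole line. *)
Definition clamp t : R := Num.max 0 (Num.min 1 t).

Lemma clamp_itv t : clamp t \in `[0, 1]%R.
Proof. by rewrite in_itv /= /clamp le_max lexx ge_max ler01 ge_min lexx. Qed.

Lemma clamp_id t : 0 <= t <= 1 -> clamp t = t.
Proof. by case/andP=> t_ge0 t_le1; rewrite /clamp min_r ?max_r. Qed.

Lemma clamp_continuous : continuous clamp.
Proof.
apply: max_fun_continuous; first exact: cst_continuous.
by apply: min_fun_continuous => [|t]; [exact: cst_continuous | exact: cvg_id].
Qed.

Lemma continuous_clamp G : {within `[0, 1], continuous G}%classic -> continuous (G \o clamp).
Proof.
move=> /subspace_continuousP contG t; apply: cvg_comp (contG _ (clamp_itv t)).
move=> A /= nbhsA; suff : nbhs t (clamp @^-1` A)%classic by [].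
apply: (@filterS _ (nbhs t) _ (clamp @^-1` (fun s => `[0, 1]%classic s -> A s))%classic).
  by move=> s; apply; exact: clamp_itv.
exact: clamp_continuous nbhsA.
Qed.

Lemma compact_positive_lower_bound (T : topologicalType) (A : set T) (f : T -> R) :
  compact A -> continuous f -> (forall x, A x -> 0 < f x) ->
  exists2 d, 0 < d & forall x, A x -> d < f x.
Proof.
move=> compA contf f_gt0; have [->|/set0P A0] := eqVneq A classical_sets.set0; first by exists 1.
have [x /set_mem Ax f_min] := compact_EVT_min A0 compA (continuous_subspaceT contf).
exists (f x / 2); first by rewrite divr_gt0 ?f_gt0.
by move=> y /mem_set /f_min; apply: lt_le_trans; have := f_gt0 x Ax; lra.
Qed.

(* The pairs of parameters for which the first curve is away from the points form a
   compact set, on which the distance of the curves is positive. *)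
Lemma curves_apart (I : finType) (pos : I -> R * R) (G H : R -> R * R) (r : R) : 0 < r ->
  continuous G -> continuous H ->
  (forall s t, 0 <= s <= 1 -> 0 <= t <= 1 -> G s = H t -> exists i, G s = pos i) ->
  exists2 d, 0 < d & forall s t, 0 <= s <= 1 -> 0 <= t <= 1 ->
    (forall i, r <= `|G s - pos i|) -> d < `|G s - H t|.
Proof.
move=> r_gt0 contG contH meet_pos.
pose square := (`[0, 1]%classic `*` `[0, 1]%classic)%classic : set (R * R).
pose off i := [set st : R * R | r <= `|G st.1 - pos i|]%classic.
have contG_fst : continuous (fun st : R * R => G st.1).
  by move=> st; apply: continuous_comp; [exact: cvg_fst | exact: contG].
have contH_snd : continuous (fun st : R * R => H st.2).
  by move=> st; apply: continuous_comp; [exact: cvg_snd | exact: contH].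
have compact_off : compact (square `&` \bigcap_i off i)%classic.
  apply: compact_closedI; first by apply: compact_setX; exact: segment_compact.
  apply: closed_bigI => i _.
  apply: (@closed_comp _ _ (fun st => `|G st.1 - pos i|) [set x | r <= x]%classic).
    by move=> st _; apply: cvg_norm; apply: cvgB; [exact: contG_fst | exact: cvg_cst].
  exact: closed_ge.
have [|[s t]|d d_gt0 far] :=
  compact_positive_lower_bound compact_off (f := fun st => `|G st.1 - H st.2|).
- by move=> st; apply: cvg_norm; apply: cvgB; [exact: contG_fst | exact: contH_snd].
- case=> -[/=]; rewrite !in_itv /= => s01 t01 far; rewrite normr_gt0 subr_eq0.
  apply/eqP => /(meet_pos s t s01 t01)[i eq_i].
  by have := far i Logic.I; rewrite /off /= eq_i subrr normr0 leNgt r_gt0.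
exists d => // s t s01 t01 off_st; apply: (far (s, t)); split=> [|i _]; last exact: off_st.
by split; rewrite /= in_itv.
Qed.

Lemma uniform_positive_bound (I : finType) (P : I -> R -> Prop) :
  (forall i, exists2 d, 0 < d & P i d) -> (forall i d d', d' <= d -> P i d -> P i d') ->
  exists2 d, 0 < d & forall i, P i d.
Proof.
move=> exP monoP; have /choice[f fP] : forall i, exists d, 0 < d /\ P i d.
  by move=> i; have [d] := exP i; exists d.
exists (\big[Order.min/1]_i f i); first by apply/bigmin_gtP; split=> // i _; case: (fP i).
by move=> i; apply: monoP (fP i).2; exact: bigmin_le_cond.
Qed.

Lemma interval_induction (P : R -> Prop) : P 0 ->
  (forall s, 0 <= s <= 1 -> exists2 d, 0 < d & forall t t', 0 <= t <= 1 -> 0 <= t' <= 1 ->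
     `|s - t| < d -> `|s - t'| < d -> P t -> P t') ->
  P 1.
Proof.
move=> P0 step; pose S := [set t | 0 <= t <= 1 /\ P t]%classic.
have supS : has_sup S.
  by split; [exists 0; rewrite /S /= lexx ler01 | exists 1 => t [/andP[]]].
have S0 : S 0 by rewrite /S /= lexx ler01.
have s01 : 0 <= sup S <= 1.
  by rewrite (ub_le_sup supS.2) //= ge_sup //; [exact: supS.1 | move=> t [/andP[]]].
have [d d_gt0 near_s] := step _ s01.
have [t [t01 Pt] t_gt] := sup_adherent d_gt0 supS.
have t_le : t <= sup S by apply: (ub_le_sup supS.2).
have st : `|sup S - t| < d by rewrite ger0_norm; lra.
suff sup1 : sup S = 1 by apply: near_s st _ Pt => //; rewrite ?sup1 ?subrr ?normr0 ?lexx ?ler01.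
apply/eqP; rewrite eq_le; have /andP[_ -> /=] := s01; rewrite leNgt; apply/negP => sup_lt1.
pose t' := Num.min 1 (sup S + d / 2).
have [t'_gt t'_le1 t'_lt] : [/\ sup S < t', t' <= 1 & t' < sup S + d].
  by rewrite /t' lt_min ge_min gt_min lexx sup_lt1 /=; split; [lra | | apply/orP; right; lra].
have : t' <= sup S; last by rewrite leNgt t'_gt.
apply: (ub_le_sup supS.2); have t'01 : 0 <= t' <= 1 by lra.
by split=> //; apply: near_s t01 t'01 st _ Pt; rewrite ltr0_norm; lra.
Qed.

(** ** Grid walks along curves *)

Definition mesh_point h p : R * R := h *: plane R p.
Definition mesh_floor h z : gpoint := gfloor (h^-1 *: z).

Lemma norm_mesh h p q : 0 < h ->
  `|mesh_point h p - mesh_point h q| = h * (gdist p q)%:~R.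
Proof. by move=> h_gt0; rewrite -scalerBr normrZ norm_plane gtr0_norm. Qed.

Lemma norm_mesh_floor h z : 0 < h -> `|mesh_point h (mesh_floor h z) - z| <= h.
Proof.
move=> h_gt0; rewrite -{2}(scalerKV (lt0r_neq0 h_gt0) z) -scalerBr normrZ gtr0_norm //.
rewrite ler_piMr ?(ltW h_gt0) //.
have floor_near (x : R) : `|(Num.floor x)%:~R - x| <= 1.
  by have /andP[] := floor_itv x; rewrite intrD ler_distlC; lra.
by rewrite prod_normE /= ge_max !floor_near.
Qed.

Lemma mesh_box h p q w c d : 0 < h -> `|mesh_point h p - c| <= d -> `|mesh_point h q - c| <= d ->
  in_box p q w -> `|mesh_point h w - c| <= d.
Proof.
move=> h_gt0; rewrite !prod_normE /= !ge_max => /andP[p1 p2] /andP[q1 q2] /andP[w1 w2].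
have between (a b m : int) (y : R) : `|h * a%:~R - y| <= d -> `|h * b%:~R - y| <= d ->
    Order.min a b <= m <= Order.max a b -> `|h * m%:~R - y| <= d.
  wlog le_ab : a b / a <= b => [hwlog a_y b_y|].
    have [le_ab|le_ba] := orP (le_total a b); first exact: hwlog.
    by rewrite minC maxC; exact: hwlog.
  rewrite min_l ?max_r // !ler_distl => a_y b_y /andP[am mb].
  have : h * a%:~R <= h * m%:~R by rewrite ler_pM2l // ler_int.
  have : h * m%:~R <= h * b%:~R by rewrite ler_pM2l // ler_int.
  by lra.
by rewrite (between p.1 q.1) // (between p.2 q.2).
Qed.

Lemma curve_walk G h : continuous G -> 0 < h -> exists s,
  [/\ path gadj (mesh_floor h (G 0)) s, last (mesh_floor h (G 0)) s = mesh_floor h (G 1) &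
    {in mesh_floor h (G 0) :: s, forall w,
      exists2 t, 0 <= t <= 1 & `|mesh_point h w - G t| <= 2 * h}].
Proof.
move=> contG h_gt0.
pose near w := exists2 t, 0 <= t <= 1 & `|mesh_point h w - G t| <= 2 * h.
apply: (@interval_induction (fun t => exists s, [/\ path gadj (mesh_floor h (G 0)) s,
  last (mesh_floor h (G 0)) s = mesh_floor h (G t) &
  {in mesh_floor h (G 0) :: s, forall w, near w}])).
  exists [::]; split=> // w; rewrite inE => /eqP ->; exists 0; first by rewrite lexx ler01.
  by apply: le_trans (norm_mesh_floor _ h_gt0) _; lra.
move=> t0 t0_in; have /cvgrPdist_lt /(_ h h_gt0) /nbhs_ballP[d /= d_gt0 near_t0] := contG t0.
exists d => // t t' t01 t'01 t_near t'_near [s [walk_s last_s near_s]].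
have floor_near u : `|t0 - u| < d -> `|mesh_point h (mesh_floor h (G u)) - G t0| <= 2 * h.
  move=> /near_t0 Gu; have := norm_mesh_floor (G u) h_gt0; rewrite distrC in Gu.
  by have := ler_distD (G u) (mesh_point h (mesh_floor h (G u))) (G t0); lra.
have [s' [walk_s' last_s' box_s']] := box_walk (mesh_floor h (G t)) (mesh_floor h (G t')).
exists (s ++ s'); rewrite cat_path last_cat last_s walk_s; split=> // w.
rewrite -cat_cons mem_cat => /orP[/near_s //|ws']; exists t0 => //.
by apply: mesh_box (box_s' w _); rewrite ?floor_near // inE ws' orbT.
Qed.

End Curves.

(** ** Discretising a drawing *)

Section Discretise.
Variables (R : realType) (V : finType) (E : {set {set V}}).
Variables (pos : V -> R * R) (G : {set V} -> R -> R * R) (rho h : R) (N : nat).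
Implicit Types (v x y : V) (e : {set V}) (p w : gpoint) (t : R).

Hypothesis simpleE : simple_graph E.
Hypothesis contG : {in E, forall e, continuous (G e)}.
Hypothesis ends_G : {in E, forall e, exists x y,
  [/\ e = [set x; y], G e 0 = pos x & G e 1 = pos y]}.
Hypothesis h_gt0 : 0 < h.
Hypothesis scale : h * N%:R = rho.
Hypothesis h_small : 16 * h < rho.
Hypothesis far_vertices : forall u v, u != v -> 6 * rho < `|pos u - pos v|.
Hypothesis far_vertex_edge : forall e v t, e \in E -> v \notin e -> 0 <= t <= 1 ->
  6 * rho < `|G e t - pos v|.
Hypothesis far_edges : forall e f s t, e \in E -> f \in E -> e != f ->
  0 <= s <= 1 -> 0 <= t <= 1 -> (forall v, rho / 2 <= `|G e s - pos v|) ->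
  4 * h < `|G e s - G f t|.

Definition discrete_layout (P : {set V} -> seq gpoint) : layout V :=
  Layout (fun v => mesh_floor h (pos v)) (fun=> N%:Z) P.

Definition near_edge e w : Prop := exists2 t, 0 <= t <= 1 & `|mesh_point h w - G e t| <= 2 * h.

Local Notation mesh_centre v := (mesh_floor h (pos v)).

Lemma mesh_distance v p :
  `| `|mesh_point h p - pos v| - h * (gdist p (mesh_centre v))%:~R| <= h.
Proof.
have := norm_mesh_floor (pos v) h_gt0; rewrite -norm_mesh //; apply: le_trans.
have -> : mesh_point h (mesh_centre v) - pos v =
    (mesh_point h p - pos v) - (mesh_point h p - mesh_point h (mesh_centre v)).
  by rewrite opprB [RHS]addrC addrA subrK.
exact: ler_dist_dist.
Qed.

Lemma out_of_ball_far v p : ~~ in_ball (mesh_centre v) N%:Z p -> rho <= `|mesh_point h p - pos v|.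
Proof.
rewrite /in_ball -ltNge -lezD1 -(ler_int R) intrD -(ler_pM2l h_gt0) mulrDr -pmulrn scale mulr1.
by have := mesh_distance v p; rewrite ler_distl => /andP[]; lra.
Qed.

Lemma sphere_far v p : on_sphere (mesh_centre v) N%:Z p -> rho - h <= `|mesh_point h p - pos v|.
Proof.
move/eqP => dist_p; have := mesh_distance v p; rewrite dist_p -pmulrn scale ler_distl.
by case/andP.
Qed.

Lemma in_ball_near v p : in_ball (mesh_centre v) N%:Z p -> `|mesh_point h p - pos v| <= rho + h.
Proof.
rewrite /in_ball -(ler_int R) -(ler_pM2l h_gt0) -pmulrn scale.
by have := mesh_distance v p; rewrite ler_distl => /andP[]; lra.
Qed.

Lemma discrete_balls_disjoint P : disjoint_balls (discrete_layout P).
Proof.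
move=> u v p /in_ball_near u_p /in_ball_near v_p; apply/eqP; apply: contraT => neq_uv.
have := far_vertices neq_uv; have := ler_distD (mesh_point h p) (pos u) (pos v).
by move: h_gt0 h_small; rewrite (distrC (pos u) (mesh_point h p)); lra.
Qed.

Lemma discrete_route e : e \in E -> exists s x y, [/\ e = [set x; y], x != y,
  joins (discrete_layout (fun=> [::])) x y s & {in s, forall w, near_edge e w}].
Proof.
move=> eE; have [x [y [eq_e G0 G1]]] := ends_G eE.
have neq_xy : x != y by apply/eqP => eq_xy; have := simpleE eE; rewrite eq_e eq_xy setUid cards1.
have [s [walk_s last_s near_s]] := curve_walk (contG eE) h_gt0;
  rewrite G0 G1 in walk_s last_s near_s.
have in_own v : in_ball (mesh_centre v) N%:Z (mesh_centre v) by exact: in_ball_centre.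
have y_last : in_ball (mesh_centre y) N%:Z (last (mesh_centre x) s) by rewrite last_s.
have [p [t [walk_t uniq_t sub_t [xp y_t] only]]] :=
  simple_path_between gadjC walk_s (in_own x) y_last.
exists (p :: t), x, y; split=> //; last by move=> w /sub_t; exact: near_s.
split=> // z v zt vz; have [|v_e] := boolP (v \in e).
  rewrite eq_e => /set2P[] eq_v; [left|right]; split=> //; rewrite eq_v in vz.
    exact: (only z zt).1 vz.
  exact: (only z zt).2 vz.
exfalso; have [r r01 z_near] := near_s z (sub_t z zt).
have := far_vertex_edge eE v_e r01; have := ler_distD (mesh_point h z) (G e r) (pos v).
by move: h_gt0 h_small (@in_ball_near v z vz); rewrite (distrC (G e r) (mesh_point h z)); lra.
Qed.

Lemma discretise : exists L, is_layout E L.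
Proof.
have /choice[P PP] : forall e, exists s, e \in E -> exists x y, [/\ e = [set x; y], x != y,
    joins (discrete_layout (fun=> [::])) x y s & {in s, forall w, near_edge e w}].
  move=> e; have [eE|_] := boolP (e \in E); last by exists [::].
  by have [s s_route] := discrete_route eE; exists s.
have far_route e w v : e \in E -> w \in P e -> rho - h <= `|mesh_point h w - pos v|.
  move=> eE we; have [x [y [_ neq_xy joins_e _]]] := PP e eE.
  have [in_v|/out_of_ball_far] := boolP (in_ball (mesh_centre v) N%:Z w); last by move: h_gt0; lra.
  exact/sphere_far/(joins_on_sphere (@discrete_balls_disjoint _) neq_xy joins_e we in_v).
exists (discrete_layout P); split; [|exact: discrete_balls_disjoint| |].
- move=> v /=; rewrite lez_nat lt0n; apply/eqP => N0; move: scale h_small.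
  by rewrite N0 mulr0 => <-; rewrite ltNge mulr_ge0 // ltW.
- by move=> e /PP[x [y [eq_e neq_xy [? ? ? ? ?] _]]]; exists x, y.
move=> e f w eE fE we wf; apply/eqP; apply: contraT => neq_ef.
have [_ [_ [_ _ _ near_e]]] := PP e eE; have [_ [_ [_ _ _ near_f]]] := PP f fE.
have [s s01 w_s] := near_e w we; have [t t01 w_t] := near_f w wf.
have far_s v : rho / 2 <= `|G e s - pos v|.
  have := far_route e w v eE we; have := ler_distD (G e s) (mesh_point h w) (pos v).
  by move: h_gt0 h_small; lra.
have := far_edges eE fE neq_ef s01 t01 far_s.
have := ler_distD (mesh_point h w) (G e s) (G f t).
by rewrite (distrC (G e s) (mesh_point h w)); lra.
Qed.

End Discretise.

Lemma exists_mesh (R : realType) (rho d : R) : 0 < rho -> 0 < d ->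
  exists (N : nat) (h : R), [/\ 0 < h, h * N%:R = rho & h < d].
Proof.
move=> rho_gt0 d_gt0; have ratio_ge0 : 0 <= rho / d by rewrite divr_ge0 // ltW.
have N_gt : rho / d < (Num.bound (rho / d))%:R by exact: archi_boundP.
exists (Num.bound (rho / d)), (rho / (Num.bound (rho / d))%:R).
have N_gt0 : 0 < (Num.bound (rho / d))%:R :> R by exact: le_lt_trans N_gt.
split; [exact: divr_gt0 | by rewrite divfK // gt_eqF |].
by rewrite ltr_pdivrMr // mulrC -ltr_pdivrMr.
Qed.

Section DrawingBounds.
Variables (R : realType) (V : finType) (E : {set {set V}}).
Variables (pos : V -> R * R) (arc : {set V} -> R -> R * R).
Hypothesis drawingE : is_drawing E pos arc.

Let G e := arc e \o @clamp R.

Lemma frozen_arc e t : 0 <= t <= 1 -> G e t = arc e t.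
Proof. by move=> t01; rewrite /G /= clamp_id. Qed.

Lemma frozen_arc_trace e t : 0 <= t <= 1 -> arc_trace (arc e) (G e t).
Proof. by move=> t01; rewrite frozen_arc //; exact: arc_trace_at. Qed.

Lemma continuous_frozen_arc : {in E, forall e, continuous (G e)}.
Proof.
by move=> e /(drawing_ends drawingE)[x [y [_ [cont_e _ _ _]]]]; exact: continuous_clamp.
Qed.

Lemma vertices_apart : exists2 d : R, 0 < d & forall u v, u != v -> d < `|pos u - pos v|.
Proof.
have [|uv d d' le_d|d d_gt0 apart] := @uniform_positive_bound R (V * V)%type
  (fun uv d => uv.1 != uv.2 -> d < `|pos uv.1 - pos uv.2|).
- case=> u v; have [->|neq_uv] := eqVneq u v; first by exists 1 => //; rewrite eqxx.
  have dist_gt0 : 0 < `|pos u - pos v|.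
    by rewrite normr_gt0 subr_eq0; apply: contra neq_uv => /eqP /(drawing_inj drawingE) ->.
  by exists (`|pos u - pos v| / 2); [rewrite divr_gt0 | move=> _ /=; lra].
- by move=> apart neq_uv; apply: le_lt_trans le_d (apart neq_uv).
by exists d => // u v; exact: (apart (u, v)).
Qed.

Lemma vertices_off_arcs : exists2 d : R, 0 < d &
  forall e v t, e \in E -> v \notin e -> 0 <= t <= 1 -> d < `|G e t - pos v|.
Proof.
have [|ev d d' le_d apart|d d_gt0 apart] := @uniform_positive_bound R ({set V} * V)%type
  (fun ev d => ev.1 \in E -> ev.2 \notin ev.1 -> forall t, 0 <= t <= 1 ->
    d < `|G ev.1 t - pos ev.2|).
- case=> e v /=; have [eE|] := boolP (e \in E); last by exists 1.
  have [|ve] := boolP (v \in e); first by exists 1.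
  have [||t t01|d d_gt0 far] := @compact_positive_lower_bound R R `[0, 1]%classic
    (fun t => `|G e t - pos v|); first exact: segment_compact.
  + move=> t; apply: cvg_norm; apply: cvgB; last exact: cvg_cst.
    exact: continuous_frozen_arc.
  + rewrite normr_gt0 subr_eq0; apply: contraNneq ve => eq_v.
    apply: (drawing_vertex drawingE eE); rewrite -eq_v; apply: frozen_arc_trace.
    by move: t01; rewrite /= in_itv.
  by exists d => // _ _ t t01; apply: far; rewrite /= in_itv.
- by move=> eE ve t t01; apply: le_lt_trans le_d (apart eE ve t t01).
by exists d => // e v t eE ve; exact: (apart (e, v)).
Qed.

Lemma arcs_apart (r : R) : 0 < r -> exists2 d : R, 0 < d &
  forall e f s t, e \in E -> f \in E -> e != f -> 0 <= s <= 1 -> 0 <= t <= 1 ->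
    (forall v, r <= `|G e s - pos v|) -> d < `|G e s - G f t|.
Proof.
move=> r_gt0; pose apart_by (ef : {set V} * {set V}) d := ef.1 \in E -> ef.2 \in E ->
  ef.1 != ef.2 -> forall s t, 0 <= s <= 1 -> 0 <= t <= 1 ->
  (forall v, r <= `|G ef.1 s - pos v|) -> d < `|G ef.1 s - G ef.2 t|.
have [|ef d d' le_d apart|d d_gt0 apart] := @uniform_positive_bound R _ apart_by; last 2 first.
- move=> eE fE neq_ef s t s01 t01 far.
  exact: le_lt_trans le_d (apart eE fE neq_ef s t s01 t01 far).
- by exists d => // e f s t eE fE neq_ef; exact: (apart (e, f)).
case=> e f; rewrite /apart_by /=; have [eE|] := boolP (e \in E); last by exists 1.
have [fE|] := boolP (f \in E); last by exists 1.
have [->|/eqP neq_ef] := eqVneq e f; first by exists 1 => // _ _; rewrite eqxx.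
have [s t s01 t01 eq_st|d d_gt0 apart] :=
  curves_apart r_gt0 (pos := pos) (continuous_frozen_arc eE) (continuous_frozen_arc fE).
  have f_trace := frozen_arc_trace f t01; rewrite -eq_st in f_trace.
  have [v _ eq_v] := drawing_cross drawingE eE fE neq_ef (frozen_arc_trace e s01) f_trace.
  by exists v.
by exists d => // _ _ _; exact: apart.
Qed.

End DrawingBounds.

Lemma planar_layout (R : realType) (V : finType) (E : {set {set V}}) :
  simple_graph E -> planar R E -> exists L, is_layout E L.
Proof.
move=> simpleE [pos [arc drawingE]].
have [d1 d1_gt0 far_vertices] := vertices_apart drawingE.
have [d2 d2_gt0 far_vertex_edge] := vertices_off_arcs drawingE.
pose rho := Num.min d1 d2 / 6.
have rho_gt0 : 0 < rho by rewrite divr_gt0 // lt_min d1_gt0.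
have [rho_d1 rho_d2] : 6 * rho <= d1 /\ 6 * rho <= d2.
  by rewrite /rho mulrC divfK // !ge_min !lexx orbT.
have [|d3 d3_gt0 far_edges] := arcs_apart drawingE (r := rho / 2); first by rewrite divr_gt0.
have [|N [h [h_gt0 scale h_lt]]] := @exists_mesh R rho (Num.min (rho / 16) (d3 / 4)) rho_gt0.
  by rewrite lt_min; apply/andP; split; exact: divr_gt0.
have [h_rho h_d3] : 16 * h < rho /\ 4 * h < d3 by move: h_lt; rewrite lt_min => /andP[]; lra.
apply: (@discretise R V E pos (fun e => arc e \o @clamp R) rho h N) => //.
- exact: continuous_frozen_arc drawingE.
- move=> e /(drawing_ends drawingE)[x [y [eq_e [_ _ arc0 arc1]]]]; exists x, y.
  by rewrite /= !clamp_id ?lexx ?ler01 ?arc0 ?arc1.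
- by move=> u v neq_uv; exact: le_lt_trans rho_d1 (far_vertices u v neq_uv).
- by move=> e v t eE ve t01; exact: le_lt_trans rho_d2 (far_vertex_edge e v t eE ve t01).
move=> e f s t eE fE neq_ef s01 t01 far.
exact: lt_trans h_d3 (far_edges e f s t eE fE neq_ef s01 t01 far).
Qed.

(** * Spanning trees and their leaves *)

Lemma connect_first_step (T : finType) (r : rel T) a b :
  connect r a b -> a != b -> exists c, r a c.
Proof.
case/connectP=> -[|c p] /=; first by move=> _ ->; rewrite eqxx.
by case/andP=> ac _ _ _; exists c.
Qed.

Section SpanningTrees.
Variable V : finType.
Implicit Types (E T : {set {set V}}) (F X : {set V}) (x y v : V) (e : {set V}).

Lemma connected_delete_cycle_edge E c x : connected_graph E -> is_cycle E c -> x \in c ->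
  connected_graph (E :\ [set x; next c x]).
Proof.
move=> connE cycle_c xc a b; apply: connect_sub (connE a b) => u v uv.
have [eq_uv|neq_uv] := eqVneq [set u; v] [set x; next c x]; last first.
  by apply: connect1; rewrite /adj in_setD1 neq_uv.
have bypass := cycle_edge_bypass cycle_c xc.
have neq_x : x != next c x by rewrite eq_sym (next_neq cycle_c).
by case: (eq_set2 neq_x eq_uv) => -[-> ->] //; rewrite adj_connect_sym.
Qed.

Lemma connected_spanning_tree E : connected_graph E ->
  exists2 T : {set {set V}}, T \subset E & is_tree T.
Proof.
move=> connE; pose P (T : {set {set V}}) := (T \subset E) && `[< connected_graph T >].
have PE : P E by rewrite /P subxx; apply/asboolP.
case: (arg_minnP (fun T : {set {set V}} => #|T|) PE) => T /andP[subT /asboolP connT] T_min.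
exists T => //; split=> // c cycle_c.
have [x xc] := cycle_nonempty cycle_c.
have edge_x : [set x; next c x] \in T by apply: (cycle_edges_sub cycle_c); apply/mapP; exists x.
have /T_min : P (T :\ [set x; next c x]).
  rewrite /P (subset_trans (subsetDl _ _) subT); apply/asboolP.
  exact: connected_delete_cycle_edge.
by rewrite leqNgt (cardsD1 [set x; next c x] T) edge_x ltnS leqnn.
Qed.

Lemma leaf_unique_edge T v e0 : (1 < #|V|)%N -> connected_graph T ->
  {in T, forall e, v \in e -> e = e0} -> v \in leaves T.
Proof.
move=> cardV connT only_e0.
have [w neq_vw] : exists w, v != w.
  have /card_gt1P[a [b [_ _ neq_ab]]] := cardV.
  by have [eq_va|neq_va] := eqVneq v a; [exists b; rewrite eq_va|exists a].
have [y vy] := connect_first_step (connT v w) neq_vw.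
rewrite inE; apply/cards1P; exists e0; apply/setP => e; rewrite !inE.
apply/andP/eqP => [[eT ve]|->]; first exact: only_e0.
by have := only_e0 _ vy (set21 v y) => <-; rewrite set21.
Qed.

Lemma path_interior_not_leaf T x s z : path (adj T) x s -> uniq (x :: s) ->
  z \in s -> z != last x s -> z \notin leaves T.
Proof.
move=> + + zs; case/splitPr: zs => s1 [|b s2]; first by rewrite last_cat /= eqxx.
rewrite cat_path -cat_cons cat_uniq => /and4P[_ az zb _] /and3P[_ /hasPn disj /andP[z_off _]] _.
rewrite inE; apply/negP => /cards1P[e only_e].
have edge_eq e' : e' \in T -> z \in e' -> e' = e.
  by move=> e'T ze'; apply/set1P; rewrite -only_e inE e'T.
have eq_e := edge_eq _ az (set22 _ _); have := set22 z b.
rewrite (edge_eq _ zb (set21 _ _)) -eq_e => /set2P[eq_b|eq_b].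
  by have := disj b; rewrite eq_b /= mem_last !inE eqxx orbT => /(_ isT).
by move: z_off; rewrite eq_b mem_head.
Qed.

Lemma cyclic_separators_connected E : cyclic_separators E -> connected_graph E.
Proof.
move=> separators a b; have forest0 : induces_forest E finset.set0.
  move=> c /is_cycle_induced[[size_c _ _] c0].
  by case: c size_c c0 => // x s _ /(_ x (mem_head _ _)); rewrite in_set0.
have := separators _ forest0 a b; rewrite setC0 !inE => /(_ isT isT).
by apply: connect_sub => u v; rewrite adj_induced => /and3P[uv _ _]; exact: connect1.
Qed.

Lemma forest_cyclic_separators_card E :
  simple_graph E -> cyclic_separators E -> is_forest E -> (#|V| <= 2)%N.
Proof.
move=> simpleE separators forestE; rewrite leqNgt; apply/card_gt2P => -[x [y [z [_]]]].
have adjE a b : a != b -> adj E a b.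
  move=> neq_ab; have forest_ab : induces_forest E (~: [set a; b]).
    exact: sub_forest (induced_sub _ _) forestE.
  have := separators _ forest_ab a b; rewrite setCK !inE !eqxx orbT => /(_ isT isT).
  case/connect_first_step => // d; rewrite adj_induced => /and3P[ad _].
  by case/set2P => eq_d; rewrite eq_d in ad *; have := adj_neq simpleE ad; rewrite ?eqxx.
case=> neq_xy neq_yz neq_zx; apply: (forestE [:: x; y; z]); split=> //=.
  by rewrite !inE negb_or neq_xy neq_yz eq_sym neq_zx.
by rewrite !adjE.
Qed.

Lemma neighbour_outside_forest E F x y : simple_graph E -> cyclic_separators E ->
  induces_forest E F -> x \in F -> y \notin F -> exists2 z, z \notin F & adj E x z.
Proof.
move=> simpleE separators forestF xF yF.
have forestF' := sub_induces_forest (subsetDl F [set x]) forestF.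
have := separators _ forestF' x y; rewrite !inE eqxx (negbTE yF) andbF => /(_ isT isT).
case/connect_first_step => [|z]; first by apply: contraNneq yF => <-.
rewrite adj_induced !inE !negb_and !negbK => /and3P[xz _ /orP[/eqP eq_z|zF]]; last by exists z.
by have := adj_neq simpleE xz; rewrite eq_z eqxx.
Qed.

Lemma spanning_tree_with_leaves E F : (1 < #|V|)%N ->
  {in ~: F &, forall a b, connect (adj (induced_edges E (~: F))) a b} ->
  {in F, forall x, exists2 y, y \notin F & adj E x y} ->
  exists2 T : {set {set V}}, T \in spanning_trees E & F \subset leaves T.
Proof.
move=> cardV connC dominated.
have /choice[n nP] : forall x, exists y, x \in F -> y \notin F /\ adj E x y.
  by move=> x; have [/dominated[y yF xy]|_] := boolP (x \in F); [exists y|exists x].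
pose E' := induced_edges E (~: F) :|: [set [set x; n x] | x in F].
have subE' : E' \subset E.
  apply/subsetP => e; rewrite inE => /orP[|/imsetP[x xF ->]]; first exact/subsetP/induced_sub.
  by case: (nP x xF).
have to_complement x : exists2 y, y \in ~: F & connect (adj E') x y.
  have [xF|xF] := boolP (x \in F); last by exists x; rewrite ?inE ?connect0.
  exists (n x); first by rewrite inE; case: (nP x xF).
  by apply: connect1; rewrite /adj inE; apply/orP; right; apply: imset_f.
have connE' : connected_graph E'.
  move=> a b; have [a' a'F aa'] := to_complement a; have [b' b'F bb'] := to_complement b.
  apply: connect_trans aa' _; rewrite adj_connect_sym; apply: connect_trans bb' _.
  rewrite adj_connect_sym; apply: connect_sub (connC a' b' a'F b'F) => u v uv.
  by apply: connect1; rewrite /adj inE; apply/orP; left.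
have [T subT treeT] := connected_spanning_tree connE'.
exists T; first by rewrite inE (subset_trans subT subE'); apply/asboolP.
apply/subsetP => x xF; apply: (@leaf_unique_edge T x [set x; n x]) => //; first by case: treeT.
move=> e /(subsetP subT); rewrite inE => /orP[|/imsetP[y yF ->]].
  by rewrite inE => /andP[_ /subsetP sub] /sub; rewrite inE xF.
case/set2P => eq_x; first by rewrite eq_x.
by have [] := nP y yF; rewrite -eq_x xF.
Qed.

Lemma induced_forest_leaves E F : (1 < #|V|)%N -> simple_graph E -> cyclic_separators E ->
  induces_forest E F -> exists2 T : {set {set V}}, T \in spanning_trees E & F \subset leaves T.
Proof.
move=> cardV simpleE separators forestF.
have [FT|/subsetPn[y _ yF]] := boolP ([set: V] \subset F); last first.
  apply: spanning_tree_with_leaves => // [|x xF]; first exact: separators.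
  exact: neighbour_outside_forest yF.
have forestE : is_forest E.
  move=> c cycle_c; apply: (forestF c); apply/is_cycle_induced.
  by split=> // x _; exact: (subsetP FT).
have [T subT treeT] := connected_spanning_tree (cyclic_separators_connected separators).
exists T; first by rewrite inE subT; apply/asboolP.
apply/subsetP => v _; apply: (@leaf_unique_edge T v [set: V]) => //; first by case: treeT.
move=> e eT _; apply/eqP; rewrite eqEcard subsetT cardsT (simpleE e) ?(subsetP subT) //.
exact: forest_cyclic_separators_card simpleE separators forestE.
Qed.

Lemma robust_connectivity_ge E (k : rat) : k <= 1 ->
  (forall X, X != finset.set0 -> exists2 T : {set {set V}}, T \in spanning_trees E &
     k <= #|X :&: leaves T|%:R / #|X|%:R) ->
  k <= robust_connectivity E.
Proof.
move=> k_le1 trees; rewrite /robust_connectivity.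
elim/big_ind: _ => [//|a b ka kb|X /trees[T T_tree k_le]]; first by rewrite le_min ka.
exact: le_trans k_le (le_bigmax_cond _ (fun T => #|X :&: leaves T|%:R / #|X|%:R) T_tree).
Qed.

Lemma robust_connectivity_tree E X : 0 < robust_connectivity E -> X != finset.set0 ->
  exists2 T : {set {set V}}, T \in spanning_trees E &
    robust_connectivity E <= #|X :&: leaves T|%:R / #|X|%:R :> rat.
Proof.
move=> kappa_gt0 X0; apply: contrapT => none.
have : robust_connectivity E <= \big[Order.max/0]_(T in spanning_trees E)
    (#|X :&: leaves T|%:R / #|X|%:R) by exact: bigmin_le_cond.
rewrite leNgt => /negP; apply; elim/big_ind: _ => // [a b ka kb|T T_tree].
  by rewrite gt_max ka kb.
by rewrite ltNge; apply/negP => k_le; apply: none; exists T.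
Qed.

End SpanningTrees.

Lemma triangulation_cyclic_separators (R : realType) (V : finType) (E : {set {set V}}) :
  planar_triangulation R E -> cyclic_separators E.
Proof.
case=> simpleE planarE maximalE; have [L layoutL] := planar_layout simpleE planarE.
case: (cyclic_separators_or_extend layoutL) => // -[a [b [s [neq_ab abE layoutL']]]].
case: (maximalE [set a; b]) => //; first by rewrite cards2 neq_ab.
exact: layout_planar layoutL'.
Qed.

Lemma cyclic_separators_triangulation (R : realType) (V : finType) (E : {set {set V}})
    (L : layout V) :
  is_layout E L -> cyclic_separators E -> planar_triangulation R E.
Proof.
move=> layoutL separators; have simpleE := layout_simple layoutL.
split=> [//||e card_e eE planar_e]; first exact: layout_planar layoutL.
have /eqP/cards2P[u [v [neq_uv eq_e]]] := card_e; rewrite eq_e in eE planar_e.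
have simple_e : simple_graph ([set u; v] |: E).
  by move=> f; rewrite in_setU1 => /orP[/eqP ->|/simpleE //]; rewrite cards2 neq_uv.
have [L' layoutL'] := planar_layout simple_e planar_e.
exact: (cyclic_separators_maximal simpleE separators neq_uv eE layoutL').
Qed.

(** * From induced forests to robust connectivity *)

Section Pullback.
Variables (U V : finType) (f : U -> V).
Hypothesis f_inj : injective f.

Definition pullback (E : {set {set V}}) : {set {set U}} := [set e : {set U} | f @: e \in E].

Lemma pullback_simple E : simple_graph E -> simple_graph (pullback E).
Proof. by move=> simpleE e; rewrite inE => /simpleE; rewrite card_imset. Qed.

Lemma pullback_planar (R : realType) E : planar R E -> planar R (pullback E).
Proof.
case=> pos [arc drawingE]; exists (pos \o f), (fun e : {set U} => arc (f @: e)); split.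
- exact: inj_comp (drawing_inj drawingE) f_inj.
- move=> e; rewrite inE => eE; have [x [y [eq_e arc_e]]] := drawing_ends drawingE eE.
  have [x' _ eq_x] : exists2 x', x' \in e & x = f x' by apply/imsetP; rewrite eq_e set21.
  have [y' _ eq_y] : exists2 y', y' \in e & y = f y' by apply/imsetP; rewrite eq_e set22.
  exists x', y'; rewrite /= -eq_x -eq_y; split=> //.
  by apply: (imset_inj f_inj); rewrite eq_e imsetU !imset_set1 eq_x eq_y.
- by move=> e v; rewrite inE => eE /(drawing_vertex drawingE eE); rewrite mem_imset.
move=> e e' p; rewrite !inE => eE e'E neq_e p_e p_e'.
have neq_fe : f @: e <> f @: e' by move/(imset_inj f_inj).
have [v + ->] := drawing_cross drawingE eE e'E neq_fe p_e p_e'.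
rewrite inE => /andP[/imsetP[u ue ->]]; rewrite mem_imset // => ue'.
by exists u; rewrite // inE ue.
Qed.

Lemma induces_forest_pullback E (F : {set U}) :
  induces_forest (pullback E) F -> induces_forest E (f @: F).
Proof.
move=> forestF c /is_cycle_induced[cycle_c cF].
have [d eq_c] : exists d, c = map f d.
  elim: c cF {cycle_c} => [|x c IH] cF; first by exists [::].
  have [y yc|d ->] := IH; first by rewrite cF // inE yc orbT.
  by have /imsetP[u _ ->] := cF x (mem_head _ _); exists (u :: d).
case: cycle_c cF; rewrite eq_c size_map (map_inj_uniq f_inj) cycle_map => size_d uniq_d cycle_d dF.
apply: (forestF d); apply/is_cycle_induced; split=> [|u ud].
  split=> //; apply: sub_cycle cycle_d => u v.
  by rewrite /adj /= inE imsetU !imset_set1.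
by rewrite -(mem_imset _ _ f_inj) dF // map_f.
Qed.

End Pullback.

Definition large_induced_forests (R : realType) : Prop :=
  forall (V : finType) (E : {set {set V}}), simple_graph E -> planar R E ->
    exists F : {set V}, induces_forest E F /\ #|V|%:R / 2%:R <= #|F|%:R :> rat.

Definition robust_triangulations (R : realType) : Prop :=
  forall (V : finType) (E : {set {set V}}), (1 < #|V|)%N -> planar_triangulation R E ->
    2%:R^-1 <= robust_connectivity E :> rat.

Lemma large_induced_forests_robust (R : realType) :
  large_induced_forests R -> robust_triangulations R.
Proof.
move=> large_forest V E cardV triE; have separators := triangulation_cyclic_separators triE.
have [simpleE planarE _] := triE; apply: robust_connectivity_ge => [|X X0].
  by rewrite invf_le1.
have f_inj : injective (val : {x : V | x \in X} -> V) by exact: val_inj.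
have [F [forestF F_large]] :=
  large_forest _ _ (pullback_simple f_inj simpleE) (pullback_planar f_inj planarE).
have [T T_tree F_leaves] := induced_forest_leaves cardV simpleE separators
  (induces_forest_pullback f_inj forestF).
exists T => //; have cardX : (0 < #|X|)%N by rewrite card_gt0.
rewrite ler_pdivlMr ?ltr0n // mulrC; apply: (le_trans (y := #|F|%:R)).
  by move: F_large; rewrite card_sig (eq_card (B := X)).
rewrite ler_nat -(card_imset _ f_inj) subset_leq_card // subsetI F_leaves andbT.
by apply/subsetP => x /imsetP[u _ ->]; exact: valP.
Qed.

(** * From robust connectivity to induced forests *)

Lemma ghalf_centre f : ghalf (face_centre f) = f.
Proof. by case: f => x y; rewrite /ghalf /face_centre /=; congr (_, _); lia. Qed.

Lemma face_centre_notin_refine s f : sorted gadj s -> face_centre f \notin refine s.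
Proof.
move=> walk_s; apply/negP => /mem_refine[[p _ /esym]|[[p q] pq /esym]].
  exact: gdouble_neq_centre.
exact: gmid_neq_centre (steps_sorted walk_s pq).
Qed.

Lemma refine_avoids o s z : sorted gadj s -> o \notin s -> z \in refine s ->
  ~~ in_ball (gdouble o) 1 z.
Proof.
move=> walk_s o_off /mem_refine[[p ps ->]|[[p q] pq ->]]; rewrite in_ballE; apply: contra o_off.
  move=> near; suff -> : o = p by [].
  by case: o p near {ps} => a b [c d] /= near; congr (_, _); lia.
have := steps_sorted walk_s pq; have /andP[ps qs] := mem_steps pq.
move=> /= adj_pq near; suff [->|->] : o = p \/ o = q by [].
case: o p q near adj_pq {pq ps qs} => a b [c d] [c' d']; rewrite /gadj /= => near adj_pq.
have [[-> ->]|[-> ->]] : (a = c /\ b = d) \/ (a = c' /\ b = d') by lia.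
  by left.
by right.
Qed.

Lemma refine_jumps (V : finType) (L : layout V) (EC : {set {set V}}) (S : {set V}) e0 s0 col :
  e0 \notin EC -> jumps_in (drawn L EC S) col ->
  jumps_in (drawn (refine_layout L e0 s0) EC S) (col \o ghalf).
Proof.
move=> e0EC jumps a b adj_ab.
have drawn_mid p q : gadj p q -> drawn L EC S p q ->
    drawn (refine_layout L e0 s0) EC S (gdouble p) (gmid p q).
  move=> adj_pq /(drawnP L)[[e eEC pq]|[v vS vpq]]; apply/drawnP.
    left; exists e; rewrite //= ifN; first exact: walk_edge_refine.
    by apply: contraNneq e0EC => <-.
  right; exists v; rewrite // !refine_vertex_ball refined_ball_double.
  by rewrite refined_ball_mid // andbA andbb.
case: (sides_half adj_ab) => [[f [low_f high_f]]|[p [q [adj_pq sides_pq ab]]]].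
  by rewrite /jump /= low_f high_f addbb.
rewrite /jump /= -(jumpE col sides_pq) => /(jumps _ _ adj_pq)/(drawn_mid _ _ adj_pq).
by case: ab => -[-> ->] //; rewrite drawnC.
Qed.

Section Separation.
Variables (V W : finType) (E : {set {set V}}).
Implicit Types (L : layout (V + W)%type) (c : seq V).

Definition lift_edges (EC : {set {set V}}) : {set {set V + W}} :=
  [set inl @: e | e : {set V} in EC].

Definition separates L c : Prop := exists (w1 w2 : W) (col : gpoint -> bool),
  jumps_in (drawn L (lift_edges [set e in cycle_edges c]) (inl @: ends (cycle_edges c))) col /\
  col (centre L (inr w1)) != col (centre L (inr w2)).

Definition cycles_separate L : Prop := forall c, is_cycle E c -> separates L c.

Lemma inl_inj : injective (@inl V W).
Proof. by move=> x y []. Qed.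

Lemma lift_cycle_edges_sub c :
  is_cycle E c -> lift_edges [set e in cycle_edges c] \subset lift_edges E.
Proof.
move=> cycle_c; apply/imsetS/subsetP => e; rewrite inE.
exact: cycle_edges_sub cycle_c _.
Qed.

Lemma cycles_separate_refine L (e0 : {set V + W}) s0 : e0 \notin lift_edges E ->
  cycles_separate L -> cycles_separate (refine_layout L e0 s0).
Proof.
move=> e0E sep c cycle_c; have [w1 [w2 [col [jumps neq_col]]]] := sep c cycle_c.
exists w1, w2, (col \o ghalf); split; last by rewrite /= !ghalf_double.
apply: refine_jumps jumps; apply: contra e0E; exact/subsetP/lift_cycle_edges_sub.
Qed.

Variables (E' : {set {set V + W}}) (L : layout (V + W)%type).
Hypotheses (layoutL : is_layout E' L) (subE : lift_edges E \subset E').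

Lemma lift_cycle_subgraph c : is_cycle E c ->
  subgraph E' (lift_edges [set e in cycle_edges c]) (inl @: ends (cycle_edges c)).
Proof.
move=> cycle_c; split; first exact: subset_trans (lift_cycle_edges_sub cycle_c) subE.
move=> e /imsetP[e' + ->]; rewrite inE => e'c; apply: imsetS.
by apply/subsetP => x xe'; apply/endsP; exists e'.
Qed.

Lemma separating_cycle_not_leaves T c : T \in spanning_trees E' -> is_cycle E c -> separates L c ->
  exists2 x, x \in c & inl x \notin leaves T.
Proof.
rewrite inE => /andP[subT /asboolP[connT _]] cycle_c [w1 [w2 [col [jumps neq_col]]]].
apply: contrapT => all_leaves; case/negP: neq_col; apply/eqP.
have /connectP[s0 path_s0 last_s0] := connT (inr w1) (inr w2).
case/shortenP: path_s0 last_s0 => s path_s uniq_s _ last_s.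
rewrite last_s; apply: (path_const layoutL (lift_cycle_subgraph cycle_c) jumps).
  by apply: sub_path path_s => x y; exact/subsetP.
move=> z zs; apply/imsetP => -[x /endsP[e e_c xe] eq_z]; apply: all_leaves; exists x.
  exact: cycle_edges_mem e_c xe.
rewrite -eq_z; apply: path_interior_not_leaf path_s uniq_s _ _.
  by move: zs; rewrite inE eq_z.
by rewrite -last_s eq_z.
Qed.

End Separation.

(** ** A vertex on both sides of every edge *)

Section Gadget.
Variables (V : finType) (E : {set {set V}}) (L : layout V).
Hypothesis layoutL : is_layout E L.

Definition side_faces : seq gpoint :=
  flatten [seq sides st.1 st.2 | e <- enum E, st <- steps (route L e)].

Lemma side_facesP f :
  reflect (exists e p q, [/\ e \in E, walk_edge (route L e) p q & f \in sides p q])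
          (f \in side_faces).
Proof.
apply: (iffP flattenP) => [[_ /allpairsPdep[e [[p q] [eE pq ->]]] f_side]|].
  by exists e, p, q; split=> //; [rewrite mem_enum in eE | rewrite /walk_edge pq].
case=> e [p [q [eE pq f_side]]].
have adj_pq := walk_edge_gadj (route_sorted layoutL eE) pq.
exists (sides p q) => //; case/orP: pq => pq; apply/allpairsPdep.
  by exists e, (p, q); rewrite mem_enum.
by exists e, (q, p); rewrite mem_enum sidesC.
Qed.

Lemma side_face_outside f v : f \in side_faces -> ~~ vertex_face L v f.
Proof.
case/side_facesP => e [p [q [eE pq f_side]]].
exact: (side_outside layoutL eE pq f_side (in_setT v)).
Qed.

Definition side_vertex : finType := seq_sub side_faces.

(* In the grid refined once, a new vertex sits at the centre of its face; refining again
   makes room for its ball. *)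
Definition twice_refined : layout V :=
  refine_layout (refine_layout L finset.set0 [::]) finset.set0 [::].

Definition gadget_layout : layout (V + side_vertex)%type :=
  Layout (fun x => match x with
                   | inl v => centre twice_refined v
                   | inr w => gdouble (face_centre (val w))
                   end)
         (fun x => if x is inl v then radius twice_refined v else 1)
         (fun e => route twice_refined (inl @^-1: e)).

Lemma set0_not_edge : finset.set0 \notin E.
Proof. by apply/negP => /(layout_simple layoutL); rewrite cards0. Qed.

Lemma twice_refined_is_layout : is_layout E twice_refined.
Proof. by do 2!apply: refine_is_layout set0_not_edge. Qed.

Lemma twice_refined_route e : e \in E -> route twice_refined e = refine (refine (route L e)).
Proof.
move=> eE; rewrite /=; have -> // : (e == finset.set0) = false.
by apply: contraNF set0_not_edge => /eqP <-.
Qed.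

Lemma lift_edgeK (e : {set V}) : (@inl V side_vertex) @^-1: (inl @: e) = e.
Proof. by apply/setP => x; rewrite inE mem_imset //; exact: inl_inj. Qed.

Lemma side_vertex_off_ball (w : side_vertex) v z :
  vertex_ball gadget_layout (inr w) z -> ~~ vertex_ball gadget_layout (inl v) z.
Proof.
move=> wz; apply: contra (side_face_outside v (valP w)); move: wz.
rewrite /vertex_face /vertex_ball !in_ballE /face_in_ball /=.
by move: (ssval w) => [a b] /=; lia.
Qed.

Lemma side_vertex_off_route (w : side_vertex) e z : e \in E ->
  z \in route twice_refined e -> ~~ vertex_ball gadget_layout (inr w) z.
Proof.
move=> eE; have walk_e := route_sorted layoutL eE; rewrite twice_refined_route //.
exact: refine_avoids (refine_sorted walk_e) (face_centre_notin_refine _ walk_e).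
Qed.

Lemma gadget_disjoint_balls : disjoint_balls gadget_layout.
Proof.
case=> [u|w] [v|w'] z uz vz.
- by congr inl; exact: (layout_disjoint_balls twice_refined_is_layout uz vz).
- by have := side_vertex_off_ball u vz; rewrite uz.
- by have := side_vertex_off_ball v uz; rewrite vz.
congr inr; apply: val_inj; move: uz vz; rewrite /vertex_ball !in_ballE /=.
by move: (ssval w) (ssval w') => [a b] [c d] /= uz vz; congr (_, _); lia.
Qed.

Lemma gadget_is_layout : is_layout (lift_edges side_vertex E) gadget_layout.
Proof.
have layout2 := twice_refined_is_layout.
split=> [[v|w] //||_ /imsetP[e eE ->]|_ _ z /imsetP[e eE ->] /imsetP[f fE ->]].
- exact: layout_radius layout2 v.
- exact: gadget_disjoint_balls.
- have [x [y [eq_e neq_xy [walk_e uniq_e x_head y_last balls]]]] := layout_route layout2 eE.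
  exists (inl x), (inl y); split; rewrite ?(inj_eq (@inl_inj _ _)) //.
    by rewrite eq_e imsetU !imset_set1.
  have route_e : route gadget_layout (inl @: e) = route twice_refined e by rewrite /= lift_edgeK.
  split; rewrite ?route_e // => z [v|w] ze vz.
    by case: (balls z v ze vz) => -[-> ->]; [left|right].
  by rewrite (negbTE (side_vertex_off_route w eE ze)) in vz.
rewrite /= !lift_edgeK => ze zf; suff -> : e = f by [].
exact: (layout_disjoint_routes layout2 eE fE ze zf).
Qed.

Lemma drawn_gadget (EC : {set {set V}}) (S : {set V}) :
  drawn gadget_layout (lift_edges side_vertex EC) (inl @: S) =2 drawn twice_refined EC S.
Proof.
move=> p q; apply/drawnP/drawnP => -[[e eEC pq]|[v vS vpq]].
- by case/imsetP: eEC pq => e' e'EC ->; rewrite /= lift_edgeK; left; exists e'.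
- by case/imsetP: vS vpq => v' v'S ->; right; exists v'.
- by left; exists (inl @: e); rewrite ?imset_f //= lift_edgeK.
by right; exists (inl v); rewrite ?imset_f.
Qed.

Lemma gadget_cycles_separate : cycles_separate E gadget_layout.
Proof.
move=> c cycle_c; have subE := cycle_edges_sub cycle_c.
have even_c : even_chain (cycle_edges c) := cycle_edges_sum cycle_c.
have [walk walkE] := edge_walks_exist layoutL.
have [x xc] := cycle_nonempty cycle_c.
have e_c : [set x; next c x] \in cycle_edges c by apply: map_f.
have [p [q [_ _ _ pq _]]] := route_exit layoutL (subE _ e_c) (set21 _ _).
have side_in f : f \in sides p q -> f \in side_faces.
  by move=> f_side; apply/side_facesP; exists [set x; next c x], p, q; split=> //; exact: subE.
pose par := parity_sum walk (cycle_edges c).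
exists (SeqSub (side_in _ (low_side_in p q))), (SeqSub (side_in _ (high_side_in p q))),
  ((par \o ghalf) \o ghalf); split.
  move=> a b adj_ab; rewrite drawn_gadget; move: a b adj_ab.
  have set0_c : finset.set0 \notin [set e in cycle_edges c].
    by apply: contra set0_not_edge; rewrite inE => /subE.
  by do 2!apply: refine_jumps => //; exact: chain_jumps walkE _ subE even_c.
rewrite /= !ghalf_double !ghalf_centre negb_eqb.
exact: (chain_jump_at layoutL walkE subE even_c (cycle_edges_uniq cycle_c) e_c pq).
Qed.

Lemma separating_supergraph : exists (E' : {set {set V + side_vertex}}) L',
  [/\ lift_edges side_vertex E \subset E', is_layout E' L', cycles_separate E L' &
    cyclic_separators E'].
Proof.
pose P (E' : {set {set V + side_vertex}}) := (lift_edges side_vertex E \subset E') &&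
  `[< exists2 L', is_layout E' L' & cycles_separate E L' >].
have PE : P (lift_edges side_vertex E).
  rewrite /P subxx; apply/asboolP; exists gadget_layout; first exact: gadget_is_layout.
  exact: gadget_cycles_separate.
case: (arg_maxnP (fun E' : {set {set V + side_vertex}} => #|E'|) PE) =>
  E' /andP[sub /asboolP[L' layoutL' sep]] E'_max.
exists E', L'; split=> //.
case: (cyclic_separators_or_extend layoutL') => // -[a [b [s [neq_ab abE' layout_ab]]]].
have /E'_max : P ([set a; b] |: E').
  rewrite /P (subset_trans sub (subsetUr _ _)); apply/asboolP.
  exists (refine_layout L' [set a; b] s) => //; apply: cycles_separate_refine sep.
  by apply: contra abE'; exact/subsetP.
by rewrite cardsU1 abE' /= /geq /= ltnn.
Qed.

End Gadget.

Lemma robust_large_induced_forests (R : realType) :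
  robust_triangulations R -> large_induced_forests R.
Proof.
move=> robust V E simpleE planarE; have [small|large] := leqP #|V| 1.
  exists [set: V]; split; last by rewrite cardsT ler_pdivrMr // ler_peMr ?ler0n.
  exact/card_le2_forest/ltnW.
have [L layoutL] := planar_layout simpleE planarE.
have [E' [L' [subE layoutL' sep separators]]] := separating_supergraph layoutL.
have large' : (1 < #|{: V + side_vertex E L}|)%N by rewrite card_sum (leq_trans large) ?leq_addr.
have kappa := robust _ E' large' (cyclic_separators_triangulation R layoutL' separators).
have kappa_gt0 : 0 < robust_connectivity E' by apply: lt_le_trans kappa.
pose X : {set V + side_vertex E L} := inl @: [set: V].
have cardX : #|X| = #|V| by rewrite card_imset ?cardsT //; exact: inl_inj.
have X0 : X != finset.set0 by rewrite -card_gt0 cardX ltnW.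
have [T T_tree T_leaves] := robust_connectivity_tree kappa_gt0 X0.
exists [set v | inl v \in leaves T]; split.
  move=> c /is_cycle_induced[cycle_c c_leaves].
  have [x xc] := separating_cycle_not_leaves layoutL' subE T_tree cycle_c (sep c cycle_c).
  by have := c_leaves x xc; rewrite inE => ->.
have := le_trans kappa T_leaves; rewrite cardX ler_pdivlMr ?ltr0n ?(ltnW large) // mulrC.
move/le_trans; apply; rewrite ler_nat -(card_imset _ (@inl_inj V (side_vertex E L))).
apply/subset_leq_card/subsetP => y; rewrite inE => /andP[/imsetP[v _ ->] v_leaf].
by apply: imset_f; rewrite inE.
Qed.

Theorem theorem4 (R : realType) :
  (forall (V : finType) (E : {set {set V}}),
      simple_graph E -> planar R E ->
      exists F : {set V},
        induces_forest E F /\ (#|V|%:R / 2%:R <= #|F|%:R :> rat))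
  <->
  (forall (V : finType) (E : {set {set V}}),
      (1 < #|V|)%N -> planar_triangulation R E ->
      (2%:R^-1 <= robust_connectivity E :> rat)).
Proof. by split; [exact: large_induced_forests_robust|exact: robust_large_induced_forests]. Qed.
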